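(* Let $\Omega\subset\mathbb{R}^2$ be a bounded and convex domain, let $u_0$ be the solution of $-\Delta u=1$ in $\Omega$, $u=0$ on $\partial\Omega$, let $y_0\in\Omega$ be its maximum point, and suppose that the two eigenvalues $\lambda_1,\lambda_2$ of $D^2u_0(y_0)$ are equal (for example $\Omega=B(0,1)$). For small $\varepsilon>0$ let $\Omega_\varepsilon=\Omega\setminus B(y_0,\varepsilon)$, let $u_\varepsilon$ be the solution of $-\Delta u=1$ in $\Omega_\varepsilon$, $u=0$ on $\partial\Omega_\varepsilon$, and let $x_\varepsilon\in\Omega_\varepsilon$ be a maximum point of $u_\varepsilon$. Then $$\lim_{\varepsilon\to0}\lambda_{\max}\big(D^2u_\varepsilon(x_\varepsilon)\big)=0,$$ and consequently there are no constants $c_1,c_2>0$ independent of $\varepsilon$ such that $$\lambda_{\max}\big(D^2u_\varepsilon(x_\varepsilon)\big)\le -c_1\exp\left(-c_2\frac{\operatorname{diam}(\Omega_\varepsilon)}{\operatorname{inrad}(\Omega_\varepsilon)}\right)$$ holds for all small $\varepsilon>0$.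
   Context: $B(y_0,\varepsilon)$ is the ball centered at $y_0$ with radius $\varepsilon$, with $\varepsilon$ small enough that the closed ball is contained in $\Omega$. $D^2u$ is the Hessian matrix, $\lambda_{\max}(\cdot)$ the largest eigenvalue of a symmetric matrix, $\operatorname{diam}$ the diameter, and $\operatorname{inrad}$ the inradius (supremum of radii of balls contained in the domain). On a bounded convex planar domain the torsion function $u_0$ has a unique maximum point. *)

(* Defs.v *)
(* Stdlib reals and Coquelicot.  The plane is R * R; on it Coquelicot's [norm]
   is the Euclidean norm (while its [ball], used only for the topology, is a
   square). *)
From Stdlib Require Import Reals.
From Coquelicot Require Import Coquelicot.
Open Scope R_scope.

Definition plane : Type := (R * R)%type.

Definition eucl_dist (p q : plane) : R := norm (minus p q).

Definition closed_disc (c : plane) (r : R) (p : plane) : Prop := eucl_dist c p <= r.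

Definition bounded_region (D : plane -> Prop) : Prop :=
  exists M : R, forall p : plane, D p -> norm p <= M.

Definition convex (D : plane -> Prop) : Prop :=
  forall (p q : plane) (t : R), D p -> D q -> 0 <= t <= 1 ->
    D (plus (scal (1 - t) p) (scal t q)).

Definition closure (D : plane -> Prop) (p : plane) : Prop :=
  forall eps : posreal, exists q : plane, D q /\ ball p eps q.

Definition boundary (D : plane -> Prop) (p : plane) : Prop :=
  closure D p /\ closure (fun q => ~ D q) p.

Definition diam (D : plane -> Prop) : R :=
  real (Lub_Rbar (fun d => exists p q : plane, D p /\ D q /\ d = eucl_dist p q)).

Definition inrad (D : plane -> Prop) : R :=
  real (Lub_Rbar (fun r =>
    0 < r /\ exists c : plane, forall p : plane, eucl_dist c p < r -> D p)).

(* The closed disc is removed, so that the perforated set is again open. *)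
Definition perforated (D : plane -> Prop) (c : plane) (r : R) (p : plane) : Prop :=
  D p /\ ~ closed_disc c r p.

Definition d1 (u : plane -> R) (p : plane) : R :=
  Derive (fun s => u (s, snd p)) (fst p).

Definition d2 (u : plane -> R) (p : plane) : R :=
  Derive (fun s => u (fst p, s)) (snd p).

Definition C1_on (D : plane -> Prop) (u : plane -> R) : Prop :=
  forall p : plane, D p ->
    ex_derive (fun s => u (s, snd p)) (fst p) /\
    ex_derive (fun s => u (fst p, s)) (snd p) /\
    continuous (d1 u) p /\ continuous (d2 u) p.

Definition C2_on (D : plane -> Prop) (u : plane -> R) : Prop :=
  C1_on D u /\ C1_on D (d1 u) /\ C1_on D (d2 u).

Definition laplacian (u : plane -> R) (p : plane) : R :=
  d1 (d1 u) p + d2 (d2 u) p.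

(* Classical solution, in C^2(D) and C(closure D), of - Delta u = 1 in D and
   u = 0 on the boundary; the values of u off the closure of D are irrelevant. *)
Definition torsion_function (D : plane -> Prop) (u : plane -> R) : Prop :=
  C2_on D u /\
  continuous_on (closure D) u /\
  (forall p : plane, D p -> - laplacian u p = 1) /\
  (forall p : plane, boundary D p -> u p = 0).

Definition max_point (D : plane -> Prop) (u : plane -> R) (p : plane) : Prop :=
  D p /\ forall q : plane, D q -> u q <= u p.

Record mat2 : Type := Mat2 { m11 : R; m12 : R; m21 : R; m22 : R }.

Definition mat2_mulv (A : mat2) (v : plane) : plane :=
  (m11 A * fst v + m12 A * snd v, m21 A * fst v + m22 A * snd v).

Definition char_poly2 (A : mat2) (t : R) : R :=
  (t - m11 A) * (t - m22 A) - m12 A * m21 A.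

Definition is_eigenvalue (A : mat2) (l : R) : Prop :=
  exists v : plane, v <> zero /\ mat2_mulv A v = scal l v.

(* l1, l2 are the two eigenvalues of A, listed with multiplicity. *)
Definition eigenvalue_pair (A : mat2) (l1 l2 : R) : Prop :=
  forall t : R, char_poly2 A t = (t - l1) * (t - l2).

(* The largest eigenvalue: for a symmetric matrix the set of eigenvalues is
   finite and nonempty, so that its supremum is its maximum. *)
Definition lambda_max (A : mat2) : R := real (Lub_Rbar (is_eigenvalue A)).

Definition hessian (u : plane -> R) (p : plane) : mat2 :=
  Mat2 (d1 (d1 u) p) (d1 (d2 u) p) (d2 (d1 u) p) (d2 (d2 u) p).

(* Main.v *)
Require Import Defs.
From Stdlib Require Import Reals Lra Lia ClassicalEpsilon.
From Coquelicot Require Import Coquelicot.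
(* Restores [d1] and [d2], which are also names of the real analysis library. *)
Import Defs.
Open Scope R_scope.

(** Write [c] for the maximum point of the torsion function [u0] of [D], [M] for
    its maximum, [r] for the distance to [c], and [L = ln (R0 / e)] with [D] in
    the disc of radius [R0] around [c].  Since the eigenvalues of the Hessian at
    [c] agree and have sum [-1], [u0] is close to the radial function
    [M - r^2 / 4].  For the torsion function [u] of the domain perforated at [c]
    with radius [e], the difference [v = u0 - u] is harmonic, vanishes on the
    outer boundary and equals [u0], about [M], on the small circle, so that it is
    roughly [(M / L) ln (1 / r)].  The sum [M - r^2 / 4 - (M / L) ln (1 / r)] of
    the leading parts of [u] is radial, and at its critical radius, where [r^2]
    is about [2 M / L], its second derivative in the tangential direction is
    zero: for a radial function it is the radial derivative divided by [r].  The
    claim is that the error terms do not spoil this.  All of them are controlled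
    by maximum principles, as follows.

    At a maximum point [x] of [u] the gradient of [u] vanishes, so the tangential
    second derivative is [u_tt / r^2], where [t] is the polar angle.  The part of
    [u_tt] due to [u0] is [o(r^2)].  For [v], the odd reflection
    [v (s, t + h) - v (s, t - h)] in polar coordinates is harmonic and bounded by
    [O(1 / L) h] at a fixed distance from [c]; comparison with the linear function
    [r sin h] gives the bound [O(1 / L) r h] all the way down to the small circle
    ([strip_difference]), and an interior gradient estimate turns this into
    [v_tt = O(r / L)] ([strip_second_derivative]).  Therefore
    [lambda_max >= - o(1) - O(1 / (L r))], while [lambda_max <= 0] because [x] is a
    maximum ([lambda_max_bounds]).

    It remains to see that [r] tends to [0] but [L r] to infinity.  Logarithmic
    barriers ([difference_upper], [difference_lower]) bound [v] from both sides.
    Comparing [u x] with the value of [u] at distance [L^(-1/2)] shows that [r] is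
    at least a constant times [L^(-2/3)] ([max_points_distance]).  Comparison
    with points near [c] also shows that [u0 x] tends to [M], so that [r] tends to [0]
    ([max_points_converge]) once the maximum point of [u0] is known to be unique
    ([torsion_strict_max]).  This is where convexity enters: the cube root of [u0]
    is concave ([cbrt_torsion_midpoint_concave]).  The exponent 1/3 is below the optimal 1/2 so that the root leaves the boundary
    with infinite slope even at corners of the domain, which keeps the
    maximum of the two-point concavity defect away from the boundary.

    The second claim follows, since diameter over inradius stays bounded. *)

(** * One-variable calculus of second-order jets *)

(** The derivative exists near [x] and is itself differentiable at [x].  This is
    what maximum principles use, and it is stable under composition, unlike
    statements about nested [Derive]. *)
Definition jet2 (f : R -> R) (x a b : R) : Prop :=
  exists f' : R -> R, f' x = a /\ locally x (fun y => is_derive f y (f' y)) /\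
    is_derive f' x b.

Lemma jet2_ext_loc (f g : R -> R) (x a b : R) :
  locally x (fun y => f y = g y) -> jet2 f x a b -> jet2 g x a b.
Proof.
  intros E [f' [H1 [H2 H3]]]. exists f'. split; [exact H1|split; [|exact H3]].
  apply locally_locally in E.
  generalize (filter_and _ _ E H2). apply filter_imp. intros y [Ey Hy].
  now apply is_derive_ext_loc with f.
Qed.

Lemma jet2_eq (f : R -> R) (x a b a' b' : R) :
  jet2 f x a b -> a = a' -> b = b' -> jet2 f x a' b'.
Proof. now intros H <- <-. Qed.

Lemma jet2_derive (f : R -> R) (x a b : R) : jet2 f x a b -> is_derive f x a.
Proof. intros [f' [H1 [H2 H3]]]. rewrite <- H1. now apply locally_singleton in H2. Qed.

Lemma jet2_const (c x : R) : jet2 (fun _ => c) x 0 0.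
Proof.
  exists (fun _ => 0). split; [reflexivity|split].
  - apply filter_forall. intros y. auto_derive; auto.
  - auto_derive; auto.
Qed.

Lemma jet2_plus (f g : R -> R) (x a b c d : R) :
  jet2 f x a b -> jet2 g x c d -> jet2 (fun y => f y + g y) x (a + c) (b + d).
Proof.
  intros [f' [H1 [H2 H3]]] [g' [G1 [G2 G3]]].
  exists (fun y => f' y + g' y). split; [now rewrite H1, G1|split].
  - generalize (filter_and _ _ H2 G2). apply filter_imp. intros y [Hy Gy].
    now apply @is_derive_plus.
  - now apply @is_derive_plus.
Qed.

Lemma jet2_scal (k : R) (f : R -> R) (x a b : R) :
  jet2 f x a b -> jet2 (fun y => k * f y) x (k * a) (k * b).
Proof.
  intros [f' [H1 [H2 H3]]].
  exists (fun y => k * f' y). split; [now rewrite H1|split].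
  - revert H2. apply filter_imp. intros y Hy. now apply @is_derive_scal.
  - now apply @is_derive_scal.
Qed.

Lemma jet2_minus (f g : R -> R) (x a b c d : R) :
  jet2 f x a b -> jet2 g x c d -> jet2 (fun y => f y - g y) x (a - c) (b - d).
Proof.
  intros Hf Hg. apply jet2_eq with (a + -1 * c) (b + -1 * d); try ring.
  apply jet2_ext_loc with (fun y => f y + -1 * g y).
  - apply filter_forall; intros; ring.
  - apply jet2_plus; auto. now apply jet2_scal.
Qed.

Lemma jet2_comp (g f : R -> R) (x a b c d : R) :
  jet2 g (f x) c d -> jet2 f x a b ->
  jet2 (fun s => g (f s)) x (c * a) (d * a ^ 2 + c * b).
Proof.
  intros [g' [G1 [G2 G3]]] [f' [H1 [H2 H3]]].
  pose proof (locally_singleton _ _ H2) as Hx. cbv beta in Hx.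
  exists (fun s => g' (f s) * f' s).
  split; [now rewrite G1, H1|split].
  - assert (C : continuous f x).
    { apply (@ex_derive_continuous R_AbsRing R_NormedModule). now exists (f' x). }
    assert (L : locally x (fun s => is_derive g (f s) (g' (f s)))) by exact (C _ G2).
    generalize (filter_and _ _ L H2). apply filter_imp. intros y [Gy Hy].
    rewrite Rmult_comm. now apply (is_derive_comp g f).
  - evar_last.
    { apply (is_derive_mult (fun s => g' (f s)) f').
      - apply (is_derive_comp g' f); [exact G3|exact Hx].
      - exact H3.
      - intros; apply Rmult_comm. }
    unfold plus, mult, scal; simpl. unfold mult; simpl. rewrite G1, H1. ring.
Qed.

Lemma jet2_line (c k t : R) : jet2 (fun s => c + k * s) t k 0.
Proof.
  exists (fun _ => k). split; [reflexivity|split].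
  - apply filter_forall. intros y. auto_derive; auto; ring.
  - auto_derive; auto.
Qed.

Lemma jet2_affine (f : R -> R) (x k t a b : R) :
  jet2 f (x + k * t) a b -> jet2 (fun s => f (x + k * s)) t (k * a) (k ^ 2 * b).
Proof.
  intros J. apply jet2_eq with (a * k) (b * k ^ 2 + a * 0); try ring.
  apply (jet2_comp f (fun s => x + k * s)); auto. apply jet2_line.
Qed.

Lemma mvt (f f' : R -> R) (a b : R) :
  a <= b -> (forall y, a <= y <= b -> is_derive f y (f' y)) ->
  exists c, a <= c <= b /\ f b - f a = f' c * (b - a).
Proof.
  intros Hab H. destruct (MVT_gen f a b f') as [c Hc].
  - intros y. rewrite Rmin_left, Rmax_right; try lra. intros Hy. apply H; lra.
  - intros y. rewrite Rmin_left, Rmax_right; try lra. intros Hy.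
    apply continuity_pt_filterlim.
    apply (@ex_derive_continuous R_AbsRing R_NormedModule). exists (f' y).
    apply H; lra.
  - rewrite Rmin_left, Rmax_right in Hc by lra. now exists c.
Qed.

(** Second derivative test: if [b > 0] then [f'] is positive just to the right
    of its zero [x], so that [f] increases there. *)
Lemma jet2_max (f : R -> R) (x a b : R) :
  jet2 f x a b -> locally x (fun y => f y <= f x) -> a = 0 /\ b <= 0.
Proof.
  intros J [d Hd].
  assert (E : a = 0).
  { pose proof (jet2_derive _ _ _ _ J) as D. apply is_derive_Reals in D.
    assert (D0 : derivable_pt f x) by (exists a; exact D).
    rewrite <- (derive_pt_eq_0 _ _ _ D0 D).
    apply (deriv_maximum f (x - d) (x + d)).
    - destruct d; simpl; lra.
    - destruct d; simpl; lra.
    - intros y y1 y2. apply Hd. apply Rabs_def1; unfold minus, plus, opp; simpl; lra. }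
  split; auto. subst a.
  destruct J as [f' [H1 [[d' Hd'] H3]]].
  apply Rnot_lt_le. intros Hb.
  apply is_derive_Reals in H3.
  destruct (H3 (b / 2)) as [d2 H2]; [lra|].
  pose (h := Rmin d (Rmin d' d2) / 2).
  assert (hp : 0 < h /\ h < d /\ h < d' /\ h < d2).
  { unfold h. destruct d as [d dp], d' as [d' dp'], d2 as [d2 dp2]; simpl.
    assert (0 < Rmin d (Rmin d' d2)) by (repeat apply Rmin_pos; auto).
    pose proof (Rmin_l d (Rmin d' d2)). pose proof (Rmin_r d (Rmin d' d2)).
    pose proof (Rmin_l d' d2). pose proof (Rmin_r d' d2). lra. }
  assert (Dn : forall y, x <= y <= x + h -> is_derive f y (f' y)).
  { intros y Hy. apply Hd'. apply Rabs_def1; unfold minus, plus, opp; simpl; lra. }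
  assert (Pn : forall y, x <= y <= x + h -> 0 <= f' y /\ (x < y -> 0 < f' y)).
  { intros y Hy. destruct (Req_dec y x) as [->|Hyx]; [rewrite H1; lra|].
    specialize (H2 (y - x) ltac:(lra)).
    assert (Hy2 : Rabs (y - x) < d2) by (apply Rabs_def1; lra).
    specialize (H2 Hy2). replace (x + (y - x)) with y in H2 by ring.
    rewrite H1 in H2. apply Rabs_def2 in H2.
    assert (Q : 0 < (f' y - 0) / (y - x)) by lra.
    assert (0 < f' y); [|lra].
    replace (f' y) with ((f' y - 0) / (y - x) * (y - x)) by (field; lra).
    apply Rmult_lt_0_compat; lra. }
  (* Two halves, because [f'] is only nonnegative at the left end point. *)
  destruct (mvt f f' x (x + h / 2)) as [c [Hc Ec]]; [lra|intros; apply Dn; lra|].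
  destruct (mvt f f' (x + h / 2) (x + h)) as [c' [Hc' Ec']]; [lra|intros; apply Dn; lra|].
  assert (0 <= f' c) by (apply Pn; lra).
  assert (0 < f' c') by (apply Pn; lra).
  assert (f (x + h) <= f x).
  { apply Hd. apply Rabs_def1; unfold minus, plus, opp; simpl; lra. }
  assert (0 <= f' c * (x + h / 2 - x)) by (apply Rmult_le_pos; lra).
  assert (0 < f' c' * (x + h - (x + h / 2))) by (apply Rmult_lt_0_compat; lra).
  lra.
Qed.

(** A bound on symmetric second differences passes to the second derivative:
    [f (x + h) + f (x - h) - B h^2] is maximal at [h = 0]. *)
Lemma jet2_second_difference (f : R -> R) (x a b B : R) :
  jet2 f x a b ->
  locally 0 (fun h => f (x + h) + f (x - h) - 2 * f x <= B * h ^ 2) -> b <= B.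
Proof.
  intros J H.
  assert (J1 : jet2 (fun h => f (x + 1 * h)) 0 (1 * a) (1 ^ 2 * b)).
  { apply jet2_affine. now replace (x + 1 * 0) with x by ring. }
  assert (J2 : jet2 (fun h => f (x + -1 * h)) 0 (-1 * a) ((-1) ^ 2 * b)).
  { apply jet2_affine. now replace (x + -1 * 0) with x by ring. }
  assert (J3 : jet2 (fun h => B * (h * h)) 0 (B * 0) (B * 2)).
  { apply (jet2_scal B (fun h => h * h)). exists (fun h => 2 * h).
    split; [ring|split].
    - apply filter_forall. intros y. auto_derive; auto; ring.
    - auto_derive; auto; ring. }
  pose proof (jet2_minus _ _ _ _ _ _ _ (jet2_plus _ _ _ _ _ _ _ J1 J2) J3) as J4.
  apply jet2_max in J4.
  - lra.
  - revert H. apply filter_imp. intros h Hh.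
    replace (x + 1 * h) with (x + h) by ring.
    replace (x + -1 * h) with (x - h) by ring.
    replace (x + 1 * 0) with x by ring.
    replace (x + -1 * 0) with x by ring. lra.
Qed.

(** * Chain rule along plane curves *)

Lemma C1_on_chain (D : plane -> Prop) (u : plane -> R) (a b : R -> R) (t a' b' : R) :
  open D -> C1_on D u -> D (a t, b t) -> is_derive a t a' -> is_derive b t b' ->
  is_derive (fun s => u (a s, b s)) t (d1 u (a t, b t) * a' + d2 u (a t, b t) * b').
Proof.
  intros Dop HC Dp Ha Hb.
  assert (F : filterdiff (fun z : R * R => (fun x y => u (x, y)) (fst z) (snd z))
     (locally (a t, b t))
     (fun z => plus (scal (fst z) (d1 u (a t, b t))) (scal (snd z) (d2 u (a t, b t))))).
  { apply (is_derive_filterdiff (fun x y => u (x, y)) (a t) (b t)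
      (fun x y => d1 u (x, y)) (d2 u (a t, b t))).
    - generalize (Dop _ Dp). apply filter_imp. intros [x y] Dxy. simpl.
      apply Derive_correct. exact (proj1 (HC _ Dxy)).
    - apply Derive_correct. exact (proj1 (proj2 (HC _ Dp))).
    - apply continuous_ext with (d1 u); [now intros [x y]|].
      exact (proj1 (proj2 (proj2 (HC _ Dp)))). }
  pose proof (filterdiff_comp'_2 a b (fun x y => u (x, y)) t _ _
    (fun x y => plus (scal x (d1 u (a t, b t))) (scal y (d2 u (a t, b t)))) Ha Hb F) as G.
  unfold is_derive. refine (filterdiff_ext_lin _ _ _ G _).
  intros y. unfold plus, scal; simpl. unfold mult; simpl. ring.
Qed.

Lemma C1_on_continuous (D : plane -> Prop) (u : plane -> R) (p : plane) :
  open D -> C1_on D u -> D p -> continuous u p.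
Proof.
  intros Dop HC Dp. destruct p as [x y].
  apply continuous_ext with (fun z : R * R => (fun x y => u (x, y)) (fst z) (snd z)).
  { now intros [? ?]. }
  apply (@filterdiff_continuous R_AbsRing (prod_NormedModule R_AbsRing R_NormedModule R_NormedModule)).
  eexists.
  apply (is_derive_filterdiff (fun x y => u (x, y)) x y
      (fun x y => d1 u (x, y)) (d2 u (x, y))).
  - generalize (Dop _ Dp). apply filter_imp. intros [x' y'] Dxy. simpl.
    apply Derive_correct. exact (proj1 (HC _ Dxy)).
  - apply Derive_correct. exact (proj1 (proj2 (HC _ Dp))).
  - apply continuous_ext with (d1 u); [now intros [? ?]|].
    exact (proj1 (proj2 (proj2 (HC _ Dp)))).
Qed.

(** The chain rule, applied to [u] and then to its two partial derivatives, which
    are of class C1 again. *)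
Lemma jet2_curve (D : plane -> Prop) (u : plane -> R) (a b : R -> R)
  (t a' b' a'' b'' : R) (p : plane) :
  open D -> C2_on D u -> D p -> p = (a t, b t) -> jet2 a t a' a'' -> jet2 b t b' b'' ->
  jet2 (fun s => u (a s, b s)) t
    (d1 u p * a' + d2 u p * b')
    (d1 (d1 u) p * a' ^ 2 + (d1 (d2 u) p + d2 (d1 u) p) * (a' * b')
      + d2 (d2 u) p * b' ^ 2 + d1 u p * a'' + d2 u p * b'').
Proof.
  intros Dop [C [C1 C2]] Dp Ep [fa [A1 [A2 A3]]] [fb [B1 [B2 B3]]]. subst p.
  pose proof (locally_singleton _ _ A2) as At. pose proof (locally_singleton _ _ B2) as Bt.
  cbv beta in At, Bt. rewrite A1 in At. rewrite B1 in Bt.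
  exists (fun s => d1 u (a s, b s) * fa s + d2 u (a s, b s) * fb s).
  split; [now rewrite A1, B1|split].
  - assert (L : locally t (fun s => D (a s, b s))).
    { assert (Cab : filterlim (fun s => (a s, b s)) (locally t) (locally (a t, b t))).
      { apply (filterlim_filter_le_2 (F := locally t) (G := filter_prod (locally (a t)) (locally (b t)))).
        - intros P [e He]. apply (Filter_prod _ _ _ (ball (a t) e) (ball (b t) e)); try apply locally_ball.
          intros x y Hx Hy. apply He. now split.
        - apply filterlim_pair.
          + apply (@ex_derive_continuous R_AbsRing R_NormedModule). now exists a'.
          + apply (@ex_derive_continuous R_AbsRing R_NormedModule). now exists b'. }
      apply Cab. exact (Dop _ Dp). }
    generalize (filter_and _ _ L (filter_and _ _ A2 B2)). apply filter_imp.
    intros s [Ds [As Bs]]. now apply C1_on_chain with D.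
  - assert (E1 := C1_on_chain D (d1 u) a b t a' b' Dop C1 Dp At Bt).
    assert (E2 := C1_on_chain D (d2 u) a b t a' b' Dop C2 Dp At Bt).
    evar_last.
    { apply @is_derive_plus.
      - apply @is_derive_mult; [exact E1|exact A3|intros; apply Rmult_comm].
      - apply @is_derive_mult; [exact E2|exact B3|intros; apply Rmult_comm]. }
    unfold plus, mult; simpl. rewrite A1, B1. ring.
Qed.

(** * Extreme values by sequential compactness *)

(** Sequential compactness passes to products, which gives extreme values for
    functions of one or of two points of the plane alike. *)
Definition seq_compact {T : UniformSpace} (K : T -> Prop) : Prop :=
  forall s : nat -> T, (forall n, K (s n)) ->
    exists (phi : nat -> nat) (l : T),
      filterlim phi eventually eventually /\ K l /\
      filterlim (fun n => s (phi n)) eventually (locally l).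

Lemma real_subsequence (s : nat -> R) (M : R) :
  (forall n, Rabs (s n) <= M) ->
  exists (phi : nat -> nat) (l : R), filterlim phi eventually eventually /\
    filterlim (fun n => s (phi n)) eventually (locally l).
Proof.
  intros HM.
  destruct (Bolzano_Weierstrass s (fun x => - M <= x <= M)) as [l Hl].
  { apply compact_P3. }
  { intros n. apply Rabs_le_between, HM. }
  assert (A : forall n, exists p, (n <= p)%nat /\ Rabs (s p - l) < / (INR n + 1)).
  { intros n. apply (Hl (disc l (mkposreal _ (RinvN_pos n)))).
    exists (mkposreal _ (RinvN_pos n)). now intros y Hy. }
  exists (fun n => proj1_sig (constructive_indefinite_description _ (A n))), l.
  split.
  - intros P [N HN]. exists N. intros n Hn.
    destruct (constructive_indefinite_description _ (A n)) as [p [H1 H2]]; simpl.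
    apply HN. lia.
  - intros P [e He]. destruct (archimed_cor1 e (cond_pos e)) as [N [HN HN']].
    exists N. intros n Hn.
    destruct (constructive_indefinite_description _ (A n)) as [p [H1 H2]]; simpl.
    apply He. unfold ball; simpl; unfold AbsRing_ball; simpl.
    apply Rlt_trans with (1 := H2). apply Rle_lt_trans with (2 := HN).
    apply Rinv_le_contravar.
    + now apply lt_0_INR.
    + apply le_INR in Hn. lra.
Qed.

Lemma filterlim_plane {T : Type} (F : (T -> Prop) -> Prop) {FF : Filter F}
  {U V : UniformSpace} (f : T -> U) (g : T -> V) (x : U) (y : V) :
  filterlim f F (locally x) -> filterlim g F (locally y) ->
  filterlim (fun t => (f t, g t)) F (locally (x, y)).
Proof.
  intros Hf Hg P [e He].
  assert (H1 : F (fun t => ball x e (f t))) by exact (Hf _ (locally_ball x e)).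
  assert (H2 : F (fun t => ball y e (g t))) by exact (Hg _ (locally_ball y e)).
  generalize (filter_and _ _ H1 H2). unfold filtermap. apply filter_imp. intros t [B1 B2]. apply He. now split.
Qed.

Lemma seq_compact_interval (a b : R) : seq_compact (fun x => a <= x <= b).
Proof.
  intros s Hs.
  destruct (real_subsequence s (Rmax (Rabs a) (Rabs b))) as [phi [l [H1 H2]]].
  { intros n. specialize (Hs n). now apply RmaxAbs. }
  exists phi, l. split; [exact H1|split; [|exact H2]].
  split.
  - apply (is_lim_seq_le (fun _ => a) (fun n => s (phi n)) a l).
    + intros n. apply Hs.
    + apply is_lim_seq_const.
    + exact H2.
  - apply (is_lim_seq_le (fun n => s (phi n)) (fun _ => b) l b).
    + intros n. apply Hs.
    + exact H2.
    + apply is_lim_seq_const.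
Qed.

Lemma seq_compact_prod {T U : UniformSpace} (A : T -> Prop) (B : U -> Prop) :
  seq_compact A -> seq_compact B -> seq_compact (fun z : T * U => A (fst z) /\ B (snd z)).
Proof.
  intros HA HB s Hs.
  destruct (HA (fun n => fst (s n))) as [phi [l [H1 [H2 H3]]]]; [intros n; apply Hs|].
  destruct (HB (fun n => snd (s (phi n)))) as [psi [m [G1 [G2 G3]]]]; [intros n; apply Hs|].
  exists (fun n => phi (psi n)), (l, m). split; [|split].
  - now apply filterlim_comp with (2 := H1).
  - now split.
  - apply filterlim_ext with (fun n => (fst (s (phi (psi n))), snd (s (phi (psi n))))).
    { intros n. now destruct (s (phi (psi n))). }
    apply filterlim_plane; try typeclasses eauto; auto.
    now apply (filterlim_comp _ _ _ psi (fun n => fst (s (phi n))) _ _ _ G1).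
Qed.

Lemma Rabs_ball (x y e : R) : ball x e y -> Rabs (y - x) < e.
Proof. intros H; exact H. Qed.

Lemma Rabs_near (x y e M : R) : ball x e y -> Rabs y <= M -> Rabs x <= M + e.
Proof.
  intros H Hy. apply Rabs_ball in H. rewrite Rabs_minus_sym in H.
  pose proof (Rabs_triang_inv x y). lra.
Qed.

Lemma plane_norm (p : plane) : norm p = sqrt (fst p ^ 2 + snd p ^ 2).
Proof.
  unfold norm; simpl. unfold prod_norm; simpl. unfold norm; simpl. unfold abs; simpl.
  f_equal. rewrite !Rmult_1_r, <- !Rabs_mult, !Rabs_pos_eq; try ring; apply Rle_0_sqr.
Qed.

Lemma Rabs_le_plane_norm (x y : R) : Rabs x <= sqrt (x ^ 2 + y ^ 2) /\ Rabs y <= sqrt (x ^ 2 + y ^ 2).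
Proof.
  rewrite <- !sqrt_Rsqr_abs. split; apply sqrt_le_1_alt; unfold Rsqr; nra.
Qed.

Lemma seq_compact_closure (D : plane -> Prop) : bounded_region D -> seq_compact (closure D).
Proof.
  intros [M HM] s Hs.
  assert (Bd : forall n, Rabs (fst (s n)) <= M + 1 /\ Rabs (snd (s n)) <= M + 1).
  { intros n. destruct (Hs n (mkposreal 1 Rlt_0_1)) as [q [Dq [B1 B2]]].
    specialize (HM q Dq). rewrite plane_norm in HM.
    destruct (Rabs_le_plane_norm (fst q) (snd q)) as [E1 E2].
    split; [apply Rabs_near with (fst q)|apply Rabs_near with (snd q)]; auto;
      eapply Rle_trans; eassumption. }
  destruct (real_subsequence (fun n => fst (s n)) (M + 1)) as [phi [l [H1 H2]]]; [intros; apply Bd|].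
  destruct (real_subsequence (fun n => snd (s (phi n))) (M + 1)) as [psi [m [G1 G2]]]; [intros; apply Bd|].
  assert (L : filterlim (fun n => s (phi (psi n))) eventually (locally ((l, m) : plane))).
  { apply filterlim_ext with (fun n => (fst (s (phi (psi n))), snd (s (phi (psi n))))).
    { intros n. now destruct (s (phi (psi n))). }
    apply filterlim_plane; try typeclasses eauto; auto.
    now apply (filterlim_comp _ _ _ psi (fun n => fst (s (phi n))) _ _ _ G1). }
  exists (fun n => phi (psi n)), (l, m). split; [|split; [|exact L]].
  - now apply filterlim_comp with (2 := H1).
  - intros e. pose (e2 := pos_div_2 e).
    destruct (L _ (locally_ball _ e2)) as [N HN]. specialize (HN N (Nat.le_refl N)).
    destruct (Hs (phi (psi N)) e2) as [q [Dq Bq]].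
    exists q. split; auto.
    replace (pos e) with (e2 + e2) by (unfold e2; simpl; lra).
    now apply ball_triangle with (s (phi (psi N))).
Qed.

Lemma extreme_value {T : UniformSpace} (K : T -> Prop) (f : T -> R) :
  seq_compact K -> (exists x, K x) -> continuous_on K f ->
  exists x, K x /\ forall y, K y -> f y <= f x.
Proof.
  intros HK [x0 Kx0] Hf.
  assert (A : forall n : nat, exists x, K x /\
     forall y, K y -> f y <= f x + / (INR n + 1) \/ INR n <= f x).
  { intros n. destruct (Lub_Rbar_correct (fun v => exists x, K x /\ v = f x)) as [U L].
    set (l := Lub_Rbar _) in *.
    assert (P := RinvN_pos n).
    destruct l as [l| |].
    - destruct (classic (exists x, K x /\ l - / (INR n + 1) < f x)) as [[x [Kx Hx]]|N].
      + exists x. split; auto. intros y Ky. left.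
        assert (Rbar_le (f y) l) by (apply U; eauto). simpl in H. lra.
      + exfalso. assert (Rbar_le l (l - / (INR n + 1))).
        { apply L. intros v [x [Kx ->]]. apply Rnot_lt_le. intros Hx. apply N; eauto. }
        simpl in H. lra.
    - destruct (classic (exists x, K x /\ INR n < f x)) as [[x [Kx Hx]]|N].
      + exists x. split; auto. intros y Ky. right. lra.
      + exfalso. assert (Rbar_le p_infty (INR n)).
        { apply L. intros v [x [Kx ->]]. apply Rnot_lt_le. intros Hx. apply N; eauto. }
        exact H.
    - exfalso. assert (Rbar_le (f x0) m_infty) by (apply U; eauto). exact H. }
  pose (s := fun n => proj1_sig (constructive_indefinite_description _ (A n))).
  assert (Ps : forall n, K (s n) /\
     forall y, K y -> f y <= f (s n) + / (INR n + 1) \/ INR n <= f (s n)).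
  { intros n. exact (proj2_sig (constructive_indefinite_description _ (A n))). }
  clearbody s. clear A.
  destruct (HK s) as [phi [l [H1 [H2 H3]]]]; [intros; apply Ps|].
  exists l. split; auto. intros y Ky. apply Rnot_lt_le. intros Hlt.
  assert (F : filterlim (fun n => f (s (phi n))) eventually (locally (f l))).
  { apply filterlim_comp with (within K (locally l)); [|now apply Hf].
    intros P HP. unfold within in HP.
    assert (E : eventually (fun n => K (s (phi n)) -> P (s (phi n)))) by exact (H3 _ HP).
    revert E. unfold filtermap. apply filter_imp. intros n Hn. apply Hn, Ps. }
  assert (e1 : 0 < (f y - f l) / 2) by lra.
  destruct (F _ (locally_ball (f l) (mkposreal _ e1))) as [N1 HN1].
  destruct (archimed_cor1 ((f y - f l) / 2) e1) as [N2 [HN2 HN2']].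
  destruct (nfloor_ex (Rabs (f y))) as [N3 HN3]; [apply Rabs_pos|].
  assert (Q : eventually (fun n => (N2 <= n /\ N3 + 1 <= n)%nat)).
  { exists (N2 + N3 + 1)%nat. intros; lia. }
  destruct (H1 _ Q) as [N4 HN4].
  pose (n := (N1 + N4)%nat).
  specialize (HN1 n ltac:(unfold n; lia)). specialize (HN4 n ltac:(unfold n; lia)).
  apply Rabs_ball in HN1. simpl in HN1.
  apply Rabs_def2 in HN1.
  destruct HN4 as [Q1 Q2]. apply le_INR in Q1. apply le_INR in Q2. rewrite plus_INR in Q2.
  simpl in Q2.
  destruct (proj2 (Ps (phi n)) y Ky) as [E|E].
  - assert (/ (INR (phi n) + 1) < (f y - f l) / 2).
    { apply Rle_lt_trans with (2 := HN2). apply Rinv_le_contravar; [now apply lt_0_INR|lra]. }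
    lra.
  - pose proof (Rle_abs (f y)). lra.
Qed.

Lemma continuous_on_of_continuous {T U : UniformSpace} (K : T -> Prop) (f : T -> U) :
  (forall x, K x -> continuous f x) -> continuous_on K f.
Proof.
  intros H x Kx. apply filterlim_filter_le_1 with (2 := H x Kx).
  intros P HP. unfold within. revert HP. now apply filter_imp.
Qed.

(** * The weak maximum principle *)

Definition has_lap (w : plane -> R) (p : plane) (l : R) : Prop :=
  exists a' a b' b, jet2 (fun s => w (s, snd p)) (fst p) a' a /\
    jet2 (fun t => w (fst p, t)) (snd p) b' b /\ a + b = l.

Lemma has_lap_ext (w w' : plane -> R) (p : plane) (l l' : R) :
  (forall q, w q = w' q) -> l = l' -> has_lap w p l -> has_lap w' p l'.
Proof.
  intros E <- [a' [a [b' [b [H1 [H2 H3]]]]]]. exists a', a, b', b.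
  split; [|split]; auto.
  - apply jet2_ext_loc with (2 := H1). apply filter_forall. intros; apply E.
  - apply jet2_ext_loc with (2 := H2). apply filter_forall. intros; apply E.
Qed.

Lemma has_lap_plus (w z : plane -> R) (p : plane) (l m : R) :
  has_lap w p l -> has_lap z p m -> has_lap (fun q => w q + z q) p (l + m).
Proof.
  intros [a' [a [b' [b [H1 [H2 <-]]]]]] [c' [c [d' [d [G1 [G2 <-]]]]]].
  exists (a' + c'), (a + c), (b' + d'), (b + d). split; [|split]; try ring.
  - exact (jet2_plus _ _ _ _ _ _ _ H1 G1).
  - exact (jet2_plus _ _ _ _ _ _ _ H2 G2).
Qed.

Lemma has_lap_scal (k : R) (w : plane -> R) (p : plane) (l : R) :
  has_lap w p l -> has_lap (fun q => k * w q) p (k * l).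
Proof.
  intros [a' [a [b' [b [H1 [H2 <-]]]]]].
  exists (k * a'), (k * a), (k * b'), (k * b). split; [|split]; try ring.
  - exact (jet2_scal _ _ _ _ _ H1).
  - exact (jet2_scal _ _ _ _ _ H2).
Qed.

Lemma has_lap_minus (w z : plane -> R) (p : plane) (l m : R) :
  has_lap w p l -> has_lap z p m -> has_lap (fun q => w q - z q) p (l - m).
Proof.
  intros H G. apply has_lap_ext with (fun q => w q + -1 * z q) (l + -1 * m).
  - intros; ring.
  - ring.
  - apply has_lap_plus; auto. now apply has_lap_scal.
Qed.

Lemma has_lap_const (c : R) (p : plane) : has_lap (fun _ => c) p 0.
Proof.
  exists 0, 0, 0, 0. split; [|split]; try apply jet2_const. ring.
Qed.

Definition dist2 (c q : plane) : R := (fst q - fst c) ^ 2 + (snd q - snd c) ^ 2.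

Lemma dist2_ge_0 (c q : plane) : 0 <= dist2 c q.
Proof. apply Rplus_le_le_0_compat; apply pow2_ge_0. Qed.

Lemma jet2_square (c x : R) : jet2 (fun s => (s - c) ^ 2) x (2 * (x - c)) 2.
Proof.
  exists (fun s => 2 * (s - c)). split; [reflexivity|split].
  - apply filter_forall. intros y. auto_derive; auto; ring.
  - auto_derive; auto; ring.
Qed.

Lemma has_lap_dist2 (c p : plane) : has_lap (dist2 c) p 4.
Proof.
  exists (2 * (fst p - fst c) + 0), (2 + 0), (0 + 2 * (snd p - snd c)), (0 + 2).
  simpl fst; simpl snd. split; [|split]; try ring.
  - apply (jet2_plus (fun s => (s - fst c) ^ 2) (fun _ => (snd p - snd c) ^ 2)).
    + apply jet2_square.
    + apply jet2_const.
  - apply (jet2_plus (fun _ => (fst p - fst c) ^ 2) (fun s => (s - snd c) ^ 2)).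
    + apply jet2_const.
    + apply jet2_square.
Qed.

Lemma has_lap_C2 (D : plane -> Prop) (u : plane -> R) (p : plane) :
  open D -> C2_on D u -> D p -> has_lap u p (laplacian u p).
Proof.
  intros Dop HC Dp. destruct p as [x y]. unfold has_lap, laplacian. simpl.
  assert (J1 : forall z, jet2 (fun s => s) z 1 0).
  { intros z. apply jet2_ext_loc with (fun s => 0 + 1 * s); [|apply jet2_line].
    apply filter_forall. intros r. ring. }
  do 4 eexists. split; [|split].
  - apply (jet2_curve D u (fun s => s) (fun _ => y) x 1 0 0 0 (x, y)); auto. apply jet2_const.
  - apply (jet2_curve D u (fun _ => x) (fun s => s) y 0 1 0 0 (x, y)); auto. apply jet2_const.
  - ring.
Qed.

Lemma locally_lines (p : plane) (P : plane -> Prop) :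
  locally p P ->
  locally (fst p) (fun s => P (s, snd p)) /\ locally (snd p) (fun t => P (fst p, t)).
Proof.
  intros [e He]. split; exists e; intros s Hs; apply He; split; simpl; auto; apply ball_center.
Qed.

Lemma continuous_dist2 (c p : plane) : continuous (dist2 c) p.
Proof.
  apply (continuous_plus (fun q : plane => (fst q - fst c) ^ 2) (fun q : plane => (snd q - snd c) ^ 2)).
  - apply (continuous_comp (fun q : plane => fst q) (fun s => (s - fst c) ^ 2)).
    + apply continuous_fst.
    + apply (@ex_derive_continuous R_AbsRing R_NormedModule). auto_derive; auto.
  - apply (continuous_comp (fun q : plane => snd q) (fun s => (s - snd c) ^ 2)).
    + apply continuous_snd.
    + apply (@ex_derive_continuous R_AbsRing R_NormedModule). auto_derive; auto.
Qed.

Lemma continuous_on_comp {T U V : UniformSpace} (K : T -> Prop) (K' : U -> Prop)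
  (g : T -> U) (f : U -> V) :
  (forall p, K p -> continuous g p) -> (forall p, K p -> K' (g p)) ->
  continuous_on K' f -> continuous_on K (fun p => f (g p)).
Proof.
  intros Hg HK Hf p Kp.
  apply filterlim_comp with (within K' (locally (g p))); [|now apply Hf, HK].
  intros P HP. unfold within in *. pose proof (Hg p Kp _ HP) as E. revert E.
  unfold filtermap. apply filter_imp. intros q Hq Kq. apply Hq. now apply HK.
Qed.

Lemma continuous_on_plus {T : UniformSpace} (K : T -> Prop) (f g : T -> R) :
  continuous_on K f -> continuous_on K g -> continuous_on K (fun p => f p + g p).
Proof.
  intros Hf Hg x Kx. apply (filterlim_comp_2 (F := within K (locally x))) with (1 := Hf x Kx) (2 := Hg x Kx).
  apply (filterlim_plus (f x) (g x)).
Qed.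

Lemma continuous_on_scal {T : UniformSpace} (K : T -> Prop) (k : R) (f : T -> R) :
  continuous_on K f -> continuous_on K (fun p => k * f p).
Proof.
  intros Hf x Kx. apply filterlim_comp with (1 := Hf x Kx).
  apply (filterlim_scal_r k (f x)).
Qed.

Lemma continuous_on_minus {T : UniformSpace} (K : T -> Prop) (f g : T -> R) :
  continuous_on K f -> continuous_on K g -> continuous_on K (fun p => f p - g p).
Proof.
  intros Hf Hg. apply continuous_on_ext with (fun p => f p + -1 * g p).
  - intros p _. change (f p + -1 * g p = f p - g p). ring.
  - apply continuous_on_plus; auto. now apply continuous_on_scal.
Qed.

(** Adding [eta |p|^2] makes the Laplacian positive, which forbids interior
    maxima. *)
Lemma max_principle (K : plane -> Prop) (w : plane -> R) :
  seq_compact K -> continuous_on K w ->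
  (forall p, K p -> w p <= 0 \/ (locally p K /\ exists l, 0 <= l /\ has_lap w p l)) ->
  forall p, K p -> w p <= 0.
Proof.
  intros HK Hw H p0 K0. apply Rnot_lt_le. intros W0.
  pose (q := dist2 (0, 0)).
  assert (Cq : continuous_on K q).
  { apply continuous_on_of_continuous. intros x _. apply continuous_dist2. }
  destruct (extreme_value K q HK (ex_intro _ p0 K0) Cq) as [pb [_ Hb]].
  assert (Pq : forall p, 0 <= q p) by (intros; apply dist2_ge_0).
  pose proof (Pq pb) as Pb.
  pose (eta := w p0 / (2 * (q pb + 1))).
  assert (eta_pos : 0 < eta) by (apply Rdiv_lt_0_compat; lra).
  assert (eta_eq : eta * (2 * (q pb + 1)) = w p0) by (unfold eta; field; lra).
  destruct (extreme_value K (fun p => w p + eta * q p) HK (ex_intro _ p0 K0)) as [m [Km Hm]].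
  { apply continuous_on_plus; auto. now apply continuous_on_scal. }
  destruct (H m Km) as [Wm|[L [l [l0 Hl]]]].
  - specialize (Hm p0 K0). specialize (Hb m Km).
    specialize (Pq p0). nra.
  - assert (HL : has_lap (fun p => w p + eta * q p) m (l + eta * 4)).
    { apply has_lap_plus; auto. apply has_lap_scal. apply has_lap_dist2. }
    destruct HL as [a' [a [b' [b [J1 [J2 E]]]]]].
    destruct (locally_lines m K L) as [L1 L2].
    apply jet2_max in J1; [apply jet2_max in J2; [lra|]|].
    + revert L2. apply filter_imp. intros t Kt. destruct m as [m1 m2]. apply (Hm (_, _) Kt).
    + revert L1. apply filter_imp. intros t Kt. destruct m as [m1 m2]. apply (Hm (_, _) Kt).
Qed.

Definition rectangle (a b c d : R) (p : plane) : Prop := a <= fst p <= b /\ c <= snd p <= d.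

Lemma seq_compact_rectangle (a b c d : R) : seq_compact (rectangle a b c d).
Proof. apply (seq_compact_prod (fun x => a <= x <= b) (fun x => c <= x <= d)); apply seq_compact_interval. Qed.

Lemma locally_rectangle (a b c d : R) (p : plane) :
  a < fst p < b -> c < snd p < d -> locally p (rectangle a b c d).
Proof.
  destruct p as [x y]; simpl; intros H1 H2.
  assert (e : 0 < Rmin (Rmin (x - a) (b - x)) (Rmin (y - c) (d - y))).
  { repeat apply Rmin_pos; lra. }
  exists (mkposreal _ e). intros [x' y'] [B1 B2].
  apply Rabs_ball in B1. apply Rabs_ball in B2. simpl in B1, B2.
  pose proof (Rmin_l (Rmin (x - a) (b - x)) (Rmin (y - c) (d - y))).
  pose proof (Rmin_r (Rmin (x - a) (b - x)) (Rmin (y - c) (d - y))).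
  pose proof (Rmin_l (x - a) (b - x)). pose proof (Rmin_r (x - a) (b - x)).
  pose proof (Rmin_l (y - c) (d - y)). pose proof (Rmin_r (y - c) (d - y)).
  apply Rabs_def2 in B1. apply Rabs_def2 in B2. unfold rectangle; simpl. lra.
Qed.

Lemma has_lap_reflected_difference (f : plane -> R) (s t tau : R) :
  has_lap f (s, t + tau) 0 -> has_lap f (s, t - tau) 0 ->
  has_lap (fun p => f (fst p, t + snd p) - f (fst p, t - snd p)) (s, tau) 0.
Proof.
  intros [a' [a [b' [b [H1 [H2 H3]]]]]] [c' [c [d' [d [G1 [G2 G3]]]]]]; simpl in *.
  exists (a' - c'), (a - c), (1 * b' - -1 * d'), (1 ^ 2 * b - (-1) ^ 2 * d). simpl fst; simpl snd.
  split; [|split]; try lra.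
  - exact (jet2_minus _ _ _ _ _ _ _ H1 G1).
  - apply (jet2_minus (fun r => f (s, t + r)) (fun r => f (s, t - r))).
    + apply jet2_ext_loc with (fun r => f (s, t + 1 * r)).
      { apply filter_forall; intros; now rewrite Rmult_1_l. }
      apply (jet2_affine (fun r => f (s, r)) t 1 tau). now rewrite Rmult_1_l.
    + apply jet2_ext_loc with (fun r => f (s, t + -1 * r)).
      { apply filter_forall; intros. now replace (t + -1 * x) with (t - x) by ring. }
      apply (jet2_affine (fun r => f (s, r)) t (-1) tau).
      now replace (t + -1 * tau) with (t - tau) by ring.
Qed.

Lemma continuous_shift (t k : R) (p : plane) :
  continuous (fun q : plane => (fst q, t + k * snd q) : plane) p.
Proof.
  destruct p as [p1 p2]. apply filterlim_plane; try typeclasses eauto.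
  - apply continuous_fst.
  - apply (continuous_comp (fun q : plane => snd q) (fun s => t + k * s)).
    + apply continuous_snd.
    + apply (@ex_derive_continuous R_AbsRing R_NormedModule). auto_derive; auto.
Qed.

Lemma minus_le_barrier (x y z B : R) :
  Rabs x <= B -> Rabs y <= B -> 2 * B <= z -> x - y - z <= 0.
Proof. intros H1 H2 H3. apply Rabs_le_between in H1. apply Rabs_le_between in H2. lra. Qed.

(** The interior gradient estimate, in the form of finite differences: the odd
    reflection [f (s, t0 + tau) - f (s, t0 - tau)] vanishes for [tau = 0], and on
    a half square it is dominated by a quadratic harmonic barrier. *)
Lemma gradient_estimate_le (f : plane -> R) (s0 t0 d B : R) :
  0 < d -> 0 <= B ->
  (forall p, rectangle (s0 - d) (s0 + d) (t0 - d) (t0 + d) p ->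
     continuous f p /\ has_lap f p 0 /\ Rabs (f p) <= B) ->
  forall tau, 0 <= tau <= d -> f (s0, t0 + tau) - f (s0, t0 - tau) <= 4 * B / d * tau.
Proof.
  intros d0 B0 Hf tau Ht.
  pose (K := rectangle (s0 - d) (s0 + d) 0 d).
  pose (b := fun p : plane => 2 * B / d ^ 2 * ((fst p - s0) ^ 2 + snd p * (2 * d - snd p))).
  assert (dd : 0 < d ^ 2) by nra.
  assert (Bd : 0 <= 2 * B / d ^ 2) by (apply Rmult_le_pos; [lra|left; now apply Rinv_0_lt_compat]).
  assert (Bd1 : 2 * B / d ^ 2 * d ^ 2 = 2 * B) by (field; lra).
  set (k := 2 * B / d ^ 2) in *.
  assert (KK : forall p, K p -> rectangle (s0 - d) (s0 + d) (t0 - d) (t0 + d) (fst p, t0 + snd p) /\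
    rectangle (s0 - d) (s0 + d) (t0 - d) (t0 + d) (fst p, t0 - snd p)).
  { intros [s t] [K1 K2]; unfold rectangle in *; simpl in *. lra. }
  assert (Cf : continuous_on (rectangle (s0 - d) (s0 + d) (t0 - d) (t0 + d)) f).
  { apply continuous_on_of_continuous. intros; now apply Hf. }
  assert (Lb : forall p, has_lap b p 0).
  { intros [s t]. exists (k * (2 * (s - s0) + 0)), (k * (2 + 0)),
      (k * (0 + 2 * (d - t))), (k * (0 + -2)). simpl fst; simpl snd.
    split; [|split]; try ring.
    - apply jet2_scal. apply (jet2_plus (fun s => (s - s0) ^ 2) (fun _ => t * (2 * d - t))).
      + apply jet2_square.
      + apply jet2_const.
    - apply jet2_scal. apply (jet2_plus (fun _ => (s - s0) ^ 2) (fun t => t * (2 * d - t))).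
      + apply jet2_const.
      + exists (fun t => 2 * (d - t)). split; [reflexivity|split].
        * apply filter_forall; intros y. auto_derive; auto; ring.
        * auto_derive; auto; ring. }
  assert (W : f (s0, t0 + tau) - f (s0, t0 - tau) - b (s0, tau) <= 0).
  { refine (max_principle K (fun p => f (fst p, t0 + snd p) - f (fst p, t0 - snd p) - b p)
      _ _ _ (s0, tau) _).
    - apply seq_compact_rectangle.
    - apply continuous_on_minus; [apply continuous_on_minus|].
      + apply continuous_on_ext with (fun p : plane => f (fst p, t0 + 1 * snd p)).
        { intros p _. change (f (fst p, t0 + 1 * snd p) = f (fst p, t0 + snd p)).
          now rewrite Rmult_1_l. }
        apply continuous_on_comp with (3 := Cf); [intros; apply continuous_shift|].
        intros [s t] Kp. destruct (KK _ Kp) as [Q _]. unfold rectangle in *; simpl in *; lra.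
      + apply continuous_on_ext with (fun p : plane => f (fst p, t0 + -1 * snd p)).
        { intros p _. change (f (fst p, t0 + -1 * snd p) = f (fst p, t0 - snd p)).
          now replace (t0 + -1 * snd p) with (t0 - snd p) by ring. }
        apply continuous_on_comp with (3 := Cf); [intros; apply continuous_shift|].
        intros [s t] Kp. destruct (KK _ Kp) as [_ Q]. unfold rectangle in *; simpl in *; lra.
      + apply continuous_on_of_continuous. intros p _. unfold b.
        apply (continuous_scal_r k (fun p : plane => (fst p - s0) ^ 2 + snd p * (2 * d - snd p))).
        apply (continuous_plus (fun q : plane => (fst q - s0) ^ 2) (fun q : plane => snd q * (2 * d - snd q))).
        * apply (continuous_comp (fun q : plane => fst q) (fun s => (s - s0) ^ 2)).
          -- apply continuous_fst.
          -- apply (@ex_derive_continuous R_AbsRing R_NormedModule). auto_derive; auto.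
        * apply (continuous_comp (fun q : plane => snd q) (fun s => s * (2 * d - s))).
          -- apply continuous_snd.
          -- apply (@ex_derive_continuous R_AbsRing R_NormedModule). auto_derive; auto.
    - intros [s t] Kp. destruct (KK _ Kp) as [Kp1 Kp2]. simpl in Kp1, Kp2.
      destruct (Hf _ Kp1) as [_ [L1 A1]]. destruct (Hf _ Kp2) as [_ [L2 A2]].
      unfold K, rectangle in Kp. cbn [fst snd] in *.
      destruct (Req_dec t 0) as [->|Ht0].
      { left. rewrite Rplus_0_r, Rminus_0_r. 
        assert (0 <= b (s, 0)); [|lra]. unfold b. cbn [fst snd].
        apply Rmult_le_pos; auto. rewrite Rmult_0_l, Rplus_0_r. apply pow2_ge_0. }
      assert (Pt : 0 <= t * (2 * d - t)) by (apply Rmult_le_pos; lra).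
      destruct (Req_dec t d) as [->|Htd].
      { left. apply (minus_le_barrier _ _ _ B A1 A2). rewrite <- Bd1.
        unfold b. cbn [fst snd]. apply Rmult_le_compat_l; auto.
        pose proof (pow2_ge_0 (s - s0)). lra. }
      destruct (Rle_lt_dec d (Rabs (s - s0))) as [Hs|Hs].
      { left. apply (minus_le_barrier _ _ _ B A1 A2). rewrite <- Bd1.
        unfold b. cbn [fst snd]. apply Rmult_le_compat_l; auto.
        rewrite <- (pow2_abs (s - s0)).
        assert (d ^ 2 <= Rabs (s - s0) ^ 2) by (apply pow_incr; lra). lra. }
      right. apply Rabs_def2 in Hs. split.
      + apply locally_rectangle; simpl; lra.
      + exists 0. split; [lra|].
        apply has_lap_ext with (fun p => f (fst p, t0 + snd p) - f (fst p, t0 - snd p) - b p) (0 - 0);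
          [intros; reflexivity|ring|].
        apply has_lap_minus; [|apply Lb]. now apply has_lap_reflected_difference.
    - unfold K, rectangle; simpl; lra. }
  unfold b in W; simpl in W.
  assert (4 * B / d * tau = k * (2 * d * tau)) by (unfold k; field; lra).
  rewrite H. assert (0 <= k * (tau * tau)) by (apply Rmult_le_pos; nra). nra.
Qed.

Lemma gradient_estimate (f : plane -> R) (s0 t0 d B : R) :
  0 < d -> 0 <= B ->
  (forall p, rectangle (s0 - d) (s0 + d) (t0 - d) (t0 + d) p ->
     continuous f p /\ has_lap f p 0 /\ Rabs (f p) <= B) ->
  forall tau, 0 <= tau <= d -> Rabs (f (s0, t0 + tau) - f (s0, t0 - tau)) <= 4 * B / d * tau.
Proof.
  intros d0 B0 Hf tau Ht. apply Rabs_le. split.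
  - enough (-1 * f (s0, t0 + tau) - -1 * f (s0, t0 - tau) <= 4 * B / d * tau) by lra.
    apply (gradient_estimate_le (fun p => -1 * f p) s0 t0 d B); auto.
    intros p Kp. destruct (Hf p Kp) as [H1 [H2 H3]]. split; [|split].
    + now apply (continuous_scal_r (-1) f).
    + apply has_lap_ext with (fun p => -1 * f p) (-1 * 0); [reflexivity|ring|].
      now apply has_lap_scal.
    + now rewrite Rabs_mult, Rabs_m1, Rmult_1_l.
  - now apply gradient_estimate_le.
Qed.

(** * Comparison for torsion functions *)

Lemma closure_subset (D : plane -> Prop) (p : plane) : D p -> closure D p.
Proof. intros Dp e. exists p. split; auto. apply ball_center. Qed.

Lemma closure_cases (D : plane -> Prop) (p : plane) : closure D p -> D p \/ boundary D p.
Proof.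
  intros H. destruct (classic (D p)) as [Dp|Dp]; auto. right. split; auto.
  now apply (closure_subset (fun q => ~ D q)).
Qed.

Lemma boundary_open (D : plane -> Prop) (p : plane) : open D -> boundary D p -> ~ D p.
Proof.
  intros Dop [_ H] Dp. destruct (Dop p Dp) as [e He].
  destruct (H e) as [q [Nq Bq]]. now apply Nq, He.
Qed.

Lemma max_principle_domain (D : plane -> Prop) (w : plane -> R) :
  open D -> bounded_region D -> continuous_on (closure D) w ->
  (forall p, D p -> exists l, 0 <= l /\ has_lap w p l) ->
  (forall p, boundary D p -> w p <= 0) -> forall p, closure D p -> w p <= 0.
Proof.
  intros Dop Db Cw Lw Bw. apply max_principle; auto.
  - now apply seq_compact_closure.
  - intros p Cp. destruct (closure_cases D p Cp) as [Dp|Bp]; auto. right. split; auto.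
    generalize (Dop p Dp). apply filter_imp. intros q. apply closure_subset.
Qed.

Lemma torsion_has_lap (D : plane -> Prop) (u : plane -> R) (p : plane) :
  open D -> torsion_function D u -> D p -> has_lap u p (-1).
Proof.
  intros Dop [C [_ [L _]]] Dp. apply has_lap_ext with u (laplacian u p); auto.
  - specialize (L p Dp). lra.
  - now apply has_lap_C2 with D.
Qed.

Lemma torsion_nonneg (D : plane -> Prop) (u : plane -> R) :
  open D -> bounded_region D -> torsion_function D u ->
  forall p, closure D p -> 0 <= u p.
Proof.
  intros Dop Db Tu p Cp. enough (-1 * u p <= 0) by lra.
  apply (max_principle_domain D (fun p => -1 * u p)); auto.
  - apply continuous_on_scal. apply Tu.
  - intros q Dq. exists (-1 * -1). split; [lra|]. apply has_lap_scal. now apply torsion_has_lap with D.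
  - intros q Bq. replace (u q) with 0; [lra|symmetry; now apply Tu].
Qed.

(** Comparison with the torsion function [(r^2 - |q - p|^2) / 4] of a disc. *)
Lemma torsion_disc_lower (D : plane -> Prop) (u : plane -> R) (p : plane) (r : R) :
  open D -> bounded_region D -> torsion_function D u -> 0 < r ->
  (forall q, dist2 p q < r ^ 2 -> D q) -> r ^ 2 / 4 <= u p.
Proof.
  intros Dop Db Tu r0 Hr.
  assert (Dp : D p). { apply Hr. unfold dist2. nra. }
  assert (W : r ^ 2 / 4 - (1 / 4 * dist2 p p + u p) <= 0).
  { refine (max_principle_domain D (fun q => r ^ 2 / 4 - (1 / 4 * dist2 p q + u q)) _ _ _ _ _ p _); auto.
    - apply continuous_on_minus; [|apply continuous_on_plus; [apply continuous_on_scal|apply Tu]].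
      + apply continuous_on_of_continuous. intros; apply continuous_const.
      + apply continuous_on_of_continuous. intros; apply continuous_dist2.
    - intros q Dq. exists (0 - (1 / 4 * 4 + -1)). split; [lra|].
      apply has_lap_minus; [apply has_lap_const|]. apply has_lap_plus.
      + apply has_lap_scal, has_lap_dist2.
      + now apply torsion_has_lap with D.
    - intros q Bq. replace (u q) with 0 by (symmetry; now apply Tu).
      destruct (Rlt_le_dec (dist2 p q) (r ^ 2)) as [Hq|Hq]; [|lra].
      exfalso. apply (boundary_open D q); auto.
    - now apply closure_subset. }
  unfold dist2 in W. lra.
Qed.

Lemma dist2_lt_Rabs (p q : plane) (r : R) :
  0 < r -> dist2 p q < r ^ 2 -> Rabs (fst q - fst p) < r /\ Rabs (snd q - snd p) < r.
Proof.
  intros r0 H. unfold dist2 in H.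
  pose proof (pow2_ge_0 (fst q - fst p)). pose proof (pow2_ge_0 (snd q - snd p)).
  split; apply Rabs_def1; nra.
Qed.

Lemma open_disc (D : plane -> Prop) (p : plane) :
  open D -> D p -> exists r, 0 < r /\ forall q, dist2 p q < r ^ 2 -> D q.
Proof.
  intros Dop Dp. destruct (Dop p Dp) as [[r r0] Hr]. simpl in Hr. exists r. split; auto.
  intros q Hq. apply Hr. apply dist2_lt_Rabs in Hq; [|lra]. now split.
Qed.

Lemma torsion_pos (D : plane -> Prop) (u : plane -> R) (p : plane) :
  open D -> bounded_region D -> torsion_function D u -> D p -> 0 < u p.
Proof.
  intros Dop Db Tu Dp. destruct (open_disc D p Dop Dp) as [r [r0 Hr]].
  pose proof (torsion_disc_lower D u p r Dop Db Tu r0 Hr). nra.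
Qed.

(** * Concavity of the cube root of the torsion function *)

(** Extended by [0], so as to be continuous up to the boundary of the domain. *)
Definition cbrt (x : R) : R := if Rle_dec x 0 then 0 else exp (ln x / 3).

Lemma cbrt_pos (x : R) : 0 < x -> 0 < cbrt x.
Proof. intros Hx. unfold cbrt. destruct (Rle_dec x 0); [lra|apply exp_pos]. Qed.

Lemma cbrt_0 : cbrt 0 = 0.
Proof. unfold cbrt. destruct (Rle_dec 0 0); lra. Qed.

Lemma cbrt_ge_0 (x : R) : 0 <= cbrt x.
Proof. unfold cbrt. destruct (Rle_dec x 0); [lra|left; apply exp_pos]. Qed.

Lemma cbrt_cube (x : R) : 0 <= x -> cbrt x ^ 3 = x.
Proof.
  intros Hx. unfold cbrt. destruct (Rle_dec x 0); [replace x with 0 by lra; ring|].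
  simpl. rewrite Rmult_1_r, <- !exp_plus.
  replace (ln x / 3 + (ln x / 3 + ln x / 3)) with (ln x) by field. apply exp_ln; lra.
Qed.

Lemma cube_lt (a b : R) : 0 <= b -> a ^ 3 < b ^ 3 -> a < b.
Proof.
  intros Hb H. apply Rnot_le_lt. intros Hl.
  pose proof (pow_incr b a 3 (conj Hb Hl)). lra.
Qed.

Lemma cbrt_le (x y : R) : 0 <= x <= y -> cbrt x <= cbrt y.
Proof.
  intros H. apply Rnot_lt_le. intros Hl. pose proof (cbrt_ge_0 y).
  assert (E : 0 < (cbrt x - cbrt y) * (cbrt x ^ 2 + cbrt x * cbrt y + cbrt y ^ 2)).
  { apply Rmult_lt_0_compat; [lra|]. nra. }
  replace (_ * _) with (cbrt x ^ 3 - cbrt y ^ 3) in E by ring.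
  rewrite !cbrt_cube in E; lra.
Qed.

Lemma cbrt_jet2 (x : R) : 0 < x ->
  jet2 cbrt x (/ (3 * cbrt x ^ 2)) (- (2 / (9 * cbrt x ^ 5))).
Proof.
  intros Hx.
  assert (P : locally x (fun y => 0 < y)) by now apply (open_gt 0).
  apply jet2_ext_loc with (fun y => exp (ln y / 3)).
  { revert P. apply filter_imp. intros y Hy. unfold cbrt. destruct (Rle_dec y 0); lra. }
  assert (C3 : exp (ln x / 3) ^ 3 = x).
  { rewrite <- (cbrt_cube x) at 2 by lra. f_equal. unfold cbrt. destruct (Rle_dec x 0); lra. }
  assert (E : cbrt x = exp (ln x / 3)) by (unfold cbrt; destruct (Rle_dec x 0); lra).
  rewrite E. pose proof (exp_pos (ln x / 3)) as ep.
  exists (fun y => exp (ln y / 3) / (3 * y)). split; [|split].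
  - revert ep C3. generalize (exp (ln x / 3)). intros c ep <-. field. lra.
  - revert P. apply filter_imp. intros y Hy. auto_derive; auto. unfold Rdiv. field; lra.
  - evar_last.
    { apply (is_derive_div (fun y => exp (ln y / 3)) (fun y => 3 * y) x (exp (ln x / 3) * (/ x / 3)) 3).
      - auto_derive; [lra|]. unfold Rdiv. field; lra.
      - auto_derive; auto; ring.
      - lra. }
    revert ep C3. generalize (exp (ln x / 3)). intros c ep <-. field. lra.
Qed.

Lemma cbrt_continuous (x : R) : 0 <= x -> filterlim cbrt (within (fun y => 0 <= y) (locally x)) (locally (cbrt x)).
Proof.
  intros Hx. destruct (Rle_lt_or_eq_dec 0 x Hx) as [Hp| <-].
  - assert (C : continuous cbrt x).
    { apply (@ex_derive_continuous R_AbsRing R_NormedModule). eexists.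
      exact (jet2_derive _ _ _ _ (cbrt_jet2 x Hp)). }
    apply filterlim_filter_le_1 with (2 := C).
    intros P HP. unfold within. revert HP. now apply filter_imp.
  - intros P [e He]. rewrite cbrt_0 in He.
    assert (e3 : 0 < e ^ 3) by (apply pow_lt, cond_pos).
    exists (mkposreal _ e3). intros y Hy Hy0. apply He.
    apply Rabs_ball in Hy. simpl in Hy. rewrite Rminus_0_r, Rabs_pos_eq in Hy by auto.
    change (Rabs (cbrt y - 0) < e). rewrite Rminus_0_r, Rabs_pos_eq by apply cbrt_ge_0.
    apply cube_lt; [left; apply cond_pos|]. now rewrite cbrt_cube.
Qed.

Definition mid (x y : plane) : plane := ((fst x + fst y) / 2, (snd x + snd y) / 2).

Definition segment (y x : plane) (t : R) : plane :=
  (fst y + t * (fst x - fst y), snd y + t * (snd x - snd y)).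

Lemma convex_segment (D : plane -> Prop) (x y : plane) (t : R) :
  convex D -> D y -> D x -> 0 <= t <= 1 -> D (segment y x t).
Proof.
  intros Dc Dy Dx Ht. replace (segment y x t) with (plus (scal (1 - t) y) (scal t x)).
  - now apply Dc.
  - destruct x as [x1 x2], y as [y1 y2]. unfold plus, scal, segment; simpl.
    unfold prod_plus, prod_scal, plus, scal; simpl. unfold mult; simpl. f_equal; ring.
Qed.

Lemma convex_closure_mid (D : plane -> Prop) (x y : plane) :
  convex D -> closure D x -> closure D y -> closure D (mid x y).
Proof.
  intros Dc Hx Hy e. destruct (Hx e) as [x' [Dx [X1 X2]]]. destruct (Hy e) as [y' [Dy [Y1 Y2]]].
  exists (segment x' y' (1 / 2)). split; [apply convex_segment; auto; lra|].
  destruct x as [x1 x2], y as [y1 y2], x' as [x1' x2'], y' as [y1' y2'].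
  simpl in X1, X2, Y1, Y2. apply Rabs_ball in X1. apply Rabs_ball in X2. apply Rabs_ball in Y1. apply Rabs_ball in Y2.
  apply Rabs_def2 in X1. apply Rabs_def2 in X2. apply Rabs_def2 in Y1. apply Rabs_def2 in Y2.
  split.
  - change (Rabs (x1' + 1 / 2 * (y1' - x1') - (x1 + y1) / 2) < e).
    apply Rabs_def1; lra.
  - change (Rabs (x2' + 1 / 2 * (y2' - x2') - (x2 + y2) / 2) < e).
    apply Rabs_def1; lra.
Qed.

(** Homothety with centre [y]: the shrunken discs lie in the convex hull of [y]
    and of the disc around [x]. *)
Lemma convex_cone (D : plane -> Prop) (x y : plane) (r t : R) :
  convex D -> closure D y -> 0 < r -> (forall q, dist2 x q < r ^ 2 -> D q) -> 0 < t <= 1 ->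
  forall q, dist2 (segment y x t) q < (t * r) ^ 2 -> D q.
Proof.
  intros Dc Cy r0 Hr Ht q Hq.
  pose (x' := (fst x + (fst q - fst (segment y x t)) / t,
               snd x + (snd q - snd (segment y x t)) / t) : plane).
  assert (X' : dist2 x x' < r ^ 2).
  { apply Rmult_lt_reg_l with (t ^ 2); [nra|]. replace (t ^ 2 * r ^ 2) with ((t * r) ^ 2) by ring.
    replace (t ^ 2 * dist2 x x') with (dist2 (segment y x t) q); auto.
    unfold dist2, x'; simpl. field. lra. }
  (* The point [q] lies on the segment from [y] to [x']; replace [y] by a nearby
     point of the set and move [x'] accordingly. *)
  assert (C : continuous (dist2 x) x') by apply continuous_dist2.
  destruct (C (fun v => v < r ^ 2)) as [e He]; [now apply (open_lt (r ^ 2))|].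
  assert (et : 0 < e * t) by (apply Rmult_lt_0_compat; [apply cond_pos|lra]).
  destruct (Cy (mkposreal _ et)) as [y' [Dy [Y1 Y2]]].
  apply Rabs_ball in Y1. apply Rabs_ball in Y2. simpl in Y1, Y2.
  apply Rabs_def2 in Y1. apply Rabs_def2 in Y2.
  pose (x'' := (fst x' + (1 - t) * (fst y - fst y') / t,
                snd x' + (1 - t) * (snd y - snd y') / t) : plane).
  assert (Dx : D x'').
  { apply Hr. apply He.
    assert (G : forall d, - (e * t) < d < e * t -> - e < (1 - t) * (-d) / t < e).
    { intros d Hd. replace ((1 - t) * - d / t) with ((1 - t) * (- d / t)) by (field; lra).
      assert (- e < - d / t < e).
      { split; apply Rmult_lt_reg_r with t; try lra;
          replace (- d / t * t) with (- d) by (field; lra); lra. }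
      pose proof (cond_pos e). split; nra. }
    split; simpl.
    - change (Rabs (fst x' + (1 - t) * (fst y - fst y') / t - fst x') < e).
      destruct (G (fst y' - fst y)) as [G1 G2]; [lra|].
      replace (- (fst y' - fst y)) with (fst y - fst y') in * by ring. apply Rabs_def1; lra.
    - change (Rabs (snd x' + (1 - t) * (snd y - snd y') / t - snd x') < e).
      destruct (G (snd y' - snd y)) as [G1 G2]; [lra|].
      replace (- (snd y' - snd y)) with (snd y - snd y') in * by ring. apply Rabs_def1; lra. }
  replace q with (segment y' x'' t); [apply convex_segment; auto; lra|].
  destruct q as [q1 q2]. unfold segment, x'', x'; simpl. f_equal; field; lra.
Qed.

(** Moving one point alone gives the slopes; moving the two points at speeds [a]
    and [b] gives the second order condition.  The freedom in the speeds is what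
    makes the two-point argument work. *)
Lemma midpoint_second_order (f g h : R -> R) (x y f1 f2 g1 g2 h1 h2 : R) :
  jet2 f x f1 f2 -> jet2 g y g1 g2 -> jet2 h ((x + y) / 2) h1 h2 ->
  (exists d : posreal, forall s t, Rabs s < d -> Rabs t < d ->
     (f (x + s) + g (y + t)) / 2 - h ((x + y) / 2 + (s + t) / 2)
       <= (f x + g y) / 2 - h ((x + y) / 2)) ->
  f1 = h1 /\ g1 = h1 /\
  forall a b, (a ^ 2 * f2 + b ^ 2 * g2) / 2 <= ((a + b) / 2) ^ 2 * h2.
Proof.
  intros Jf Jg Jh [d Hd].
  assert (M : forall a b, (a * f1 + b * g1) / 2 - (a + b) / 2 * h1 = 0 /\
     (a ^ 2 * f2 + b ^ 2 * g2) / 2 - ((a + b) / 2) ^ 2 * h2 <= 0).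
  { intros a b.
    assert (Ja : jet2 (fun r => f (x + a * r)) 0 (a * f1) (a ^ 2 * f2)).
    { apply jet2_affine. now rewrite Rmult_0_r, Rplus_0_r. }
    assert (Jb : jet2 (fun r => g (y + b * r)) 0 (b * g1) (b ^ 2 * g2)).
    { apply jet2_affine. now rewrite Rmult_0_r, Rplus_0_r. }
    assert (Jc : jet2 (fun r => h ((x + y) / 2 + (a + b) / 2 * r)) 0
       ((a + b) / 2 * h1) (((a + b) / 2) ^ 2 * h2)).
    { apply jet2_affine. now rewrite Rmult_0_r, Rplus_0_r. }
    pose proof (jet2_minus _ _ _ _ _ _ _
      (jet2_scal (/ 2) _ _ _ _ (jet2_plus _ _ _ _ _ _ _ Ja Jb)) Jc) as J.
    apply jet2_max in J; [lra|].
    assert (m : 0 < d / (Rabs a + Rabs b + 1)).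
    { apply Rdiv_lt_0_compat; [apply cond_pos|]. pose proof (Rabs_pos a). pose proof (Rabs_pos b). lra. }
    exists (mkposreal _ m). intros r Hr. apply Rabs_ball in Hr. simpl in Hr. rewrite Rminus_0_r in Hr.
    assert (Hr' : Rabs r * (Rabs a + Rabs b + 1) < d).
    { apply Rmult_lt_compat_r with (r := Rabs a + Rabs b + 1) in Hr;
        [|pose proof (Rabs_pos a); pose proof (Rabs_pos b); lra].
      replace (d / (Rabs a + Rabs b + 1) * (Rabs a + Rabs b + 1)) with (pos d) in Hr; auto.
      field. pose proof (Rabs_pos a); pose proof (Rabs_pos b); lra. }
    pose proof (Rabs_pos a). pose proof (Rabs_pos b). pose proof (Rabs_pos r).
    specialize (Hd (a * r) (b * r)). rewrite !Rabs_mult in Hd.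
    replace ((a * r + b * r) / 2) with ((a + b) / 2 * r) in Hd by field.
    rewrite !Rmult_0_r, !Rplus_0_r.
    assert (0 <= Rabs a * Rabs r) by now apply Rmult_le_pos.
    assert (0 <= Rabs b * Rabs r) by now apply Rmult_le_pos.
    specialize (Hd ltac:(lra) ltac:(lra)). lra. }
  destruct (M 1 0) as [M1 _]. destruct (M 0 1) as [M2 _].
  split; [lra|split; [lra|]]. intros a b. destruct (M a b). lra.
Qed.

(** For [w = u^(1/3)], the equation [Delta (w^3) = -1] reads
    [Delta w = - 1 / (3 w^2) - 2 |grad w|^2 / w]. *)
Lemma cbrt_torsion_jets (D : plane -> Prop) (u : plane -> R) (p : plane) :
  open D -> bounded_region D -> torsion_function D u -> D p ->
  exists w1 w11 w2 w22,
    jet2 (fun s => cbrt (u (s, snd p))) (fst p) w1 w11 /\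
    jet2 (fun s => cbrt (u (fst p, s))) (snd p) w2 w22 /\
    w11 + w22 = - (/ (3 * cbrt (u p) ^ 2)) - 2 * (w1 ^ 2 + w2 ^ 2) / cbrt (u p).
Proof.
  intros Dop Db Tu Dp.
  pose proof (torsion_pos D u p Dop Db Tu Dp) as up.
  destruct (torsion_has_lap D u p Dop Tu Dp) as [a' [a [b' [b [H1 [H2 H3]]]]]].
  pose proof (cbrt_pos _ up) as cp.
  exists (/ (3 * cbrt (u p) ^ 2) * a'), (- (2 / (9 * cbrt (u p) ^ 5)) * a' ^ 2 + / (3 * cbrt (u p) ^ 2) * a),
    (/ (3 * cbrt (u p) ^ 2) * b'), (- (2 / (9 * cbrt (u p) ^ 5)) * b' ^ 2 + / (3 * cbrt (u p) ^ 2) * b).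
  split; [|split].
  - apply (jet2_comp cbrt (fun s => u (s, snd p))); auto.
    destruct p as [x y]. now apply cbrt_jet2.
  - apply (jet2_comp cbrt (fun s => u (fst p, s))); auto.
    destruct p as [x y]. now apply cbrt_jet2.
  - replace a with (-1 - b) by lra. field. lra.
Qed.

Lemma mid_sym (x y : plane) : mid x y = mid y x.
Proof. unfold mid. f_equal; lra. Qed.

(** At an interior maximum of [(w x + w y) / 2 - w (mid x y)], where
    [w = u^(1/3)], the three gradients agree.  Moving [x] at speed [w x] and
    [y] at speed [w y] in each coordinate direction and adding the second order
    conditions, the equation for [w] gives
    [A^2 / (3 c^2) + 2 |grad w|^2 A^2 / c <= 1 / 3 + 2 |grad w|^2 A] with
    [A = (w x + w y) / 2] and [c = w (mid x y)], whence [A <= c]. *)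
Lemma cbrt_torsion_interior (D : plane -> Prop) (u : plane -> R) (x y : plane) :
  open D -> bounded_region D -> torsion_function D u -> D x -> D y -> D (mid x y) ->
  (forall x' y', D x' -> D y' ->
     (cbrt (u x') + cbrt (u y')) / 2 - cbrt (u (mid x' y'))
       <= (cbrt (u x) + cbrt (u y)) / 2 - cbrt (u (mid x y))) ->
  (cbrt (u x) + cbrt (u y)) / 2 <= cbrt (u (mid x y)).
Proof.
  intros Dop Db Tu Dx Dy Dm H.
  destruct (cbrt_torsion_jets D u x Dop Db Tu Dx) as [x1 [x11 [x2 [x22 [X1 [X2 X]]]]]].
  destruct (cbrt_torsion_jets D u y Dop Db Tu Dy) as [y1 [y11 [y2 [y22 [Y1 [Y2 Y]]]]]].
  destruct (cbrt_torsion_jets D u _ Dop Db Tu Dm) as [z1 [z11 [z2 [z22 [Z1 [Z2 Z]]]]]].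
  pose proof (cbrt_pos _ (torsion_pos D u x Dop Db Tu Dx)) as xp.
  pose proof (cbrt_pos _ (torsion_pos D u y Dop Db Tu Dy)) as yp.
  pose proof (cbrt_pos _ (torsion_pos D u _ Dop Db Tu Dm)) as zp.
  destruct (Dop x Dx) as [dx Hdx]. destruct (Dop y Dy) as [dy Hdy].
  assert (d0 : 0 < Rmin dx dy) by (apply Rmin_pos; apply cond_pos).
  pose proof (Rmin_l dx dy). pose proof (Rmin_r dx dy).
  destruct (midpoint_second_order _ _ _ _ _ _ _ _ _ _ _ X1 Y1 Z1) as [E1 [E2 E3]].
  { exists (mkposreal _ d0). simpl. intros s t Hs Ht.
    assert (Q : D (fst x + s, snd x)).
    { apply Hdx. split; [|apply ball_center]. change (Rabs (fst x + s - fst x) < dx).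
      replace (fst x + s - fst x) with s by ring. lra. }
    assert (Q' : D (fst y + t, snd y)).
    { apply Hdy. split; [|apply ball_center]. change (Rabs (fst y + t - fst y) < dy).
      replace (fst y + t - fst y) with t by ring. lra. }
    specialize (H _ _ Q Q'). destruct x as [xa xb], y as [ya yb]. unfold mid in *. simpl in *.
    now replace ((xa + ya) / 2 + (s + t) / 2) with ((xa + s + (ya + t)) / 2) by field. }
  destruct (midpoint_second_order _ _ _ _ _ _ _ _ _ _ _ X2 Y2 Z2) as [G1 [G2 G3]].
  { exists (mkposreal _ d0). simpl. intros s t Hs Ht.
    assert (Q : D (fst x, snd x + s)).
    { apply Hdx. split; [apply ball_center|]. change (Rabs (snd x + s - snd x) < dx).
      replace (snd x + s - snd x) with s by ring. lra. }
    assert (Q' : D (fst y, snd y + t)).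
    { apply Hdy. split; [apply ball_center|]. change (Rabs (snd y + t - snd y) < dy).
      replace (snd y + t - snd y) with t by ring. lra. }
    specialize (H _ _ Q Q'). destruct x as [xa xb], y as [ya yb]. unfold mid in *. simpl in *.
    now replace ((xb + yb) / 2 + (s + t) / 2) with ((xb + s + (yb + t)) / 2) by field. }
  subst x1 y1 x2 y2.
  set (a := cbrt (u x)) in *. set (b := cbrt (u y)) in *. set (c := cbrt (u (mid x y))) in *.
  specialize (E3 a b). specialize (G3 a b).
  set (P := z1 ^ 2 + z2 ^ 2) in *.
  assert (P0 : 0 <= P) by (apply Rplus_le_le_0_compat; apply pow2_ge_0).
  assert (Ex : a ^ 2 * x11 + a ^ 2 * x22 = - (1 / 3) - 2 * P * a).
  { rewrite <- Rmult_plus_distr_l, X. field. lra. }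
  assert (Ey : b ^ 2 * y11 + b ^ 2 * y22 = - (1 / 3) - 2 * P * b).
  { rewrite <- Rmult_plus_distr_l, Y. field. lra. }
  apply Rnot_lt_le. intros Hc. set (A := (a + b) / 2) in *.
  assert (Ez : A ^ 2 * z11 + A ^ 2 * z22 = - (1 / 3 * (A / c) ^ 2) - 2 * P * (A * (A / c))).
  { rewrite <- Rmult_plus_distr_l, Z. field. lra. }
  assert (q1 : 1 < A / c).
  { apply Rmult_lt_reg_r with c; auto. replace (A / c * c) with A by (field; lra). lra. }
  assert (1 < (A / c) ^ 2) by nra.
  assert (P * A <= P * (A * (A / c))).
  { apply Rmult_le_compat_l; auto. assert (0 < A) by lra. nra. }
  assert (a + b = 2 * A) by (unfold A; field).
  assert (P * a + P * b = 2 * (P * A)) by (rewrite <- Rmult_plus_distr_l, H4; ring).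
  lra.
Qed.

(** At a boundary point [y], convexity provides discs whose radius grows
    linearly along the segment to an interior point [x], so that [u] grows at least
    quadratically and [u^(1/3)] with infinite slope. *)
Lemma cbrt_torsion_boundary (D : plane -> Prop) (u : plane -> R) (x y : plane) :
  open D -> bounded_region D -> convex D -> torsion_function D u ->
  D x -> boundary D y ->
  ~ (forall y', D y' ->
     (cbrt (u x) + cbrt (u y')) / 2 - cbrt (u (mid x y'))
       <= (cbrt (u x) + cbrt (u y)) / 2 - cbrt (u (mid x y))).
Proof.
  intros Dop Db Dc Tu Dx By H.
  assert (uy : u y = 0) by now apply Tu. rewrite uy, cbrt_0 in H.
  destruct (open_disc D x Dop Dx) as [r [r0 Hr]].
  assert (Sg : forall t, 0 < t <= 1 -> forall q, dist2 (segment y x t) q < (t * r) ^ 2 -> D q).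
  { intros t Ht. apply convex_cone; auto. apply By. }
  assert (Sd : forall t, 0 < t <= 1 -> D (segment y x t)).
  { intros t Ht. apply (Sg t Ht). unfold dist2.
    assert (0 < (t * r) ^ 2) by (apply pow_lt, Rmult_lt_0_compat; lra). lra. }
  assert (Dm : D (mid x y)).
  { replace (mid x y) with (segment y x (1 / 2)); [apply Sd; lra|].
    unfold segment, mid. f_equal; field. }
  pose (f := fun t => cbrt (u (segment (mid x y) x t))).
  assert (J : exists l, is_derive f 0 l).
  { assert (E0 : segment (mid x y) x 0 = mid x y).
    { unfold segment. destruct (mid x y); simpl. f_equal; ring. }
    assert (up : 0 < u (segment (mid x y) x 0)) by (rewrite E0; now apply torsion_pos with D).
    eexists. apply (is_derive_comp cbrt).
    - exact (jet2_derive cbrt _ _ _ (cbrt_jet2 _ up)).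
    - apply (C1_on_chain D u (fun t => fst (mid x y) + t * (fst x - fst (mid x y)))
               (fun t => snd (mid x y) + t * (snd x - snd (mid x y))) 0); auto.
      + apply Tu.
      + change (D (segment (mid x y) x 0)). now rewrite E0.
      + auto_derive; auto.
      + auto_derive; auto. }
  destruct J as [l Hl]. apply is_derive_Reals in Hl.
  destruct (Hl 1 Rlt_0_1) as [d Hd].
  pose (C := Rabs l + 1). pose proof (Rabs_pos l) as lp.
  assert (K : forall t, 0 < t < d -> t <= 1 -> (t * r) ^ 2 / 4 <= 8 * C ^ 3 * t ^ 3).
  { intros t Ht Ht1.
    specialize (Hd t ltac:(lra)). rewrite Rabs_pos_eq in Hd by lra.
    specialize (Hd ltac:(lra)). rewrite Rplus_0_l in Hd. apply Rabs_def2 in Hd.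
    specialize (H _ (Sd t ltac:(lra))).
    replace (mid x (segment y x t)) with (segment (mid x y) x t) in H
      by (unfold mid, segment; simpl; f_equal; field).
    assert (f0 : cbrt (u (mid x y)) = f 0).
    { unfold f, segment. do 2 f_equal. destruct (mid x y); simpl. f_equal; ring. }
    rewrite f0 in H. change (cbrt (u (segment (mid x y) x t))) with (f t) in H.
    assert (F : (f t - f 0) / t < C).
    { pose proof (Rle_abs l). unfold C. lra. }
    apply Rmult_lt_compat_r with (r := t) in F; [|lra].
    replace ((f t - f 0) / t * t) with (f t - f 0) in F by (field; lra).
    assert (L : cbrt (u (segment y x t)) <= 2 * C * t) by lra.
    pose proof (torsion_disc_lower D u (segment y x t) (t * r) Dop Db Tu
      ltac:(apply Rmult_lt_0_compat; lra) (Sg t ltac:(lra))) as Lo.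
    assert (0 <= (t * r) ^ 2 / 4) by (pose proof (pow2_ge_0 (t * r)); lra).
    pose proof (pow_incr _ _ 3 (conj (cbrt_ge_0 _) L)) as L3.
    rewrite cbrt_cube in L3 by lra. nra. }
  assert (Cp : 0 < C) by (unfold C; lra).
  assert (C0 : 0 < C ^ 3) by (apply pow_lt; unfold C; lra).
  pose (t := Rmin (d / 2) (Rmin 1 (r ^ 2 / (64 * C ^ 3)))).
  assert (r2 : 0 < r ^ 2) by (apply pow_lt; lra).
  assert (t0 : 0 < t).
  { apply Rmin_pos; [apply Rdiv_lt_0_compat; [apply cond_pos|lra]|].
    apply Rmin_pos; [lra|]. apply Rdiv_lt_0_compat; lra. }
  assert (t1 : t <= d / 2) by apply Rmin_l.
  assert (t2 : t <= 1) by (eapply Rle_trans; [apply Rmin_r|apply Rmin_l]).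
  assert (t3 : t <= r ^ 2 / (64 * C ^ 3)) by (eapply Rle_trans; [apply Rmin_r|apply Rmin_r]).
  pose proof (cond_pos d).
  specialize (K t ltac:(lra) t2).
  assert (C ^ 3 * t <= r ^ 2 / 64).
  { apply Rmult_le_compat_l with (r := C ^ 3) in t3; [|lra].
    replace (C ^ 3 * (r ^ 2 / (64 * C ^ 3))) with (r ^ 2 / 64) in t3 by (field; lra). lra. }
  assert (t ^ 2 * (C ^ 3 * t) <= t ^ 2 * (r ^ 2 / 64)).
  { apply Rmult_le_compat_l; auto. apply pow2_ge_0. }
  assert (0 < t ^ 2 * r ^ 2) by (apply Rmult_lt_0_compat; auto; apply pow_lt; lra).
  replace ((t * r) ^ 2) with (t ^ 2 * r ^ 2) in K by ring.
  replace (8 * C ^ 3 * t ^ 3) with (8 * (t ^ 2 * (C ^ 3 * t))) in K by ring. lra.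
Qed.

(** The defect [(w x + w y) / 2 - w (mid x y)] attains its maximum on pairs of
    points of the closure; if both are on the boundary it is at most [0], and the two
    preceding lemmas treat the other cases. *)
Lemma cbrt_torsion_midpoint_concave (D : plane -> Prop) (u : plane -> R) (x y : plane) :
  open D -> bounded_region D -> convex D -> torsion_function D u ->
  closure D x -> closure D y ->
  (cbrt (u x) + cbrt (u y)) / 2 <= cbrt (u (mid x y)).
Proof.
  intros Dop Db Dc Tu Cx Cy.
  assert (Cw : continuous_on (closure D) (fun p => cbrt (u p))).
  { intros p Cp. apply filterlim_comp with (within (fun v => 0 <= v) (locally (u p))).
    - intros P HP. destruct Tu as [T1 [T2 T3]]. pose proof (T2 p Cp _ HP) as E. revert E.
      unfold filtermap, within. apply filter_imp. intros q Hq Cq. apply Hq; auto.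
      apply (torsion_nonneg D u Dop Db); auto. split; auto.
    - apply cbrt_continuous. now apply torsion_nonneg with D. }
  pose (K := fun z : plane * plane => closure D (fst z) /\ closure D (snd z)).
  destruct (extreme_value K (fun z => / 2 * (cbrt (u (fst z)) + cbrt (u (snd z)))
     - cbrt (u (mid (fst z) (snd z))))) as [[x0 y0] [[X0 Y0] M]].
  - apply seq_compact_prod; now apply seq_compact_closure.
  - exists (x, y). now split.
  - apply continuous_on_minus; [apply continuous_on_scal, continuous_on_plus|].
    + apply (continuous_on_comp K (closure D) fst (fun p => cbrt (u p))); auto.
      * intros [p q] _. apply continuous_fst.
      * now intros p [K1 K2].
    + apply (continuous_on_comp K (closure D) snd (fun p => cbrt (u p))); auto.
      * intros [p q] _. apply continuous_snd.
      * now intros p [K1 K2].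
    + apply (continuous_on_comp K (closure D) (fun z => mid (fst z) (snd z)) (fun p => cbrt (u p))); auto.
      * intros [p q] _. 
        assert (F : forall g : plane -> R, (forall a, continuous g a) ->
          continuous (fun z : plane * plane => (g (fst z) + g (snd z)) / 2) (p, q)).
        { intros g Hg. apply (continuous_mult (fun z : plane * plane => g (fst z) + g (snd z)) (fun _ => / 2)).
          - apply (continuous_plus (fun z : plane * plane => g (fst z)) (fun z : plane * plane => g (snd z))).
            + apply (continuous_comp fst g); [apply continuous_fst|apply Hg].
            + apply (continuous_comp snd g); [apply continuous_snd|apply Hg].
          - apply continuous_const. }
        apply filterlim_plane; try typeclasses eauto.
        -- apply (F (fun a : plane => fst a)). intros [a b]. apply continuous_fst.
        -- apply (F (fun a : plane => snd a)). intros [a b]. apply continuous_snd.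
      * intros p [K1 K2]. now apply convex_closure_mid.
  - simpl in M, X0, Y0.
    assert (M' : forall x' y', closure D x' -> closure D y' ->
      (cbrt (u x') + cbrt (u y')) / 2 - cbrt (u (mid x' y'))
        <= (cbrt (u x0) + cbrt (u y0)) / 2 - cbrt (u (mid x0 y0))).
    { intros x' y' H1 H2. specialize (M (x', y') (conj H1 H2)). simpl in M. lra. }
    enough ((cbrt (u x0) + cbrt (u y0)) / 2 <= cbrt (u (mid x0 y0))).
    { specialize (M' x y Cx Cy). lra. }
    pose proof (closure_subset D) as CS.
    destruct (closure_cases D x0 X0) as [Dx|Bx]; destruct (closure_cases D y0 Y0) as [Dy|By].
    + apply cbrt_torsion_interior with D; auto.
      replace (mid x0 y0) with (segment x0 y0 (1 / 2)); [apply convex_segment; auto; lra|].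
      unfold segment, mid. f_equal; field.
    + exfalso. apply (cbrt_torsion_boundary D u x0 y0); auto.
    + exfalso. apply (cbrt_torsion_boundary D u y0 x0); auto.
      intros x' Dx'. specialize (M' x' y0). rewrite (mid_sym y0 x'), (mid_sym y0 x0).
      rewrite (Rplus_comm (cbrt (u y0))), (Rplus_comm (cbrt (u y0))). auto.
    + destruct Tu as [_ [_ [_ Tb]]]. rewrite (Tb x0 Bx), (Tb y0 By), cbrt_0.
      pose proof (cbrt_ge_0 (u (mid x0 y0))). lra.
Qed.

(** The cube root at the midpoint is at least the mean of its values at [c] and
    [p], and the value at [p] is not the larger one. *)
Lemma torsion_mid_max (D : plane -> Prop) (u : plane -> R) (c p : plane) :
  open D -> bounded_region D -> convex D -> torsion_function D u ->
  max_point D u c -> D p -> D (mid c p) /\ u p <= u (mid c p).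
Proof.
  intros Dop Db Dc Tu [Dm Hm] Dp.
  assert (Dmid : D (mid c p)).
  { replace (mid c p) with (segment c p (1 / 2)); [apply convex_segment; auto; lra|].
    unfold segment, mid. f_equal; field. }
  split; auto.
  pose proof (cbrt_torsion_midpoint_concave D u c p Dop Db Dc Tu
    (closure_subset _ _ Dm) (closure_subset _ _ Dp)) as H.
  pose proof (torsion_pos D u p Dop Db Tu Dp) as up.
  pose proof (torsion_pos D u _ Dop Db Tu Dmid) as um.
  pose proof (cbrt_le (u p) (u c) ltac:(specialize (Hm p Dp); lra)).
  assert (L : cbrt (u p) <= cbrt (u (mid c p))) by lra.
  pose proof (pow_incr _ _ 3 (conj (cbrt_ge_0 _) L)) as L3.
  rewrite !cbrt_cube in L3; lra.
Qed.

(** * The torsion function near its maximum point *)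

Lemma schwarz_C2 (D : plane -> Prop) (u : plane -> R) (p : plane) :
  open D -> C2_on D u -> D p -> d1 (d2 u) p = d2 (d1 u) p.
Proof.
  intros Dop HC Dp. destruct p as [x y].
  apply (Schwarz (fun s t => u (s, t)) x y).
  - apply locally_2d_locally. generalize (Dop _ Dp). apply filter_imp. intros [a b] Dab. simpl.
    destruct HC as [C0 [C1 C2]].
    split; [apply (C0 _ Dab)|split; [apply (C0 _ Dab)|split]].
    + apply (C2 _ Dab).
    + apply (C1 _ Dab).
  - apply continuity_2d_pt_filterlim. destruct HC as [_ [_ C2]].
    destruct (C2 _ Dp) as [_ [_ [H _]]].
    apply filterlim_ext with (2 := H). now intros [a b].
  - apply continuity_2d_pt_filterlim. destruct HC as [_ [C1 _]].
    destruct (C1 _ Dp) as [_ [_ [_ H]]].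
    apply filterlim_ext with (2 := H). now intros [a b].
Qed.

Lemma max_point_conditions (D : plane -> Prop) (u : plane -> R) (p : plane) :
  open D -> C2_on D u -> max_point D u p ->
  d1 u p = 0 /\ d2 u p = 0 /\
  forall v w, d1 (d1 u) p * v ^ 2 + (d1 (d2 u) p + d2 (d1 u) p) * (v * w) + d2 (d2 u) p * w ^ 2 <= 0.
Proof.
  intros Dop HC [Dp Hm].
  assert (M : forall v w, d1 u p * v + d2 u p * w = 0 /\
    d1 (d1 u) p * v ^ 2 + (d1 (d2 u) p + d2 (d1 u) p) * (v * w) + d2 (d2 u) p * w ^ 2 <= 0).
  { intros v w.
    assert (E : p = (fst p + v * 0, snd p + w * 0)) by (destruct p; simpl; f_equal; ring).
    pose proof (jet2_curve D u (fun s => fst p + v * s) (fun s => snd p + w * s) 0 v w 0 0 p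
      Dop HC Dp E (jet2_line _ _ _) (jet2_line _ _ _)) as J.
    apply jet2_max in J; [lra|].
    assert (C : filterlim (fun s => (fst p + v * s, snd p + w * s)) (locally 0)
      (locally ((fst p + v * 0, snd p + w * 0) : plane))).
    { apply (filterlim_plane (locally 0) (fun s => fst p + v * s) (fun s => snd p + w * s)).
      - apply (@ex_derive_continuous R_AbsRing R_NormedModule (fun s => fst p + v * s)); auto_derive; auto.
      - apply (@ex_derive_continuous R_AbsRing R_NormedModule (fun s => snd p + w * s)); auto_derive; auto. }
    rewrite E in Dp. pose proof (C _ (Dop _ Dp)) as L. revert L. unfold filtermap.
    apply filter_imp. intros s Ds. rewrite <- E. now apply Hm. }
  destruct (M 1 0). destruct (M 0 1). split; [lra|split; [lra|]]. apply M.
Qed.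

Lemma eucl_dist_sqrt (p q : plane) : eucl_dist p q = sqrt (dist2 p q).
Proof.
  unfold eucl_dist, dist2. rewrite plane_norm. f_equal. destruct p, q; simpl.
  unfold minus, plus, opp; simpl. ring.
Qed.

Lemma eucl_dist_pow2 (p q : plane) : eucl_dist p q ^ 2 = dist2 p q.
Proof. rewrite eucl_dist_sqrt. apply pow2_sqrt, dist2_ge_0. Qed.

Lemma eucl_dist_ge_0 (p q : plane) : 0 <= eucl_dist p q.
Proof. rewrite eucl_dist_sqrt. apply sqrt_pos. Qed.

Lemma Rabs_fst_eucl_dist (p q : plane) : Rabs (fst q - fst p) <= eucl_dist p q.
Proof. rewrite eucl_dist_sqrt. apply Rabs_le_plane_norm. Qed.

Lemma Rabs_snd_eucl_dist (p q : plane) : Rabs (snd q - snd p) <= eucl_dist p q.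
Proof. rewrite eucl_dist_sqrt. apply Rabs_le_plane_norm. Qed.

Lemma eucl_dist_segment (c p : plane) (t : R) :
  0 <= t -> eucl_dist c (segment c p t) = t * eucl_dist c p.
Proof.
  intros Ht. rewrite !eucl_dist_sqrt. rewrite <- (sqrt_Rsqr t Ht) at 2.
  rewrite <- sqrt_mult_alt by apply Rle_0_sqr. f_equal.
  unfold dist2, segment, Rsqr; simpl. ring.
Qed.

(** The discriminant [(m11 - m22)^2 + 4 m12^2] of a symmetric matrix vanishes only
    for multiples of the identity; the equation fixes the trace. *)
Lemma equal_eigenvalues_hessian (D : plane -> Prop) (u : plane -> R) (c : plane) (l : R) :
  open D -> torsion_function D u -> D c -> eigenvalue_pair (hessian u c) l l ->
  d1 (d1 u) c = - (1 / 2) /\ d2 (d2 u) c = - (1 / 2) /\ d1 (d2 u) c = 0 /\ d2 (d1 u) c = 0.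
Proof.
  intros Dop [HC [_ [L _]]] Dc E.
  specialize (L c Dc). unfold laplacian in L.
  pose proof (schwarz_C2 D u c Dop HC Dc) as S.
  pose proof (E 0) as E0. pose proof (E 1) as E1.
  unfold char_poly2, hessian in E0, E1; simpl in E0, E1. rewrite S in *.
  assert (l = - (1 / 2)) by lra. subst l.
  set (a := d1 (d1 u) c) in *. set (b := d2 (d1 u) c) in *. set (d := d2 (d2 u) c) in *.
  assert (d = - 1 - a) by lra. subst d.
  assert (Q : (a + 1 / 2) ^ 2 + b ^ 2 = 0) by (rewrite H in *; lra).
  pose proof (pow2_ge_0 (a + 1 / 2)). pose proof (pow2_ge_0 b).
  assert (a + 1 / 2 = 0) by (apply Rsqr_0_uniq; unfold Rsqr; lra).
  assert (b = 0) by (apply Rsqr_0_uniq; unfold Rsqr; lra).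
  lra.
Qed.

Lemma continuous_near (f : plane -> R) (c : plane) (l e : R) :
  continuous f c -> f c = l -> 0 < e -> locally c (fun p => Rabs (f p - l) < e).
Proof.
  intros C <- He. pose proof (C _ (locally_ball (f c) (mkposreal e He))) as L. exact L.
Qed.

Lemma locally_eucl (c : plane) (P : plane -> Prop) :
  locally c P -> exists d, 0 < d /\ forall p, eucl_dist c p <= d -> P p.
Proof.
  intros [[e He] HP]. exists (e / 2). split; [lra|]. intros p Hp. apply HP.
  pose proof (Rabs_fst_eucl_dist c p). pose proof (Rabs_snd_eucl_dist c p).
  simpl in *. split.
  - change (Rabs (fst p - fst c) < e). lra.
  - change (Rabs (snd p - snd c) < e). lra.
Qed.

(** Up to a relative error [eta] and to second order, [u] is the paraboloid
    [u c - |p - c|^2 / 4] at [p]. *)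
Definition near_round (D : plane -> Prop) (u : plane -> R) (c : plane) (eta : R) (p : plane) : Prop :=
  D p /\ Rabs (d1 (d1 u) p + 1 / 2) <= eta /\ Rabs (d2 (d2 u) p + 1 / 2) <= eta /\
  Rabs (d1 (d2 u) p) <= eta /\ Rabs (d2 (d1 u) p) <= eta /\
  Rabs (d1 u p + (fst p - fst c) / 2) <= 2 * eta * eucl_dist c p /\
  Rabs (d2 u p + (snd p - snd c) / 2) <= 2 * eta * eucl_dist c p /\
  Rabs (u p - u c + dist2 c p / 4) <= 4 * eta * dist2 c p.

(** The second derivatives are continuous at [c]; integrating along the segment from
    [c] to [p] gives the first derivatives and then the values. *)
Lemma near_round_center (D : plane -> Prop) (u : plane -> R) (c : plane) (l eta : R) :
  open D -> torsion_function D u -> max_point D u c ->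
  eigenvalue_pair (hessian u c) l l -> 0 < eta ->
  exists d, 0 < d /\ forall p, eucl_dist c p <= d -> near_round D u c eta p.
Proof.
  intros Dop Tu Hm HE eta0.
  destruct (equal_eigenvalues_hessian D u c l Dop Tu (proj1 Hm) HE) as [H11 [H22 [H12 H21]]].
  destruct Tu as [HC _].
  destruct (max_point_conditions D u c Dop HC Hm) as [G1 [G2 _]].
  destruct HC as [C0 [C1 C2]].
  destruct (C1 c (proj1 Hm)) as [_ [_ [K11 K21]]]. destruct (C2 c (proj1 Hm)) as [_ [_ [K12 K22]]].
  pose proof (filter_and _ _ (Dop c (proj1 Hm))
   (filter_and _ _ (filter_and _ _ (continuous_near _ c _ eta K11 H11 eta0) (continuous_near _ c _ eta K22 H22 eta0))
     (filter_and _ _ (continuous_near _ c _ eta K12 H12 eta0) (continuous_near _ c _ eta K21 H21 eta0)))) as L.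
  destruct (locally_eucl c _ L) as [d [d0 Hd]]. clear L K11 K12 K21 K22.
  exists d. split; auto. intros p Hp.
  assert (Sg : forall t, 0 <= t <= 1 -> eucl_dist c (segment c p t) <= d).
  { intros t Ht. rewrite eucl_dist_segment by lra. pose proof (eucl_dist_ge_0 c p). nra. }
  assert (S1 : segment c p 1 = p) by (unfold segment; destruct p; simpl; f_equal; ring).
  assert (S0 : segment c p 0 = c) by (unfold segment; destruct c; simpl; f_equal; ring).
  pose proof (Rabs_fst_eucl_dist c p) as W1. pose proof (Rabs_snd_eucl_dist c p) as W2.
  set (w1 := fst p - fst c) in *. set (w2 := snd p - snd c) in *. set (w := eucl_dist c p) in *.
  assert (w0 : 0 <= w) by apply eucl_dist_ge_0.
  assert (Dv : forall f, C1_on D f -> forall t, 0 <= t <= 1 ->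
    is_derive (fun t => f (segment c p t)) t (d1 f (segment c p t) * w1 + d2 f (segment c p t) * w2)).
  { intros f Cf t Ht. apply (C1_on_chain D f (fun t => fst c + t * w1) (fun t => snd c + t * w2)); auto.
    - apply (Hd _ (Sg t Ht)).
    - auto_derive; auto; ring.
    - auto_derive; auto; ring. }
  assert (Gr : forall q, (exists t, 0 <= t <= 1 /\ q = segment c p t) ->
     Rabs (d1 u q + (fst q - fst c) / 2) <= 2 * eta * eucl_dist c q /\
     Rabs (d2 u q + (snd q - snd c) / 2) <= 2 * eta * eucl_dist c q).
  { intros q [T [HT ->]]. rewrite eucl_dist_segment by lra. fold w.
    destruct (Req_dec T 0) as [->|T0].
    { rewrite S0, G1, G2, !Rminus_diag. unfold Rdiv. rewrite !Rmult_0_l, !Rplus_0_r, Rabs_R0. lra. }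
    split.
    - destruct (mvt (fun t => d1 u (segment c p t) + t * w1 / 2)
        (fun t => d1 (d1 u) (segment c p t) * w1 + d2 (d1 u) (segment c p t) * w2 + w1 / 2) 0 T)
        as [t [Ht Et]]; [lra| |].
      { intros t Ht. apply @is_derive_plus; [apply Dv; auto; lra|auto_derive; auto; field]. }
      rewrite S0, G1 in Et.
      replace (d1 u (segment c p T) + (fst (segment c p T) - fst c) / 2)
        with (T * ((d1 (d1 u) (segment c p t) - - (1 / 2)) * w1 + (d2 (d1 u) (segment c p t) - 0) * w2)).
      2:{ unfold segment at 4; simpl. fold w1. lra. }
      rewrite Rabs_mult, Rabs_pos_eq by lra.
      destruct (Hd _ (Sg t ltac:(lra))) as [_ [[Q1 _] [_ Q2]]].
      eapply Rle_trans; [apply Rmult_le_compat_l; [lra|apply Rabs_triang]|].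
      rewrite !Rabs_mult.
      assert (Rabs (d1 (d1 u) (segment c p t) - - (1 / 2)) * Rabs w1 <= eta * w).
      { apply Rmult_le_compat; try apply Rabs_pos; lra. }
      assert (Rabs (d2 (d1 u) (segment c p t) - 0) * Rabs w2 <= eta * w).
      { apply Rmult_le_compat; try apply Rabs_pos; lra. }
      apply Rle_trans with (T * (2 * eta * w)); [apply Rmult_le_compat_l; lra|lra].
    - destruct (mvt (fun t => d2 u (segment c p t) + t * w2 / 2)
        (fun t => d1 (d2 u) (segment c p t) * w1 + d2 (d2 u) (segment c p t) * w2 + w2 / 2) 0 T)
        as [t [Ht Et]]; [lra| |].
      { intros t Ht. apply @is_derive_plus; [apply Dv; auto; lra|auto_derive; auto; field]. }
      rewrite S0, G2 in Et.
      replace (d2 u (segment c p T) + (snd (segment c p T) - snd c) / 2)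
        with (T * ((d1 (d2 u) (segment c p t) - 0) * w1 + (d2 (d2 u) (segment c p t) - - (1 / 2)) * w2)).
      2:{ unfold segment at 4; simpl. fold w2. lra. }
      rewrite Rabs_mult, Rabs_pos_eq by lra.
      destruct (Hd _ (Sg t ltac:(lra))) as [_ [[_ Q1] [Q2 _]]].
      eapply Rle_trans; [apply Rmult_le_compat_l; [lra|apply Rabs_triang]|].
      rewrite !Rabs_mult.
      assert (Rabs (d2 (d2 u) (segment c p t) - - (1 / 2)) * Rabs w2 <= eta * w).
      { apply Rmult_le_compat; try apply Rabs_pos; lra. }
      assert (Rabs (d1 (d2 u) (segment c p t) - 0) * Rabs w1 <= eta * w).
      { apply Rmult_le_compat; try apply Rabs_pos; lra. }
      apply Rle_trans with (T * (2 * eta * w)); [apply Rmult_le_compat_l; lra|lra]. }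
  destruct (Hd p Hp) as [Dp [[Q11 Q22] [Q12 Q21]]].
  rewrite Rminus_0_r in Q12, Q21. unfold Rminus in Q11, Q22. rewrite Ropp_involutive in Q11, Q22.
  split; [exact Dp|]. do 4 (split; [lra|]).
  destruct (Gr p) as [P1 P2]; [exists 1; split; [lra|now rewrite S1]|].
  split; [exact P1|split; [exact P2|]].
  destruct (mvt (fun t => u (segment c p t) + t ^ 2 * dist2 c p / 4)
     (fun t => d1 u (segment c p t) * w1 + d2 u (segment c p t) * w2 + t * dist2 c p / 2) 0 1)
     as [t [Ht Et]]; [lra| |].
  { intros t Ht. apply @is_derive_plus; [apply Dv; auto; lra|auto_derive; auto; field]. }
  rewrite S0, S1 in Et.
  replace (u p - u c + dist2 c p / 4) with
    ((d1 u (segment c p t) + t * w1 / 2) * w1 + (d2 u (segment c p t) + t * w2 / 2) * w2).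
  2:{ unfold dist2 in Et |- *. fold w1 w2 in Et |- *. lra. }
  destruct (Gr (segment c p t)) as [R1 R2]; [now exists t|].
  rewrite eucl_dist_segment in R1, R2 by lra. unfold segment at 2 in R1. unfold segment at 2 in R2.
  simpl in R1, R2. fold w1 w2 w in R1, R2.
  replace (fst c + t * w1 - fst c) with (t * w1) in R1 by ring.
  replace (snd c + t * w2 - snd c) with (t * w2) in R2 by ring.
  eapply Rle_trans; [apply Rabs_triang|]. rewrite !Rabs_mult.
  rewrite <- eucl_dist_pow2. fold w.
  assert (tw : 2 * eta * (t * w) <= 2 * eta * w) by (apply Rmult_le_compat_l; [lra|nra]).
  assert (Rabs (d1 u (segment c p t) + t * w1 / 2) * Rabs w1 <= 2 * eta * w * w).
  { apply Rmult_le_compat; try apply Rabs_pos; lra. }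
  assert (Rabs (d2 u (segment c p t) + t * w2 / 2) * Rabs w2 <= 2 * eta * w * w).
  { apply Rmult_le_compat; try apply Rabs_pos; lra. }
  lra.
Qed.

Lemma bounded_eucl_dist (D : plane -> Prop) (c : plane) :
  bounded_region D -> exists R0, 0 < R0 /\ forall p, D p -> eucl_dist c p <= R0.
Proof.
  intros [M HM]. exists (Rabs M + norm c + 1).
  pose proof (norm_ge_0 c). pose proof (Rabs_pos M). split; [lra|].
  intros p Dp. specialize (HM p Dp). pose proof (Rle_abs M).
  pose proof (norm_triangle (V := prod_NormedModule R_AbsRing R_NormedModule R_NormedModule) c (opp p)) as T.
  pose proof (norm_opp (V := prod_NormedModule R_AbsRing R_NormedModule R_NormedModule) p) as T'.
  change (norm (plus c (opp p)) <= Rabs M + norm c + 1).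
  eapply Rle_trans; [exact T|]. apply Rle_trans with (norm c + norm p); [|lra].
  apply Rplus_le_compat_l. right. exact T'.
Qed.

(** The maximum point is unique, quantitatively: repeated midpoints bring any
    point near [c] without decreasing [u]. *)
Lemma torsion_strict_max (D : plane -> Prop) (u : plane -> R) (c : plane) (l r : R) :
  open D -> bounded_region D -> convex D -> torsion_function D u -> max_point D u c ->
  eigenvalue_pair (hessian u c) l l -> 0 < r ->
  exists k, 0 < k /\ forall p, D p -> r <= eucl_dist c p -> u p <= u c - k.
Proof.
  intros Dop Db Dc Tu Hm HE r0.
  destruct (near_round_center D u c l (1 / 32) Dop Tu Hm HE) as [d [d0 Hd]]; [lra|].
  pose (r' := Rmin d r). assert (r'0 : 0 < r') by now apply Rmin_pos.
  exists ((r' / 2) ^ 2 / 8).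
  split; [assert (0 < (r' / 2) ^ 2) by (apply pow_lt; lra); lra|].
  assert (I : forall n p, D p -> r' / 2 <= eucl_dist c p <= r' * 2 ^ n -> u p <= u c - (r' / 2) ^ 2 / 8).
  { induction n as [|n IH]; intros p Dp [H1 H2].
    - destruct (Hd p) as [_ [_ [_ [_ [_ [_ [_ H]]]]]]].
      { pose proof (Rmin_l d r). fold r' in H. simpl in H2. lra. }
      apply Rabs_le_between in H. rewrite <- eucl_dist_pow2 in H.
      assert ((r' / 2) ^ 2 <= eucl_dist c p ^ 2) by (apply pow_incr; lra). lra.
    - destruct (Rle_lt_dec (eucl_dist c p) r') as [Hs|Hs].
      { destruct (Hd p) as [_ [_ [_ [_ [_ [_ [_ H]]]]]]].
        { pose proof (Rmin_l d r). fold r' in H. lra. }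
        apply Rabs_le_between in H. rewrite <- eucl_dist_pow2 in H.
        assert ((r' / 2) ^ 2 <= eucl_dist c p ^ 2) by (apply pow_incr; lra). lra. }
      destruct (torsion_mid_max D u c p Dop Db Dc Tu Hm Dp) as [Dm Hle].
      apply Rle_trans with (1 := Hle). apply IH; auto.
      replace (mid c p) with (segment c p (1 / 2)) by (unfold segment, mid; f_equal; field).
      rewrite eucl_dist_segment by lra. simpl in H2. lra. }
  intros p Dp Hp.
  destruct (bounded_eucl_dist D c Db) as [R0 [R00 HR]].
  destruct (Pow_x_infinity 2) with (b := R0 / r') as [N HN].
  { rewrite Rabs_pos_eq; lra. }
  apply (I N); auto. split.
  - pose proof (Rmin_r d r). fold r' in H. lra.
  - apply Rle_trans with (1 := HR p Dp).
    specialize (HN N (Nat.le_refl N)). rewrite Rabs_pos_eq in HN by (apply pow_le; lra).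
    apply Rge_le in HN. apply Rmult_le_compat_l with (r := r') in HN; [|lra].
    replace (r' * (R0 / r')) with R0 in HN by (field; lra). exact HN.
Qed.

(** * Logarithmic barriers on the perforated domain *)

(** [ln |p - c|]. *)
Definition logdist (c p : plane) : R := ln (dist2 c p) / 2.

Lemma logdist_le (c p : plane) (r : R) : 0 < dist2 c p <= r ^ 2 -> 0 < r -> logdist c p <= ln r.
Proof.
  intros [H1 H2] r0. unfold logdist.
  assert (ln (dist2 c p) <= ln (r ^ 2)) by now apply ln_le.
  rewrite ln_pow in H by auto. simpl in H. lra.
Qed.

Lemma logdist_ge (c p : plane) (r : R) : 0 < r -> r ^ 2 <= dist2 c p -> ln r <= logdist c p.
Proof.
  intros r0 H2. unfold logdist.
  assert (ln (r ^ 2) <= ln (dist2 c p)) by (apply ln_le; auto; now apply pow_lt).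
  rewrite ln_pow in H by auto. simpl in H. lra.
Qed.

Lemma has_lap_logdist (c p : plane) : 0 < dist2 c p -> has_lap (logdist c) p 0.
Proof.
  intros H. pose (k := dist2 c p).
  assert (J : forall a b x, 0 < (x - a) ^ 2 + b ->
    jet2 (fun s => ln ((s - a) ^ 2 + b) / 2) x ((x - a) / ((x - a) ^ 2 + b))
      (/ ((x - a) ^ 2 + b) - 2 * (x - a) ^ 2 / ((x - a) ^ 2 + b) ^ 2)).
  { intros a b x Hx. exists (fun s => (s - a) / ((s - a) ^ 2 + b)). split; [reflexivity|split].
    - assert (C : continuous (fun s => (s - a) ^ 2 + b) x).
      { apply (@ex_derive_continuous R_AbsRing R_NormedModule). auto_derive; auto. }
      pose proof (C _ (open_gt 0 _ Hx)) as L. revert L. unfold filtermap. apply filter_imp.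
      intros s Hs. auto_derive; [lra|]. field. lra.
    - auto_derive; [lra|]. field. lra. }
  unfold dist2 in H.
  do 4 eexists. split; [|split].
  - apply (J (fst c) ((snd p - snd c) ^ 2) (fst p) H).
  - apply jet2_ext_loc with (fun s => ln ((s - snd c) ^ 2 + (fst p - fst c) ^ 2) / 2).
    { apply filter_forall. intros s. unfold logdist, dist2. simpl fst; simpl snd.
      now rewrite (Rplus_comm ((fst p - fst c) ^ 2)). }
    apply J. lra.
  - field. lra.
Qed.

Lemma continuous_logdist (c p : plane) : 0 < dist2 c p -> continuous (logdist c) p.
Proof.
  intros H. apply (continuous_comp (dist2 c) (fun v => ln v / 2)).
  - apply continuous_dist2.
  - apply (@ex_derive_continuous R_AbsRing R_NormedModule). auto_derive; auto.
Qed.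

Lemma perforated_open (D : plane -> Prop) (c : plane) (r : R) :
  open D -> 0 < r -> open (perforated D c r).
Proof.
  intros Dop r0 p [Dp Np]. apply filter_and; [now apply Dop|].
  assert (H : r ^ 2 < dist2 c p).
  { rewrite <- eucl_dist_pow2. unfold closed_disc in Np.
    apply Rnot_le_lt in Np. nra. }
  pose proof (continuous_dist2 c p _ (open_gt (r ^ 2) _ H)) as L. revert L. unfold filtermap.
  apply filter_imp. intros q Hq Cq. unfold closed_disc in Cq.
  rewrite <- eucl_dist_pow2 in Hq. pose proof (pow_incr _ _ 2 (conj (eucl_dist_ge_0 c q) Cq)). lra.
Qed.

Lemma perforated_bounded (D : plane -> Prop) (c : plane) (r : R) :
  bounded_region D -> bounded_region (perforated D c r).
Proof. intros [M HM]. exists M. intros p [Dp _]. auto. Qed.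

Lemma perforated_closure (D : plane -> Prop) (c p : plane) (r : R) :
  0 < r -> closure (perforated D c r) p -> closure D p /\ r ^ 2 <= dist2 c p.
Proof.
  intros r0 Cp. split.
  - intros e. destruct (Cp e) as [q [[Dq _] Bq]]. now exists q.
  - apply Rnot_lt_le. intros Hl.
    destruct (continuous_dist2 c p _ (open_lt (r ^ 2) _ Hl)) as [e He].
    destruct (Cp e) as [q [[_ Nq] Bq]]. specialize (He q Bq). apply Nq. unfold closed_disc.
    rewrite <- eucl_dist_pow2 in He. pose proof (eucl_dist_ge_0 c q).
    apply Rnot_lt_le. intros Hr. assert (r ^ 2 <= eucl_dist c q ^ 2) by (apply pow_incr; lra). lra.
Qed.

Lemma perforated_boundary (D : plane -> Prop) (c p : plane) (r : R) :
  open D -> 0 < r -> boundary (perforated D c r) p ->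
  (boundary D p /\ ~ D p) \/ (D p /\ dist2 c p = r ^ 2).
Proof.
  intros Dop r0 Bp. pose proof (boundary_open _ _ (perforated_open D c r Dop r0) Bp) as Np.
  destruct (perforated_closure D c p r r0 (proj1 Bp)) as [Cp Hp].
  destruct (classic (D p)) as [Dp|Dp].
  - right. split; auto. apply Rle_antisym; auto. apply Rnot_lt_le. intros Hl. apply Np.
    split; auto. unfold closed_disc. intros Hc.
    pose proof (pow_incr _ _ 2 (conj (eucl_dist_ge_0 c p) Hc)). rewrite eucl_dist_pow2 in H. lra.
  - left. split; auto. split; auto. now apply (closure_subset (fun q => ~ D q)).
Qed.

Section Comparison.

Variables (D : plane -> Prop) (u0 u : plane -> R) (c : plane) (e : R).
Hypothesis Dop : open D.
Hypothesis Db : bounded_region D.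
Hypothesis e0 : 0 < e.
Hypothesis T0 : torsion_function D u0.
Hypothesis Te : torsion_function (perforated D c e) u.

Let v (p : plane) : R := u0 p - u p.

Lemma difference_has_lap (p : plane) : perforated D c e p -> has_lap v p 0.
Proof.
  intros Pp. apply has_lap_ext with v (-1 - -1); [reflexivity|ring|].
  apply has_lap_minus.
  - apply torsion_has_lap with D; auto. apply Pp.
  - apply torsion_has_lap with (perforated D c e); auto. now apply perforated_open.
Qed.

Lemma difference_continuous_on : continuous_on (closure (perforated D c e)) v.
Proof.
  apply continuous_on_minus.
  - apply continuous_on_subset with (closure D); [|apply T0].
    intros p Cp. now apply (perforated_closure D c p e).
  - apply Te.
Qed.

Lemma difference_boundary (p : plane) : boundary (perforated D c e) p -> v p = u0 p.
Proof. intros Bp. unfold v. replace (u p) with 0; [ring|symmetry; now apply Te]. Qed.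

Lemma difference_ge_0 (p : plane) : closure (perforated D c e) p -> 0 <= v p.
Proof.
  intros Cp. enough (-1 * v p <= 0) by lra.
  apply (max_principle_domain (perforated D c e) (fun p => -1 * v p)); auto.
  - now apply perforated_open.
  - now apply perforated_bounded.
  - apply continuous_on_scal, difference_continuous_on.
  - intros q Pq. exists (-1 * 0). split; [lra|]. now apply has_lap_scal, difference_has_lap.
  - intros q Bq. rewrite difference_boundary by auto.
    enough (0 <= u0 q) by lra. apply torsion_nonneg with D; auto.
    apply (perforated_closure D c q e); auto. apply Bq.
Qed.

Lemma logdist_barrier (k s : R) :
  continuous_on (closure (perforated D c e)) (fun p => k * (s - logdist c p)) /\
  forall p, perforated D c e p -> has_lap (fun p => k * (s - logdist c p)) p 0.
Proof.
  assert (Pos : forall p, closure (perforated D c e) p -> 0 < dist2 c p).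
  { intros p Cp. apply Rlt_le_trans with (e ^ 2); [now apply pow_lt|].
    now apply (perforated_closure D c p e). }
  split.
  - apply continuous_on_scal, continuous_on_minus.
    + apply continuous_on_of_continuous. intros; apply continuous_const.
    + apply continuous_on_of_continuous. intros. now apply continuous_logdist, Pos.
  - intros p Pp. apply has_lap_ext with (fun p => k * (s - logdist c p)) (k * (0 - 0)); [reflexivity|ring|].
    apply has_lap_scal, has_lap_minus; [apply has_lap_const|].
    apply has_lap_logdist, Pos. now apply closure_subset.
Qed.

(** The barrier is [M >= u0] on the circle of radius [e], and it is nonnegative
    on the outer boundary, which lies in the disc of radius [R0]. *)
Lemma difference_upper (M R0 : R) :
  (forall p, D p -> u0 p <= M) -> 0 <= M -> e < R0 ->
  (forall p, D p -> eucl_dist c p <= R0) ->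
  forall p, closure (perforated D c e) p ->
    v p <= M * (ln R0 - logdist c p) / (ln R0 - ln e).
Proof.
  intros HM M0 eR HR p Cp.
  assert (L0 : 0 < ln R0 - ln e) by (assert (ln e < ln R0) by (apply ln_increasing; lra); lra).
  destruct (logdist_barrier (M / (ln R0 - ln e)) (ln R0)) as [BC BL].
  assert (k0 : 0 <= M / (ln R0 - ln e)).
  { apply Rmult_le_pos; auto. left. now apply Rinv_0_lt_compat. }
  assert (CR : forall q, closure D q -> dist2 c q <= R0 ^ 2).
  { intros q Cq. apply Rnot_lt_le. intros Hl.
    destruct (continuous_dist2 c q _ (open_gt (R0 ^ 2) _ Hl)) as [d Hd].
    destruct (Cq d) as [q' [Dq Bq]]. specialize (Hd q' Bq). rewrite <- eucl_dist_pow2 in Hd.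
    pose proof (pow_incr _ _ 2 (conj (eucl_dist_ge_0 c q') (HR q' Dq))). lra. }
  assert (H : v p - M / (ln R0 - ln e) * (ln R0 - logdist c p) <= 0).
  { refine (max_principle_domain (perforated D c e)
      (fun p => v p - M / (ln R0 - ln e) * (ln R0 - logdist c p)) _ _ _ _ _ p Cp).
    - now apply perforated_open.
    - now apply perforated_bounded.
    - apply continuous_on_minus; auto. apply difference_continuous_on.
    - intros q Pq. exists (0 - 0). split; [lra|].
      apply has_lap_minus; [now apply difference_has_lap|now apply BL].
    - intros q Bq. rewrite difference_boundary by auto.
      destruct (perforated_boundary D c q e Dop e0 Bq) as [[Bq' Nq]|[Dq Eq]].
      + replace (u0 q) with 0 by (symmetry; now apply T0).
        assert (logdist c q <= ln R0).
        { apply logdist_le; [|lra]. split; [|apply CR, Bq'].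
          apply Rlt_le_trans with (e ^ 2); [now apply pow_lt|].
          apply (perforated_closure D c q e); auto. apply Bq. }
        assert (0 <= M / (ln R0 - ln e) * (ln R0 - logdist c q)) by (apply Rmult_le_pos; lra).
        lra.
      + assert (El : logdist c q = ln e).
        { unfold logdist. rewrite Eq, ln_pow by auto. simpl. field. }
        rewrite El. specialize (HM q Dq).
        replace (M / (ln R0 - ln e) * (ln R0 - ln e)) with M by (field; lra). lra. }
  replace (M * (ln R0 - logdist c p) / (ln R0 - ln e))
    with (M / (ln R0 - ln e) * (ln R0 - logdist c p)) by (field; lra). lra.
Qed.

(** The barrier is [m <= u0] on the circle of radius [e], and at most [0] on the
    outer boundary, which lies outside the disc of radius [r0]. *)
Lemma difference_lower (m r0 : R) :
  (forall p, dist2 c p = e ^ 2 -> m <= u0 p) -> 0 <= m -> e < r0 ->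
  (forall p, eucl_dist c p < r0 -> D p) ->
  forall p, closure (perforated D c e) p ->
    m * (ln r0 - logdist c p) / (ln r0 - ln e) <= v p.
Proof.
  intros Hm m0 er Hr p Cp.
  assert (L0 : 0 < ln r0 - ln e) by (assert (ln e < ln r0) by (apply ln_increasing; lra); lra).
  destruct (logdist_barrier (m / (ln r0 - ln e)) (ln r0)) as [BC BL].
  assert (k0 : 0 <= m / (ln r0 - ln e)).
  { apply Rmult_le_pos; auto. left. now apply Rinv_0_lt_compat. }
  assert (H : m / (ln r0 - ln e) * (ln r0 - logdist c p) - v p <= 0).
  { refine (max_principle_domain (perforated D c e)
      (fun p => m / (ln r0 - ln e) * (ln r0 - logdist c p) - v p) _ _ _ _ _ p Cp).
    - now apply perforated_open.
    - now apply perforated_bounded.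
    - apply continuous_on_minus; auto. apply difference_continuous_on.
    - intros q Pq. exists (0 - 0). split; [lra|].
      apply has_lap_minus; [now apply BL|now apply difference_has_lap].
    - intros q Bq. rewrite difference_boundary by auto.
      destruct (perforated_boundary D c q e Dop e0 Bq) as [[Bq' Nq]|[Dq Eq]].
      + replace (u0 q) with 0 by (symmetry; now apply T0).
        assert (ln r0 <= logdist c q).
        { apply logdist_ge; [lra|]. apply Rnot_lt_le. intros Hl. apply Nq, Hr.
          apply Rnot_le_lt. intros Hle. rewrite <- eucl_dist_pow2 in Hl.
          assert (r0 ^ 2 <= eucl_dist c q ^ 2) by (apply pow_incr; lra). lra. }
        assert (0 <= m / (ln r0 - ln e) * (logdist c q - ln r0)) by (apply Rmult_le_pos; lra).
        lra.
      + assert (El : logdist c q = ln e).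
        { unfold logdist. rewrite Eq, ln_pow by auto. simpl. field. }
        rewrite El. specialize (Hm q Eq).
        replace (m / (ln r0 - ln e) * (ln r0 - ln e)) with m by (field; lra). lra. }
  replace (m * (ln r0 - logdist c p) / (ln r0 - ln e))
    with (m / (ln r0 - ln e) * (ln r0 - logdist c p)) by (field; lra). lra.
Qed.

End Comparison.

(** * Angular derivatives of periodic harmonic functions on a strip *)

Lemma sin_ge_third (t : R) : 0 <= t <= 2 -> t <= 3 * sin t.
Proof.
  intros Ht. destruct (pre_sin_bound t 0) as [H _]; try lra.
  unfold sin_approx, sin_term in H. simpl in H.
  assert (t * (t ^ 2) <= t * 4) by (apply Rmult_le_compat_l; nra).
  nra.
Qed.

Lemma has_lap_exp_sin (s t : R) : has_lap (fun p => exp (fst p) * sin (snd p)) (s, t) 0.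
Proof.
  exists (exp s * sin t), (exp s * sin t), (exp s * cos t), (- (exp s * sin t)). simpl.
  split; [|split]; [| |ring].
  - exists (fun s => exp s * sin t). split; [reflexivity|split].
    + apply filter_forall. intros y. auto_derive; auto; ring.
    + auto_derive; auto; ring.
  - exists (fun t => exp s * cos t). split; [reflexivity|split].
    + apply filter_forall. intros y. auto_derive; auto; ring.
    + auto_derive; auto; ring.
Qed.

Lemma continuous_exp_sin (p : plane) : continuous (fun p : plane => exp (fst p) * sin (snd p)) p.
Proof.
  apply (continuous_mult (fun p : plane => exp (fst p)) (fun p : plane => sin (snd p))).
  - apply (continuous_comp (fun p : plane => fst p) exp); [apply continuous_fst|].
    apply (@ex_derive_continuous R_AbsRing R_NormedModule). auto_derive; auto.
  - apply (continuous_comp (fun p : plane => snd p) sin); [apply continuous_snd|].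
    apply (@ex_derive_continuous R_AbsRing R_NormedModule). auto_derive; auto.
Qed.

Lemma has_lap_translate (f : plane -> R) (s t tau l : R) :
  has_lap f (s, t + tau) l -> has_lap (fun p => f (fst p, snd p + tau)) (s, t) l.
Proof.
  intros [a' [a [b' [b [H1 [H2 H3]]]]]]; simpl in *.
  exists a', a, (1 * b'), (1 ^ 2 * b). split; [exact H1|split; [|lra]]. simpl fst; simpl snd.
  apply jet2_ext_loc with (fun r => f (s, tau + 1 * r)).
  { apply filter_forall. intros r. cbn [fst snd]. replace (tau + 1 * r) with (r + tau) by ring. reflexivity. }
  apply (jet2_affine (fun r => f (s, r)) tau 1 t). now replace (tau + 1 * t) with (t + tau) by ring.
Qed.

Lemma continuous_translate (f : plane -> R) (p : plane) (tau : R) :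
  continuous f (fst p, snd p + tau) -> continuous (fun p => f (fst p, snd p + tau)) p.
Proof.
  intros H. apply continuous_ext with (fun p : plane => f (fst p, tau + 1 * snd p)).
  { intros [q1 q2]. cbn [fst snd]. replace (tau + 1 * q2) with (q2 + tau) by ring. reflexivity. }
  apply (continuous_comp (fun p : plane => (fst p, tau + 1 * snd p) : plane) f).
  - apply continuous_shift.
  - now replace (tau + 1 * snd p) with (snd p + tau) by ring.
Qed.

(** In the application [(s, t)] are the logarithm of the radius and the angle, [V]
    is the difference of the two torsion functions, [exp a] is the radius of the
    perforation and [exp b] is a fixed radius, near which [V] is bounded by [B]. *)
Section Strip.

Variables (V : plane -> R) (a b B E : R).
Hypothesis ab : a < b - 2.
Hypothesis B0 : 0 <= B.
Hypothesis E0 : 0 <= E.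
Hypothesis Vcont : continuous_on (fun p => a <= fst p <= b) V.
Hypothesis Vharm : forall p, a < fst p <= b + 2 -> continuous V p /\ has_lap V p 0.
Hypothesis Vper : forall s t, V (s, t + 2 * PI) = V (s, t).
Hypothesis Vbound : forall p, b - 2 <= fst p <= b + 2 -> Rabs (V p) <= B.
Hypothesis Vinner : forall t tau, 0 <= tau <= PI / 2 ->
  Rabs (V (a, t + tau) - V (a, t - tau)) <= E * tau.

Let kappa : R := 6 * B / exp b + 3 * E / exp a.

Lemma kappa_ge_0 : 0 <= kappa.
Proof.
  apply Rplus_le_le_0_compat; (apply Rmult_le_pos; [lra|]); left;
    apply Rinv_0_lt_compat, exp_pos.
Qed.

Lemma strip_sides (s t tau : R) : s = a \/ s = b -> 0 <= tau <= PI ->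
  Rabs (V (s, t + tau) - V (s, t - tau)) <= kappa * (exp s * sin tau).
Proof.
  intros Hs Ht.
  assert (S : forall t tau, 0 <= tau <= PI / 2 ->
    Rabs (V (s, t + tau) - V (s, t - tau)) <= kappa * (exp s * sin tau)).
  { clear t tau Ht. intros t tau Ht. pose proof PI_4 as P4.
    pose proof (sin_ge_third tau ltac:(lra)) as S3.
    pose proof (exp_pos a) as ea. pose proof (exp_pos b) as eb.
    assert (K1 : 0 <= 6 * B / exp b) by (apply Rmult_le_pos; [lra|left; now apply Rinv_0_lt_compat]).
    assert (K2 : 0 <= 3 * E / exp a) by (apply Rmult_le_pos; [lra|left; now apply Rinv_0_lt_compat]).
    destruct Hs as [-> | ->].
    - apply Rle_trans with (1 := Vinner t tau Ht).
      apply Rle_trans with (3 * E / exp a * (exp a * sin tau)).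
      + replace (3 * E / exp a * (exp a * sin tau)) with (E * (3 * sin tau)) by (field; lra).
        now apply Rmult_le_compat_l.
      + apply Rmult_le_compat_r; [|unfold kappa; lra]. apply Rmult_le_pos; lra.
    - apply Rle_trans with (4 * B / 2 * tau).
      + apply (gradient_estimate V b t 2 B); try lra.
        intros [p1 p2] [Hp1 Hp2]. cbn [fst snd] in *.
        destruct (Vharm (p1, p2) ltac:(cbn [fst snd]; lra)) as [V1 V2].
        split; [exact V1|split; [exact V2|]]. apply Vbound. cbn [fst snd]. lra.
      + apply Rle_trans with (6 * B / exp b * (exp b * sin tau)).
        * replace (6 * B / exp b * (exp b * sin tau)) with (2 * B * (3 * sin tau)) by (field; lra).
          replace (4 * B / 2) with (2 * B) by field. apply Rmult_le_compat_l; lra.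
        * apply Rmult_le_compat_r; [|unfold kappa; lra]. apply Rmult_le_pos; lra. }
  destruct (Rle_lt_dec tau (PI / 2)) as [H|H]; [apply S; lra|].
  (* Beyond the quarter turn, measure the angle from the opposite ray. *)
  specialize (S (t + PI) (PI - tau) ltac:(lra)).
  replace (t + PI + (PI - tau)) with (t - tau + 2 * PI) in S by ring. rewrite Vper in S.
  replace (t + PI - (PI - tau)) with (t + tau) in S by ring.
  rewrite sin_PI_x, Rabs_minus_sym in S. exact S.
Qed.

Lemma strip_half (k s t tau : R) : k = 1 \/ k = -1 -> a <= s <= b -> 0 <= tau <= PI ->
  k * (V (s, t + tau) - V (s, t - tau)) - kappa * (exp s * sin tau) <= 0.
Proof.
  intros Hk Hs Ht.
  refine (max_principle (rectangle a b 0 PI)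
    (fun p => k * (V (fst p, t + snd p) - V (fst p, t - snd p)) - kappa * (exp (fst p) * sin (snd p)))
    _ _ _ (s, tau) _).
  - apply seq_compact_rectangle.
  - apply continuous_on_minus; [apply continuous_on_scal, continuous_on_minus|].
    + apply continuous_on_ext with (fun p : plane => V (fst p, t + 1 * snd p)).
      { intros p _. change (V (fst p, t + 1 * snd p) = V (fst p, t + snd p)). now rewrite Rmult_1_l. }
      apply continuous_on_comp with (3 := Vcont); [intros; apply continuous_shift|].
      intros [s' t'] [K1 K2]. simpl in *. lra.
    + apply continuous_on_ext with (fun p : plane => V (fst p, t + -1 * snd p)).
      { intros p _. change (V (fst p, t + -1 * snd p) = V (fst p, t - snd p)).
        now replace (t + -1 * snd p) with (t - snd p) by ring. }
      apply continuous_on_comp with (3 := Vcont); [intros; apply continuous_shift|].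
      intros [s' t'] [K1 K2]. simpl in *. lra.
    + apply continuous_on_scal, continuous_on_of_continuous. intros; apply continuous_exp_sin.
  - intros [s' t'] [K1 K2]. cbn [fst snd] in *.
    assert (Sd : forall x y, Rabs x <= y -> k * x - y <= 0).
    { intros x y Hx. apply Rabs_le_between in Hx. destruct Hk as [-> | ->]; lra. }
    destruct (Req_dec s' a) as [Ea|Na]; [left; apply Sd, strip_sides; auto|].
    destruct (Req_dec s' b) as [Eb|Nb]; [left; apply Sd, strip_sides; auto|].
    destruct (Req_dec t' 0) as [->|N0].
    { left. rewrite Rplus_0_r, Rminus_0_r, sin_0. lra. }
    destruct (Req_dec t' PI) as [->|NP].
    { left. rewrite sin_PI. replace (t + PI) with (t - PI + 2 * PI) by ring. rewrite Vper. lra. }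
    right. split; [apply locally_rectangle; simpl; lra|].
    exists 0. split; [lra|].
    apply has_lap_ext with (fun p => k * (V (fst p, t + snd p) - V (fst p, t - snd p))
      - kappa * (exp (fst p) * sin (snd p))) (k * 0 - kappa * 0); [reflexivity|ring|].
    apply has_lap_minus; apply has_lap_scal; [|apply has_lap_exp_sin].
    apply has_lap_reflected_difference; apply Vharm; simpl; lra.
  - split; simpl; lra.
Qed.

(** The odd reflection in the angle vanishes for [tau = 0] and [tau = PI]; it is
    dominated by the harmonic function [exp s sin tau], that is, by the Cartesian
    coordinate [y].  Compared with the bound at [s = b] this gains the factor
    [exp s]. *)
Lemma strip_difference (s t tau : R) : a <= s <= b -> 0 <= tau <= PI ->
  Rabs (V (s, t + tau) - V (s, t - tau)) <= kappa * (exp s * sin tau).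
Proof.
  intros Hs Ht.
  pose proof (strip_half 1 s t tau (or_introl eq_refl) Hs Ht).
  pose proof (strip_half (-1) s t tau (or_intror eq_refl) Hs Ht).
  apply Rabs_le. lra.
Qed.

(** The gradient estimate applied to the difference of two rotated copies. *)
Lemma strip_second_difference (s t tau : R) : a < s - 1 -> s + 1 <= b -> 0 <= tau <= 1 ->
  Rabs (V (s, t + 2 * tau) + V (s, t - 2 * tau) - 2 * V (s, t))
    <= kappa * exp (s + 1) * (2 * tau) ^ 2.
Proof.
  intros H1 H2 Ht.
  pose (F := fun p : plane => V (fst p, snd p + tau) - V (fst p, snd p + - tau)).
  pose proof kappa_ge_0 as k0.
  assert (G : Rabs (F (s, t + tau) - F (s, t - tau)) <= 4 * (kappa * exp (s + 1) * tau) / 1 * tau).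
  { apply gradient_estimate; try lra.
    - apply Rmult_le_pos; [|lra]. apply Rmult_le_pos; auto. left; apply exp_pos.
    - intros [s' t'] [K1 K2]. cbn [fst snd] in *. split; [|split].
      + apply (continuous_minus (fun p => V (fst p, snd p + tau)) (fun p => V (fst p, snd p + - tau)));
          apply continuous_translate, Vharm; simpl; lra.
      + apply has_lap_ext with F (0 - 0); [reflexivity|ring|].
        apply has_lap_minus; apply has_lap_translate, Vharm; simpl; lra.
      + unfold F. cbn [fst snd]. fold (t' - tau). pose proof PI2_1.
        apply Rle_trans with (1 := strip_difference s' t' tau ltac:(lra) ltac:(lra)).
        rewrite Rmult_assoc. apply Rmult_le_compat_l; auto.
        apply Rmult_le_compat; [left; apply exp_pos|apply sin_ge_0; lra| |].
        * destruct (Req_dec s' (s + 1)) as [->|]; [lra|]. left. apply exp_increasing. lra.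
        * destruct (Req_dec tau 0) as [->|]; [rewrite sin_0; lra|]. left. apply sin_lt_x. lra. }
  unfold F in G. cbn [fst snd] in G.
  replace (t + tau + tau) with (t + 2 * tau) in G by ring.
  replace (t + tau + - tau) with t in G by ring.
  replace (t - tau + tau) with t in G by ring.
  replace (t - tau + - tau) with (t - 2 * tau) in G by ring.
  replace (V (s, t + 2 * tau) + V (s, t - 2 * tau) - 2 * V (s, t)) with
    (V (s, t + 2 * tau) - V (s, t) - (V (s, t) - V (s, t - 2 * tau))) by ring.
  replace (kappa * exp (s + 1) * (2 * tau) ^ 2) with (4 * (kappa * exp (s + 1) * tau) / 1 * tau) by field.
  exact G.
Qed.

Lemma strip_second_derivative (s t v1 v2 : R) : a < s - 1 -> s + 1 <= b ->
  jet2 (fun r => V (s, r)) t v1 v2 -> Rabs v2 <= kappa * exp (s + 1).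
Proof.
  intros H1 H2 J.
  assert (S : locally 0 (fun h =>
    Rabs (V (s, t + h) + V (s, t - h) - 2 * V (s, t)) <= kappa * exp (s + 1) * h ^ 2)).
  { exists (mkposreal 1 Rlt_0_1). intros h Hh. change R in h. apply Rabs_ball in Hh. simpl in Hh.
    rewrite Rminus_0_r in Hh. apply Rabs_def2 in Hh.
    destruct (Rle_lt_dec 0 h) as [Hp|Hn].
    - pose proof (strip_second_difference s t (h / 2) H1 H2 ltac:(lra)) as Q.
      now replace (2 * (h / 2)) with h in Q by field.
    - pose proof (strip_second_difference s t (- h / 2) H1 H2 ltac:(lra)) as Q.
      replace (2 * (- h / 2)) with (- h) in Q by field.
      replace (t - - h) with (t + h) in Q by ring. fold (t - h) in Q.
      replace ((- h) ^ 2) with (h ^ 2) in Q by ring.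
      now rewrite (Rplus_comm (V (s, t - h))) in Q. }
  apply Rabs_le. split.
  - enough (-1 * v2 <= kappa * exp (s + 1)) by lra.
    apply (jet2_second_difference _ _ _ _ _ (jet2_scal (-1) _ _ _ _ J)).
    revert S. apply filter_imp. intros h Hh. apply Rabs_le_between in Hh. lra.
  - apply (jet2_second_difference _ _ _ _ _ J).
    revert S. apply filter_imp. intros h Hh. apply Rabs_le_between in Hh. lra.
Qed.

End Strip.

(** * Polar coordinates *)

(** The conformal map [c + exp (s + i t)]. *)
Definition polar (c q : plane) : plane :=
  (fst c + exp (fst q) * cos (snd q), snd c + exp (fst q) * sin (snd q)).

Lemma dist2_polar (c q : plane) : dist2 c (polar c q) = exp (fst q) ^ 2.
Proof.
  unfold dist2, polar; simpl. pose proof (sin2_cos2 (snd q)) as S. unfold Rsqr in S.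
  replace (exp (fst q) * (exp (fst q) * 1)) with
    (exp (fst q) ^ 2 * (sin (snd q) * sin (snd q) + cos (snd q) * cos (snd q))) by (rewrite S; ring).
  ring.
Qed.

Lemma eucl_dist_polar (c q : plane) : eucl_dist c (polar c q) = exp (fst q).
Proof.
  rewrite eucl_dist_sqrt, dist2_polar. apply sqrt_pow2. left; apply exp_pos.
Qed.

Lemma logdist_polar (c q : plane) : logdist c (polar c q) = fst q.
Proof.
  unfold logdist. rewrite dist2_polar, ln_pow by apply exp_pos. rewrite ln_exp. simpl. field.
Qed.

Lemma polar_periodic (c : plane) (s t : R) : polar c (s, t + 2 * PI) = polar c (s, t).
Proof. unfold polar; simpl. rewrite cos_plus, sin_plus, sin_2PI, cos_2PI, !Rmult_0_r, !Rmult_1_r, Rminus_0_r, Rplus_0_r. reflexivity. Qed.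

Lemma polar_surjective (c p : plane) : 0 < eucl_dist c p ->
  exists t, p = polar c (ln (eucl_dist c p), t).
Proof.
  intros H. pose proof (eucl_dist_pow2 c p) as E. set (r := eucl_dist c p) in *.
  unfold dist2 in E. set (w1 := fst p - fst c) in *. set (w2 := snd p - snd c) in *.
  pose (x := w1 / r). pose (y := w2 / r).
  assert (X : x ^ 2 + y ^ 2 = 1).
  { unfold x, y. replace ((w1 / r) ^ 2 + (w2 / r) ^ 2) with ((w1 ^ 2 + w2 ^ 2) / r ^ 2) by (field; lra).
    rewrite <- E. field. lra. }
  assert (X1 : -1 <= x <= 1) by (split; nra).
  assert (T : exists t, cos t = x /\ sin t = y).
  { destruct (Rle_lt_dec 0 y) as [Hy|Hy].
    - exists (acos x). split; [now apply cos_acos|].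
      rewrite sin_acos by auto. replace (1 - x²) with (Rsqr y) by (unfold Rsqr; lra).
      now apply sqrt_Rsqr.
    - exists (- acos x). rewrite cos_neg, sin_neg. split; [now apply cos_acos|].
      rewrite sin_acos by auto. replace (1 - x²) with (Rsqr (- y)) by (unfold Rsqr; lra).
      rewrite sqrt_Rsqr by lra. ring. }
  destruct T as [t [Tc Ts]]. exists t. unfold polar; simpl. rewrite exp_ln, Tc, Ts by auto.
  destruct p as [p1 p2]. unfold x, y, w1, w2; simpl. f_equal; field; lra.
Qed.

Lemma polar_continuous (c q : plane) : continuous (polar c) q.
Proof.
  assert (F : forall (k : R) (g : R -> R), (forall x, ex_derive g x) ->
    continuous (fun q : plane => k + exp (fst q) * g (snd q)) q).
  { intros k g Hg. apply (continuous_plus (fun _ => k) (fun q : plane => exp (fst q) * g (snd q))).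
    - apply continuous_const.
    - apply (continuous_mult (fun p : plane => exp (fst p)) (fun p : plane => g (snd p))).
      + apply (continuous_comp (fun p : plane => fst p) exp); [apply continuous_fst|].
        apply (@ex_derive_continuous R_AbsRing R_NormedModule). auto_derive; auto.
      + apply (continuous_comp (fun p : plane => snd p) g); [apply continuous_snd|].
        apply (@ex_derive_continuous R_AbsRing R_NormedModule). apply Hg. }
  apply (filterlim_plane (locally q) (fun q : plane => fst c + exp (fst q) * cos (snd q))
    (fun q : plane => snd c + exp (fst q) * sin (snd q))).
  - apply (F (fst c) cos). intros x. auto_derive; auto.
  - apply (F (snd c) sin). intros x. auto_derive; auto.
Qed.

Lemma jet2_polar_angle (D : plane -> Prop) (u : plane -> R) (c : plane) (s t : R) :
  open D -> C2_on D u -> D (polar c (s, t)) ->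
  let p := polar c (s, t) in
  jet2 (fun t => u (polar c (s, t))) t
    (exp s * (- sin t * d1 u p + cos t * d2 u p))
    (exp s ^ 2 * (d1 (d1 u) p * (- sin t) ^ 2 + (d1 (d2 u) p + d2 (d1 u) p) * (- sin t * cos t)
        + d2 (d2 u) p * cos t ^ 2)
      - exp s * (cos t * d1 u p + sin t * d2 u p)).
Proof.
  intros Dop HC Dp p. subst p.
  apply (jet2_eq _ _ _ _ _ _ (jet2_curve D u (fun t => fst c + exp s * cos t)
    (fun t => snd c + exp s * sin t) t (exp s * - sin t) (exp s * cos t)
    (- (exp s * cos t)) (- (exp s * sin t)) (polar c (s, t)) Dop HC Dp eq_refl
    ltac:(exists (fun t => exp s * - sin t); split; [reflexivity|split];
      [apply filter_forall; intros y; auto_derive; auto; ring|auto_derive; auto; ring])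
    ltac:(exists (fun t => exp s * cos t); split; [reflexivity|split];
      [apply filter_forall; intros y; auto_derive; auto; ring|auto_derive; auto; ring]))); ring.
Qed.

(** Conformal invariance: the first order terms of the two second derivatives
    cancel, and so do the mixed ones. *)
Lemma has_lap_polar (D : plane -> Prop) (u : plane -> R) (c : plane) (s t : R) :
  open D -> C2_on D u -> D (polar c (s, t)) ->
  has_lap (fun q => u (polar c q)) (s, t) (exp s ^ 2 * laplacian u (polar c (s, t))).
Proof.
  intros Dop HC Dp. do 4 eexists. split; [|split].
  - apply (jet2_curve D u (fun s => fst c + exp s * cos t) (fun s => snd c + exp s * sin t)
      s (exp s * cos t) (exp s * sin t) (exp s * cos t) (exp s * sin t)
      (polar c (s, t)) Dop HC Dp eq_refl).
    + exists (fun s => exp s * cos t). split; [reflexivity|split].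
      * apply filter_forall. intros y. auto_derive; auto; ring.
      * auto_derive; auto; ring.
    + exists (fun s => exp s * sin t). split; [reflexivity|split].
      * apply filter_forall. intros y. auto_derive; auto; ring.
      * auto_derive; auto; ring.
  - apply (jet2_polar_angle D u c s t Dop HC Dp).
  - unfold laplacian. pose proof (sin2_cos2 t) as S. unfold Rsqr in S.
    set (p := polar c (s, t)) in *.
    transitivity (exp s ^ 2 * (sin t * sin t + cos t * cos t) * (d1 (d1 u) p + d2 (d2 u) p)); [ring|].
    rewrite S. ring.
Qed.

(** * The largest eigenvalue *)

(** The two-by-two matrix [mu - A], where [mu] is the larger root of the
    characteristic polynomial, has nonnegative diagonal and zero determinant. *)
Lemma lambda_max_spec (A : mat2) : m12 A = m21 A ->
  is_eigenvalue A (lambda_max A) /\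
  forall v w, m11 A * v ^ 2 + (m12 A + m21 A) * (v * w) + m22 A * w ^ 2
    <= lambda_max A * (v ^ 2 + w ^ 2).
Proof.
  destruct A as [a b b' d]. simpl. intros <-.
  pose (r := sqrt (((a - d) / 2) ^ 2 + b ^ 2)). pose (mu := (a + d) / 2 + r).
  assert (D0 : 0 <= ((a - d) / 2) ^ 2 + b ^ 2).
  { apply Rplus_le_le_0_compat; apply pow2_ge_0. }
  assert (r2 : r ^ 2 = ((a - d) / 2) ^ 2 + b ^ 2) by now apply pow2_sqrt.
  assert (r0 : 0 <= r) by apply sqrt_pos.
  assert (ra : Rabs ((a - d) / 2) <= r).
  { rewrite <- sqrt_Rsqr_abs. apply sqrt_le_1_alt. unfold Rsqr. pose proof (pow2_ge_0 b). lra. }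
  apply Rabs_le_between in ra.
  assert (ma : 0 <= mu - a) by (unfold mu; lra). assert (md : 0 <= mu - d) by (unfold mu; lra).
  assert (ch : (mu - a) * (mu - d) = b ^ 2).
  { replace (b ^ 2) with (r ^ 2 - ((a - d) / 2) ^ 2) by lra. unfold mu. field. }
  assert (Em : is_eigenvalue (Mat2 a b b d) mu).
  { assert (E : forall v w, (v, w) <> (0, 0) -> a * v + b * w = mu * v -> b * v + d * w = mu * w ->
      is_eigenvalue (Mat2 a b b d) mu).
    { intros v w N E1 E2. exists (v, w). split; [exact N|].
      unfold mat2_mulv; simpl. rewrite E1, E2. reflexivity. }
    destruct (Req_dec b 0) as [B0|B0].
    - rewrite B0 in ch, E |- *. assert (Z : (mu - a) * (mu - d) = 0) by (rewrite ch; ring).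
      apply Rmult_integral in Z. destruct Z as [Z|Z].
      + apply (E 1 0); try lra. intros Q. injection Q. lra.
      + apply (E 0 1); try lra. intros Q. injection Q. lra.
    - apply (E b (mu - a)); [intros Q; injection Q; auto|ring|]. 
      replace (mu * (mu - a)) with ((mu - a) * (mu - d) + d * (mu - a)) by ring. rewrite ch. ring. }
  assert (Um : forall l, is_eigenvalue (Mat2 a b b d) l -> l <= mu).
  { intros l [[v w] [N E]]. unfold mat2_mulv in E; simpl in E. injection E. clear E.
    unfold scal; simpl. unfold mult; simpl. intros E2 E1.
    apply Rnot_lt_le. intros Hl.
    assert (P1 : ((l - a) * (l - d) - b ^ 2) * v = 0).
    { replace (((l - a) * (l - d) - b ^ 2) * v) with
        ((l - d) * (l * v - (a * v + b * w)) + b * (l * w - (b * v + d * w))) by ring.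
      rewrite E1, E2. ring. }
    assert (P2 : ((l - a) * (l - d) - b ^ 2) * w = 0).
    { replace (((l - a) * (l - d) - b ^ 2) * w) with
        (b * (l * v - (a * v + b * w)) + (l - a) * (l * w - (b * v + d * w))) by ring.
      rewrite E1, E2. ring. }
    assert (Q : 0 < (l - a) * (l - d) - b ^ 2) by (rewrite <- ch; nra).
    apply N. apply Rmult_integral in P1. apply Rmult_integral in P2.
    destruct P1 as [P1|P1]; [lra|]. destruct P2 as [P2|P2]; [lra|]. rewrite P1, P2. reflexivity. }
  assert (L : lambda_max (Mat2 a b b d) = mu).
  { unfold lambda_max. rewrite (is_lub_Rbar_unique _ (Finite mu)); [reflexivity|]. split.
    - intros l Hl. now apply Um.
    - intros l Hl. now apply Hl. }
  rewrite L. split; auto. intros v w.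
  destruct (Req_dec (mu - a) 0) as [Z|Z].
  - assert (b = 0). { apply Rsqr_0_uniq. unfold Rsqr. rewrite Z in ch. lra. }
    subst b. replace a with mu by lra. pose proof (pow2_ge_0 w). nra.
  - assert (0 <= ((mu - a) * v - b * w) ^ 2) by apply pow2_ge_0.
    assert (0 <= (mu - a) * ((mu - a) * v ^ 2 - 2 * b * (v * w) + (mu - d) * w ^ 2)).
    { replace (_ * _) with (((mu - a) * v - b * w) ^ 2 + ((mu - a) * (mu - d) - b ^ 2) * w ^ 2) by ring.
      rewrite ch. lra. }
    assert (0 <= (mu - a) * v ^ 2 - 2 * b * (v * w) + (mu - d) * w ^ 2).
    { apply Rmult_le_reg_l with (mu - a); lra. }
    lra.
Qed.

Lemma lambda_max_le_0 (A : mat2) : m12 A = m21 A ->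
  (forall v w, m11 A * v ^ 2 + (m12 A + m21 A) * (v * w) + m22 A * w ^ 2 <= 0) ->
  lambda_max A <= 0.
Proof.
  intros S H. destruct (lambda_max_spec A S) as [[[v w] [N E]] _].
  set (l := lambda_max A) in *. unfold mat2_mulv in E; simpl in E. injection E. clear E.
  unfold scal; simpl. unfold mult; simpl. intros E2 E1.
  apply Rnot_lt_le. intros Hl. specialize (H v w).
  replace (m11 A * v ^ 2 + (m12 A + m21 A) * (v * w) + m22 A * w ^ 2)
    with (v * (m11 A * v + m12 A * w) + w * (m21 A * v + m22 A * w)) in H by ring.
  rewrite E1, E2 in H. apply N.
  pose proof (pow2_ge_0 v). pose proof (pow2_ge_0 w).
  assert (v ^ 2 + w ^ 2 <= 0) by nra.
  assert (v = 0) by (apply Rsqr_0_uniq; unfold Rsqr; lra).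
  assert (w = 0) by (apply Rsqr_0_uniq; unfold Rsqr; lra).
  subst. reflexivity.
Qed.

(** * The perforated problem for a fixed radius *)

Section Perforated.

Variables (D : plane -> Prop) (u0 u : plane -> R) (c : plane) (e eta R0 r1 : R).
Hypothesis Dop : open D.
Hypothesis Db : bounded_region D.
Hypothesis T0 : torsion_function D u0.
Hypothesis Hm : max_point D u0 c.
Hypothesis e0 : 0 < e.
Hypothesis er : ln e < ln r1 - 5.
Hypothesis r10 : 0 < r1.
Hypothesis Hr1 : forall p, eucl_dist c p <= r1 -> D p.
Hypothesis HR0 : forall p, D p -> eucl_dist c p <= R0.
Hypothesis R01 : r1 < R0.
Hypothesis eta0 : 0 < eta <= 1 / 4.
Hypothesis Round : forall p, eucl_dist c p <= e -> near_round D u0 c eta p.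
Hypothesis Te : torsion_function (perforated D c e) u.

Let M : R := u0 c.
Let L : R := ln R0 - ln e.
Let v (p : plane) : R := u0 p - u p.

Lemma perforation_small : e < r1.
Proof. apply ln_lt_inv; auto. lra. Qed.

Lemma polar_in_D (q : plane) : fst q <= ln r1 -> D (polar c q).
Proof.
  intros Hq. apply Hr1. rewrite eucl_dist_polar. rewrite <- (exp_ln r1) by auto.
  destruct Hq as [Hq|Hq]; [left; now apply exp_increasing|right; now f_equal].
Qed.

Lemma polar_in_perforated (q : plane) : ln e < fst q <= ln r1 -> perforated D c e (polar c q).
Proof.
  intros Hq. split; [apply polar_in_D; lra|]. unfold closed_disc. rewrite eucl_dist_polar.
  rewrite <- (exp_ln e) at 1 by auto.
  assert (exp (ln e) < exp (fst q)) by (apply exp_increasing; lra). lra.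
Qed.

Lemma closure_perforated_polar (q : plane) : ln e <= fst q <= ln r1 ->
  closure (perforated D c e) (polar c q).
Proof.
  intros Hq d. destruct (polar_continuous c q _ (locally_ball (polar c q) d)) as [d' Hd].
  pose proof perforation_small.
  (* Move outwards if [q] lies on the inner circle. *)
  destruct (Rle_lt_or_eq_dec (ln e) (fst q)) as [Hl|He]; [lra| |].
  - exists (polar c q). split; [now apply polar_in_perforated|apply ball_center].
  - pose (h := Rmin (d' / 2) (ln r1 - ln e)).
    assert (h0 : 0 < h) by (apply Rmin_pos; [pose proof (cond_pos d'); lra|lra]).
    assert (h1 : h <= d' / 2) by apply Rmin_l. assert (h2 : h <= ln r1 - ln e) by apply Rmin_r.
    exists (polar c (fst q + h, snd q)). split.
    + apply polar_in_perforated. cbn [fst snd]. lra.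
    + apply Hd. split; cbn [fst snd]; [|apply ball_center].
      change (Rabs (fst q + h - fst q) < d'). replace (fst q + h - fst q) with h by ring.
      rewrite Rabs_pos_eq by lra. pose proof (cond_pos d'). lra.
Qed.

Lemma difference_polar_has_lap (q : plane) : ln e < fst q <= ln r1 ->
  has_lap (fun q => v (polar c q)) q 0.
Proof.
  intros Hq. destruct q as [s t].
  pose proof (polar_in_perforated _ Hq) as Pp.
  apply has_lap_ext with (fun q => u0 (polar c q) - u (polar c q))
    (exp s ^ 2 * laplacian u0 (polar c (s, t)) - exp s ^ 2 * laplacian u (polar c (s, t))).
  - reflexivity.
  - destruct T0 as [_ [_ [L0 _]]]. destruct Te as [_ [_ [L1 _]]].
    specialize (L0 _ (proj1 Pp)). specialize (L1 _ Pp).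
    replace (laplacian u0 (polar c (s, t))) with (-1) by lra.
    replace (laplacian u (polar c (s, t))) with (-1) by lra. ring.
  - apply has_lap_minus.
    + apply has_lap_polar with D; auto; [apply T0|apply Pp].
    + apply has_lap_polar with (perforated D c e); auto; [now apply perforated_open|apply Te].
Qed.

Lemma difference_polar_continuous (q : plane) : ln e < fst q <= ln r1 ->
  continuous (fun q => v (polar c q)) q.
Proof.
  intros Hq. apply (continuous_comp (polar c) v); [apply polar_continuous|].
  pose proof (polar_in_perforated _ Hq) as Pp.
  apply (continuous_minus u0 u).
  - apply C1_on_continuous with D; auto; [apply T0|apply Pp].
  - apply C1_on_continuous with (perforated D c e); auto; [now apply perforated_open|apply Te].
Qed.

Lemma max_value_ge_0 : 0 <= M.
Proof. left. apply torsion_pos with D; auto. apply Hm. Qed.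

Lemma difference_polar_upper (q : plane) : ln e <= fst q <= ln r1 ->
  0 <= v (polar c q) <= M * (ln R0 - fst q) / L.
Proof.
  intros Hq. pose proof perforation_small.
  pose proof (closure_perforated_polar q Hq) as Cq. split.
  - now apply (difference_ge_0 D u0 u c e).
  - assert (eR : e < R0) by lra.
    pose proof (difference_upper D u0 u c e Dop Db e0 T0 Te M R0 (proj2 Hm) max_value_ge_0
      eR HR0 _ Cq) as U.
    rewrite logdist_polar in U. exact U.
Qed.

(** Where the perforation is, the difference is [u0] itself, which is almost
    radial. *)
Lemma difference_inner (t tau : R) : 0 <= tau ->
  Rabs (v (polar c (ln e, t + tau)) - v (polar c (ln e, t - tau))) <= 4 * e ^ 2 * tau.
Proof.
  intros Ht. pose proof perforation_small as es.
  assert (Vi : forall t, v (polar c (ln e, t)) = u0 (polar c (ln e, t))).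
  { intros t'. apply (difference_boundary D u0 u c e Te). split.
    - apply closure_perforated_polar. cbn [fst snd]. lra.
    - apply (closure_subset (fun q => ~ perforated D c e q)). intros [_ N]. apply N.
      unfold closed_disc. rewrite eucl_dist_polar. cbn [fst snd]. rewrite exp_ln; auto. lra. }
  rewrite !Vi.
  assert (Pd : forall t, eucl_dist c (polar c (ln e, t)) = e).
  { intros t'. rewrite eucl_dist_polar. cbn [fst snd]. now apply exp_ln. }
  assert (Dt : forall t, is_derive (fun t => u0 (polar c (ln e, t))) t
     (e * (- sin t * d1 u0 (polar c (ln e, t)) + cos t * d2 u0 (polar c (ln e, t))))).
  { intros t'. pose proof (jet2_derive _ _ _ _ (jet2_polar_angle D u0 c (ln e) t' Dop (proj1 T0)
      (polar_in_D (ln e, t') ltac:(cbn [fst snd]; lra)))) as J.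
    now rewrite exp_ln in J. }
  destruct (mvt _ _ (t - tau) (t + tau) ltac:(lra) (fun y _ => Dt y)) as [x [_ Ex]].
  eapply Rle_trans; [right; apply f_equal; exact Ex|]. clear Ex.
  set (p := polar c (ln e, x)) in *.
  destruct (Round p) as [_ [_ [_ [_ [_ [G1 [G2 _]]]]]]]; [unfold p; rewrite Pd; lra|].
  pose proof (Rabs_fst_eucl_dist c p) as W1. pose proof (Rabs_snd_eucl_dist c p) as W2.
  unfold p in G1, G2, W1, W2. rewrite Pd in G1, G2, W1, W2. fold p in G1, G2, W1, W2.
  apply Rabs_le_between in G1. apply Rabs_le_between in G2.
  apply Rabs_le_between in W1. apply Rabs_le_between in W2.
  assert (A1 : Rabs (d1 u0 p) <= e) by (apply Rabs_le; nra).
  assert (A2 : Rabs (d2 u0 p) <= e) by (apply Rabs_le; nra).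
  assert (S1 : Rabs (- sin x) <= 1).
  { rewrite Rabs_Ropp. apply Rabs_le. pose proof (SIN_bound x). lra. }
  assert (S2 : Rabs (cos x) <= 1) by (apply Rabs_le; pose proof (COS_bound x); lra).
  rewrite !Rabs_mult, (Rabs_pos_eq e) by lra.
  replace (t + tau - (t - tau)) with (2 * tau) by ring. rewrite (Rabs_pos_eq (2 * tau)) by lra.
  replace (4 * e ^ 2 * tau) with (e * (2 * e) * (2 * tau)) by ring.
  apply Rmult_le_compat_r; [lra|]. apply Rmult_le_compat_l; [lra|].
  eapply Rle_trans; [apply Rabs_triang|]. rewrite !Rabs_mult.
  assert (Rabs (- sin x) * Rabs (d1 u0 p) <= 1 * e) by (apply Rmult_le_compat; auto; apply Rabs_pos).
  assert (Rabs (cos x) * Rabs (d2 u0 p) <= 1 * e) by (apply Rmult_le_compat; auto; apply Rabs_pos).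
  apply Rle_trans with (1 * e + 1 * e); [exact (Rplus_le_compat _ _ _ _ H H0)|lra].
Qed.

(** The constant [kappa] of the strip, of size [O(1 / ln (1 / e))]: the first term
    comes from the bound on the difference near radius [r1], the second from the
    values on the circle of radius [e].  The shifts by [3] and [5] leave room for the
    squares of the gradient estimate. *)
Definition angular_constant (m e R0 r1 : R) : R :=
  6 * (m * (ln R0 - (ln r1 - 5)) / (ln R0 - ln e)) / exp (ln r1 - 3) + 3 * (4 * e ^ 2) / exp (ln e).

Lemma log_ratio_pos : 0 < L.
Proof. unfold L. pose proof perforation_small. assert (ln e < ln R0) by (apply ln_increasing; lra). lra. Qed.

Lemma difference_angular (s t a b : R) : ln e < s - 1 -> s + 1 <= ln r1 - 3 ->
  jet2 (fun t => v (polar c (s, t))) t a b -> Rabs b <= angular_constant M e R0 r1 * exp (s + 1).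
Proof.
  intros H1 H2 J. pose proof perforation_small as es.
  pose proof log_ratio_pos as LP. pose proof max_value_ge_0 as M0.
  assert (lnR : ln r1 < ln R0) by (apply ln_increasing; lra).
  refine (strip_second_derivative (fun q => v (polar c q)) (ln e) (ln r1 - 3)
    (M * (ln R0 - (ln r1 - 5)) / (ln R0 - ln e)) (4 * e ^ 2) _ _ _ _ _ _ _ _ s t a b H1 H2 J).
  - lra.
  - apply Rmult_le_pos; [apply Rmult_le_pos; lra|]. left. now apply Rinv_0_lt_compat.
  - pose proof (pow2_ge_0 e). lra.
  - apply (continuous_on_comp _ (closure (perforated D c e)) (polar c) v).
    + intros q _. apply polar_continuous.
    + intros [q1 q2] Hq. apply closure_perforated_polar. cbn [fst snd] in *. lra.
    + apply (difference_continuous_on D u0 u c e); auto.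
  - intros [p1 p2] Hp. cbn [fst snd] in Hp. split.
    + apply difference_polar_continuous. cbn [fst snd]. lra.
    + apply difference_polar_has_lap. cbn [fst snd]. lra.
  - intros s' t'. now rewrite polar_periodic.
  - intros [p1 p2] Hp. cbn [fst snd] in Hp.
    destruct (difference_polar_upper (p1, p2) ltac:(cbn [fst snd]; lra)) as [V0 V1].
    cbn [fst snd] in V1. rewrite Rabs_pos_eq by auto. apply Rle_trans with (1 := V1). unfold L, Rdiv.
    apply Rmult_le_compat_r; [left; now apply Rinv_0_lt_compat|].
    apply Rmult_le_compat_l; lra.
  - intros t' tau Ht. apply difference_inner. lra.
Qed.

(** At the maximum point of [u] the gradient vanishes, so that the second angular
    derivative is the Hessian in the tangential direction; for [u0] it is small
    since [u0] is nearly round. *)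
Lemma lambda_max_bounds (x : plane) :
  max_point (perforated D c e) u x -> near_round D u0 c eta x ->
  ln e + 1 < ln (eucl_dist c x) -> ln (eucl_dist c x) <= ln r1 - 4 ->
  - (8 * eta) - angular_constant M e R0 r1 * exp 1 / eucl_dist c x
    <= lambda_max (hessian u x) <= 0.
Proof.
  intros Hx [Dx [N11 [N22 [N12 [N21 [N1 [N2 _]]]]]]] Hs1 Hs2.
  pose proof (perforated_open D c e Dop e0) as Pop.
  assert (rho0 : 0 < eucl_dist c x).
  { destruct Hx as [[_ N] _]. unfold closed_disc in N. lra. }
  destruct (max_point_conditions _ u x Pop (proj1 Te) Hx) as [G1 [G2 G3]].
  pose proof (schwarz_C2 _ u x Pop (proj1 Te) (proj1 Hx)) as Sw.
  split; [|now apply lambda_max_le_0].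
  destruct (polar_surjective c x rho0) as [t Ex].
  set (s := ln (eucl_dist c x)) in *.
  assert (Es : exp s = eucl_dist c x) by now apply exp_ln.
  pose proof (jet2_polar_angle D u0 c s t Dop (proj1 T0) ltac:(rewrite <- Ex; exact Dx)) as J0.
  pose proof (jet2_polar_angle _ u c s t Pop (proj1 Te) ltac:(rewrite <- Ex; exact (proj1 Hx))) as J1.
  cbv zeta in J0, J1. rewrite <- Ex in J0, J1. rewrite G1, G2 in J1. rewrite Es in J0, J1.
  pose proof (difference_angular s t _ _ ltac:(lra) ltac:(lra) (jet2_minus _ _ _ _ _ _ _ J0 J1)) as A.
  clear J0 J1.
  assert (W1 : fst x - fst c = exp s * cos t) by (rewrite Ex at 1; unfold polar; simpl; ring).
  assert (W2 : snd x - snd c = exp s * sin t) by (rewrite Ex at 1; unfold polar; simpl; ring).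
  rewrite W1 in N1. rewrite W2 in N2. rewrite Es in N1, N2, W1, W2.
  clear Ex. set (rho := eucl_dist c x) in *.
  set (a11 := d1 (d1 u0) x) in *. set (a22 := d2 (d2 u0) x) in *.
  set (a12 := d1 (d2 u0) x) in *. set (a21 := d2 (d1 u0) x) in *.
  set (a1 := d1 u0 x) in *. set (a2 := d2 u0 x) in *.
  pose proof (sin2_cos2 t) as SC. unfold Rsqr in SC.
  destruct (lambda_max_spec (hessian u x) Sw) as [_ Q].
  specialize (Q (- sin t) (cos t)). simpl m11 in Q. simpl m12 in Q. simpl m21 in Q. simpl m22 in Q.
  set (q := d1 (d1 u) x * (- sin t) ^ 2 + (d1 (d2 u) x + d2 (d1 u) x) * (- sin t * cos t)
    + d2 (d2 u) x * cos t ^ 2) in *.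
  replace ((- sin t) ^ 2 + cos t ^ 2) with 1 in Q by (rewrite <- SC; ring). rewrite Rmult_1_r in Q.
  apply Rle_trans with (2 := Q). clear Q.
  set (K := angular_constant M e R0 r1) in *.
  rewrite exp_plus, Es in A. fold rho in A.
  pose (b11 := a11 + 1 / 2). pose (b22 := a22 + 1 / 2).
  pose (b1 := a1 + rho * cos t / 2). pose (b2 := a2 + rho * sin t / 2).
  fold b11 in N11. fold b22 in N22. fold b1 in N1. fold b2 in N2.
  (* The exact parts [- I / 2] and [- (x - c) / 2] cancel. *)
  assert (Z : rho ^ 2 * (a11 * (- sin t) ^ 2 + (a12 + a21) * (- sin t * cos t) + a22 * cos t ^ 2)
      - rho * (cos t * a1 + sin t * a2)
    = rho ^ 2 * (b11 * (sin t) ^ 2 - (a12 + a21) * (sin t * cos t) + b22 * cos t ^ 2)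
      - rho * (cos t * b1 + sin t * b2)).
  { unfold b11, b22, b1, b2.
    transitivity (rho ^ 2 * (a11 * (- sin t) ^ 2 + (a12 + a21) * (- sin t * cos t) + a22 * cos t ^ 2)
      - rho * (cos t * a1 + sin t * a2)
      + rho ^ 2 * (1 / 2) * ((sin t * sin t + cos t * cos t) - (sin t * sin t + cos t * cos t))); [ring|field]. }
  rewrite Z in A. clear Z.
  assert (Cs : Rabs (cos t) <= 1) by (apply Rabs_le; pose proof (COS_bound t); lra).
  assert (Sn : Rabs (sin t) <= 1) by (apply Rabs_le; pose proof (SIN_bound t); lra).
  assert (Bb : - (4 * eta) <= b11 * (sin t) ^ 2 - (a12 + a21) * (sin t * cos t) + b22 * cos t ^ 2).
  { apply Rabs_le_between in N11. apply Rabs_le_between in N22.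
    assert (X1 : - eta * sin t ^ 2 <= b11 * sin t ^ 2) by (apply Rmult_le_compat_r; [apply pow2_ge_0|lra]).
    assert (X2 : - eta * cos t ^ 2 <= b22 * cos t ^ 2) by (apply Rmult_le_compat_r; [apply pow2_ge_0|lra]).
    assert (X3 : Rabs ((a12 + a21) * (sin t * cos t)) <= 2 * eta * (1 * 1)).
    { rewrite !Rabs_mult. apply Rmult_le_compat; try apply Rabs_pos.
      - apply Rmult_le_pos; apply Rabs_pos.
      - eapply Rle_trans; [apply Rabs_triang|]. lra.
      - apply Rmult_le_compat; auto; apply Rabs_pos. }
    apply Rabs_le_between in X3.
    assert (eta * sin t ^ 2 + eta * cos t ^ 2 = eta) by (rewrite <- Rmult_plus_distr_l; rewrite <- (Rmult_1_r eta) at 2; f_equal; lra).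
    lra. }
  assert (Cb : Rabs (cos t * b1 + sin t * b2) <= 4 * eta * rho).
  { eapply Rle_trans; [apply Rabs_triang|]. rewrite !Rabs_mult.
    assert (Rabs (cos t) * Rabs b1 <= 1 * (2 * eta * rho)) by (apply Rmult_le_compat; auto; apply Rabs_pos).
    assert (Rabs (sin t) * Rabs b2 <= 1 * (2 * eta * rho)) by (apply Rmult_le_compat; auto; apply Rabs_pos).
    lra. }
  apply Rabs_le_between in A. apply Rabs_le_between in Cb.
  set (bb := b11 * (sin t) ^ 2 - (a12 + a21) * (sin t * cos t) + b22 * cos t ^ 2) in *.
  set (cb := cos t * b1 + sin t * b2) in *.
  clearbody bb cb q K.
  assert (r2 : 0 < rho ^ 2) by now apply pow_lt.
  apply Rmult_le_reg_l with (rho ^ 2); auto.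
  replace (rho ^ 2 * (- (8 * eta) - K * exp 1 / rho)) with (- (8 * eta) * rho ^ 2 - K * (rho * exp 1))
    by (field; lra).
  assert (rho ^ 2 * - (4 * eta) <= rho ^ 2 * bb) by (apply Rmult_le_compat_l; lra).
  assert (rho * cb <= rho * (4 * eta * rho)) by (apply Rmult_le_compat_l; lra).
  lra.
Qed.

(** The value of [u] at a point at distance [r2] from [c], estimated by the round
    profile of [u0] and the upper logarithmic barrier. *)
Lemma max_value_lower (x : plane) (r2 : R) :
  max_point (perforated D c e) u x -> e < r2 <= r1 -> eta <= 1 / 32 ->
  (forall p, eucl_dist c p <= r2 -> near_round D u0 c eta p) ->
  M - r2 ^ 2 - M * (ln R0 - ln r2) / L <= u x.
Proof.
  intros Hx Hr He Rd.
  pose (z := polar c (ln r2, 0)).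
  assert (z2 : eucl_dist c z = r2).
  { unfold z. rewrite eucl_dist_polar. cbn [fst snd]. apply exp_ln. lra. }
  assert (l1 : ln e < ln r2) by (apply ln_increasing; lra).
  assert (l2 : ln r2 <= ln r1) by (apply ln_le; lra).
  assert (Pz : perforated D c e z) by (apply polar_in_perforated; cbn [fst snd]; lra).
  destruct (difference_polar_upper (ln r2, 0) ltac:(cbn [fst snd]; lra)) as [_ V].
  fold z in V. cbn [fst snd] in V. unfold v in V.
  destruct (Rd z ltac:(lra)) as [_ [_ [_ [_ [_ [_ [_ Nz]]]]]]].
  rewrite <- eucl_dist_pow2, z2 in Nz. apply Rabs_le_between in Nz.
  pose proof (pow2_ge_0 r2) as r22. pose proof (proj2 Hx z Pz).
  assert (4 * eta * r2 ^ 2 <= 1 / 8 * r2 ^ 2) by (apply Rmult_le_compat_r; lra).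
  unfold M in *. lra.
Qed.

(** The lower logarithmic barrier: near the perforation [u] is well below [M]. *)
Lemma max_value_upper (x : plane) :
  max_point (perforated D c e) u x -> eta <= 1 / 32 -> e ^ 2 <= M / 4 -> eucl_dist c x <= r1 ->
  3 / 4 * M * (ln r1 - ln (eucl_dist c x)) <= (M - u x) * L.
Proof.
  intros Hx He Me Hr.
  pose proof perforation_small as es.
  pose proof (proj1 Hx) as Px. assert (ex : e < eucl_dist c x).
  { destruct Px as [_ N]. unfold closed_disc in N. lra. }
  assert (lx : ln (eucl_dist c x) <= ln r1) by (apply ln_le; lra).
  assert (Hlow : forall p, dist2 c p = e ^ 2 -> 3 / 4 * M <= u0 p).
  { intros p Hp. destruct (Round p) as [_ [_ [_ [_ [_ [_ [_ N]]]]]]].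
    { apply Rnot_lt_le. intros Hl. rewrite <- eucl_dist_pow2 in Hp.
      assert (e ^ 2 < eucl_dist c p ^ 2) by nra. lra. }
    rewrite Hp in N. apply Rabs_le_between in N. unfold M in *.
    assert (4 * eta * e ^ 2 <= 1 / 8 * e ^ 2) by (apply Rmult_le_compat_r; [apply pow2_ge_0|lra]).
    lra. }
  pose proof max_value_ge_0 as M0.
  pose proof (difference_lower D u0 u c e Dop Db e0 T0 Te (3 / 4 * M) r1 Hlow ltac:(lra) ltac:(lra)
    (fun p Hp => Hr1 p (Rlt_le _ _ Hp)) x (closure_subset _ _ Px)) as V. cbv zeta in V.
  assert (El : logdist c x = ln (eucl_dist c x)).
  { unfold logdist. rewrite <- eucl_dist_pow2, ln_pow by lra. simpl. field. }
  rewrite El in V.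
  assert (l1 : 0 < ln r1 - ln e) by (assert (ln e < ln r1) by (apply ln_increasing; lra); lra).
  assert (l2 : ln r1 - ln e <= L) by (unfold L; assert (ln r1 < ln R0) by (apply ln_increasing; lra); lra).
  assert (V2 : 3 / 4 * M * (ln r1 - ln (eucl_dist c x)) / (ln r1 - ln e) <= M - u x).
  { eapply Rle_trans; [exact V|]. pose proof (proj2 Hm x (proj1 Px)). unfold M. lra. }
  assert (V3 : 0 <= 3 / 4 * M * (ln r1 - ln (eucl_dist c x)) / (ln r1 - ln e)).
  { apply Rmult_le_pos; [apply Rmult_le_pos; lra|left; now apply Rinv_0_lt_compat]. }
  replace (3 / 4 * M * (ln r1 - ln (eucl_dist c x))) with
    (3 / 4 * M * (ln r1 - ln (eucl_dist c x)) / (ln r1 - ln e) * (ln r1 - ln e)) by (field; lra).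
  apply Rmult_le_compat; lra.
Qed.

End Perforated.

(** * The limit of small perforations *)

Lemma at_right_small (d : R) : 0 < d -> at_right 0 (fun e => 0 < e < d).
Proof.
  intros d0. exists (mkposreal d d0). intros e He e0. apply Rabs_ball in He. simpl in He.
  rewrite Rminus_0_r, Rabs_pos_eq in He by lra. lra.
Qed.

Lemma at_right_log (R0 K : R) : at_right 0 (fun e => K < ln R0 - ln e).
Proof.
  generalize (at_right_small (exp (ln R0 - K)) (exp_pos _)). apply filter_imp. intros e He.
  assert (ln e < ln R0 - K); [|lra].
  rewrite <- (ln_exp (ln R0 - K)). now apply ln_increasing.
Qed.

Lemma ln_le_half (x : R) : 0 < x -> ln x <= x / 2.
Proof.
  intros Hx. rewrite <- (ln_exp (x / 2)). apply ln_le; auto.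
  pose proof (exp_ineq1 (x / 4) ltac:(lra)) as E.
  replace (exp (x / 2)) with (exp (x / 4) * exp (x / 4)) by (rewrite <- exp_plus; f_equal; field).
  assert ((1 + x / 4) * (1 + x / 4) <= exp (x / 4) * exp (x / 4)) by (apply Rmult_le_compat; lra).
  pose proof (pow2_ge_0 (1 - x / 4)). lra.
Qed.

Lemma ln_gt_of_exp (x K : R) : exp K < x -> K < ln x.
Proof. intros H. rewrite <- (ln_exp K). apply ln_increasing; auto. apply exp_pos. Qed.

Section Limit.

Variables (D : plane -> Prop) (u0 : plane -> R) (c : plane) (l eps0 : R)
  (u : R -> plane -> R) (x : R -> plane).
Hypothesis Dop : open D.
Hypothesis Db : bounded_region D.
Hypothesis Dc : convex D.
Hypothesis T0 : torsion_function D u0.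
Hypothesis Hm : max_point D u0 c.
Hypothesis HE : eigenvalue_pair (hessian u0 c) l l.
Hypothesis eps0_pos : 0 < eps0.
Hypothesis Hu : forall e, 0 < e < eps0 -> torsion_function (perforated D c e) (u e).
Hypothesis Hx : forall e, 0 < e < eps0 -> max_point (perforated D c e) (u e) (x e).

Variables (R0 r1 : R).
Hypothesis r10 : 0 < r1.
Hypothesis R01 : r1 < R0.
Hypothesis Hr1 : forall p, eucl_dist c p <= r1 -> D p.
Hypothesis HR0 : forall p, D p -> eucl_dist c p <= R0.

Lemma max_value_pos : 0 < u0 c.
Proof. apply torsion_pos with D; auto. apply Hm. Qed.

(** At a fixed small distance from [c], [u] is close to [M] when [L] is large; hence
    so is [u0] at [x], and the strict maximum of [u0] applies. *)
Lemma max_points_converge (r : R) : 0 < r -> at_right 0 (fun e => eucl_dist c (x e) < r).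
Proof.
  intros r0. pose proof max_value_pos as M0.
  destruct (torsion_strict_max D u0 c l r Dop Db Dc T0 Hm HE r0) as [k [k0 Hk]].
  destruct (near_round_center D u0 c l (1 / 32) Dop T0 Hm HE ltac:(lra)) as [d [d0 Hd]].
  pose (r2 := Rmin (Rmin d r1) (Rmin 1 (k / 2))).
  assert (r20 : 0 < r2) by (repeat apply Rmin_pos; lra).
  assert (r2d : r2 <= d) by (eapply Rle_trans; [apply Rmin_l|apply Rmin_l]).
  assert (r21 : r2 <= r1) by (eapply Rle_trans; [apply Rmin_l|apply Rmin_r]).
  assert (r22 : r2 <= 1) by (eapply Rle_trans; [apply Rmin_r|apply Rmin_l]).
  assert (r2k : r2 <= k / 2) by (eapply Rle_trans; [apply Rmin_r|apply Rmin_r]).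
  assert (r2s : r2 ^ 2 <= k / 2) by nra.
  pose (K := u0 c * (ln R0 - ln r2) / (k / 2)).
  generalize (filter_and _ _ (at_right_small _ eps0_pos)
    (filter_and _ _ (at_right_small _ r20)
    (filter_and _ _ (at_right_small (exp (ln r1 - 5)) (exp_pos _)) (at_right_log R0 (Rmax K 0))))).
  apply filter_imp. intros e [He [He2 [He3 He4]]].
  pose proof (Rmax_l K 0). pose proof (Rmax_r K 0).
  assert (e5 : ln e < ln r1 - 5) by (rewrite <- (ln_exp (ln r1 - 5)); apply ln_increasing; lra).
  pose proof (max_value_lower D u0 (u e) c e (1 / 32) R0 r1 Dop Db T0 Hm ltac:(lra) e5 r10 Hr1 HR0 R01
    ltac:(lra) (Hu e He) (x e) r2 (Hx e He) ltac:(lra) ltac:(lra)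
    (fun p Hp => Hd p (Rle_trans _ _ _ Hp r2d))) as Lo.
  pose proof (difference_ge_0 D u0 (u e) c e Dop Db ltac:(lra) T0 (Hu e He) (x e)
    (closure_subset _ _ (proj1 (Hx e He)))) as V.
  apply Rnot_le_lt. intros Hr.
  pose proof (Hk (x e) (proj1 (proj1 (Hx e He))) Hr) as Up.
  assert (Q : u0 c * (ln R0 - ln r2) / (ln R0 - ln e) < k / 2); [|lra].
  apply Rmult_lt_reg_r with (ln R0 - ln e); [lra|].
  replace (u0 c * (ln R0 - ln r2) / (ln R0 - ln e) * (ln R0 - ln e))
    with (K * (k / 2)) by (unfold K; field; lra).
  rewrite Rmult_comm. apply Rmult_lt_compat_l; lra.
Qed.

(** [|x - c| >= const * L^(-2/3)] with [L = ln (R0 / e)]: the value of [u] at [x]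
    is at least its value at distance [L^(-1/2)]. *)
Lemma max_points_distance : exists C2, at_right 0 (fun e =>
  - ln (eucl_dist c (x e)) <= C2 + 2 / 3 * ln (ln R0 - ln e)).
Proof.
  pose proof max_value_pos as M0.
  destruct (near_round_center D u0 c l (1 / 32) Dop T0 Hm HE ltac:(lra)) as [d [d0 Hd]].
  exists (4 / 3 * (1 / u0 c + ln R0) - ln r1).
  assert (m0 : 0 < Rmin 1 (u0 c / 4)) by (apply Rmin_pos; lra).
  pose (K := Rmax (Rmax (exp (- 2 * ln r1)) (exp (-2 * ln d))) (Rmax 1 (2 * ln R0))).
  generalize (filter_and _ _ (at_right_small _ eps0_pos)
    (filter_and _ _ (filter_and _ _ (at_right_small _ d0) (at_right_small _ m0))
    (filter_and _ _ (at_right_small (exp (ln r1 - 5)) (exp_pos _))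
    (filter_and _ _ (at_right_log R0 K) (max_points_converge r1 r10))))).
  apply filter_imp. intros e [He [[He2 He3] [He4 [HL Hr]]]].
  set (L := ln R0 - ln e) in *.
  assert (K1 : exp (- 2 * ln r1) < L).
  { eapply Rle_lt_trans; [|exact HL]. eapply Rle_trans; [apply Rmax_l|apply Rmax_l]. }
  assert (K2 : exp (- 2 * ln d) < L).
  { eapply Rle_lt_trans; [|exact HL]. eapply Rle_trans; [apply Rmax_r|apply Rmax_l]. }
  assert (K3 : 1 < L).
  { eapply Rle_lt_trans; [|exact HL]. eapply Rle_trans; [apply Rmax_l|apply Rmax_r]. }
  assert (K4 : 2 * ln R0 < L).
  { eapply Rle_lt_trans; [|exact HL]. eapply Rle_trans; [apply Rmax_r|apply Rmax_r]. }
  apply ln_gt_of_exp in K1. apply ln_gt_of_exp in K2.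
  pose proof (ln_le_half L ltac:(lra)) as LL.
  assert (e5 : ln e < ln r1 - 5) by (rewrite <- (ln_exp (ln r1 - 5)); apply ln_increasing; lra).
  pose (r2 := exp (- (ln L / 2))).
  assert (l2 : ln r2 = - (ln L / 2)) by apply ln_exp.
  assert (r20 : 0 < r2) by apply exp_pos.
  assert (r21 : r2 < r1) by (apply ln_lt_inv; lra).
  assert (r2d : r2 < d) by (apply ln_lt_inv; lra).
  assert (r2e : e < r2) by (apply ln_lt_inv; try lra; rewrite l2; unfold L in *; lra).
  assert (r2s : r2 ^ 2 = / L).
  { unfold r2. simpl. rewrite Rmult_1_r, <- exp_plus.
    replace (- (ln L / 2) + - (ln L / 2)) with (- ln L) by field. rewrite exp_Ropp, exp_ln; lra. }
  pose proof (max_value_lower D u0 (u e) c e (1 / 32) R0 r1 Dop Db T0 Hm ltac:(lra) e5 r10 Hr1 HR0 R01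
    ltac:(lra) (Hu e He) (x e) r2 (Hx e He) ltac:(lra) ltac:(lra)
    (fun p Hp => Hd p ltac:(lra))) as Lo.
  assert (e2 : e ^ 2 <= u0 c / 4).
  { pose proof (Rmin_l 1 (u0 c / 4)). pose proof (Rmin_r 1 (u0 c / 4)). nra. }
  pose proof (max_value_upper D u0 (u e) c e (1 / 32) R0 r1 Dop Db T0 Hm ltac:(lra) e5 r10 Hr1 R01
    (fun p Hp => Hd p ltac:(lra)) (Hu e He) (x e) (Hx e He) ltac:(lra) e2 ltac:(lra)) as Up.
  fold L in Lo, Up. rewrite r2s, l2 in Lo.
  set (rho := eucl_dist c (x e)) in *. set (M := u0 c) in *.
  assert (Q : (M - u e (x e)) * L <= 1 + M * (ln R0 + ln L / 2)).
  { apply Rle_trans with ((/ L + M * (ln R0 - - (ln L / 2)) / L) * L).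
    - apply Rmult_le_compat_r; lra.
    - right. field. lra. }
  apply Rmult_le_reg_l with (3 / 4 * M); [lra|].
  replace (3 / 4 * M * (4 / 3 * (1 / M + ln R0) - ln r1 + 2 / 3 * ln L))
    with (1 + M * (ln R0 + ln L / 2) - 3 / 4 * M * ln r1) by (field; lra).
  lra.
Qed.

(** With [L = ln (R0 / e)] the error [angular_constant / r] is of order
    [L^(-1) L^(2/3)]. *)
Lemma lambda_max_limit (eps : R) : 0 < eps -> at_right 0 (fun e =>
  - eps < lambda_max (hessian (u e) (x e)) <= 0).
Proof.
  intros eps1. pose proof max_value_pos as M0.
  pose (eta := Rmin (1 / 32) (eps / 32)).
  assert (eta0 : 0 < eta) by (apply Rmin_pos; lra).
  assert (eta1 : eta <= 1 / 32) by apply Rmin_l. assert (eta2 : eta <= eps / 32) by apply Rmin_r.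
  destruct (near_round_center D u0 c l eta Dop T0 Hm HE eta0) as [d [d0 Hd]].
  destruct max_points_distance as [C2 HC2].
  set (M := u0 c) in *.
  assert (lnR : ln r1 < ln R0) by (apply ln_increasing; lra).
  pose (C1 := 6 * (M * (ln R0 - (ln r1 - 5))) / exp (ln r1 - 3)).
  assert (C10 : 0 <= C1).
  { apply Rmult_le_pos; [|left; apply Rinv_0_lt_compat, exp_pos].
    apply Rmult_le_pos; [lra|]. apply Rmult_le_pos; lra. }
  pose (K3 := 3 * (1 + C2 - ln (eps / (2 * (C1 + 12))))).
  pose (K := Rmax (Rmax (exp K3) (2 * (C2 + ln R0 + 1))) (Rmax 1 (2 * ln R0))).
  assert (rs : 0 < Rmin d (exp (ln r1 - 4))) by (apply Rmin_pos; [lra|apply exp_pos]).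
  generalize (filter_and _ _ (at_right_small _ eps0_pos)
    (filter_and _ _ (filter_and _ _ (at_right_small _ d0) (at_right_small (exp (ln r1 - 5)) (exp_pos _)))
    (filter_and _ _ HC2
    (filter_and _ _ (at_right_log R0 K) (max_points_converge _ rs))))).
  apply filter_imp. intros e [He [[He2 He4] [HC [HL Hr]]]].
  set (L := ln R0 - ln e) in *.
  assert (L1 : exp K3 < L).
  { eapply Rle_lt_trans; [|exact HL]. eapply Rle_trans; [apply Rmax_l|apply Rmax_l]. }
  assert (L2 : 2 * (C2 + ln R0 + 1) < L).
  { eapply Rle_lt_trans; [|exact HL]. eapply Rle_trans; [apply Rmax_r|apply Rmax_l]. }
  assert (L3 : 1 < L).
  { eapply Rle_lt_trans; [|exact HL]. eapply Rle_trans; [apply Rmax_l|apply Rmax_r]. }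
  assert (L4 : 2 * ln R0 < L).
  { eapply Rle_lt_trans; [|exact HL]. eapply Rle_trans; [apply Rmax_r|apply Rmax_r]. }
  apply ln_gt_of_exp in L1.
  pose proof (ln_le_half L ltac:(lra)) as LL.
  assert (e5 : ln e < ln r1 - 5) by (rewrite <- (ln_exp (ln r1 - 5)); apply ln_increasing; lra).
  pose proof (Rmin_l d (exp (ln r1 - 4))). pose proof (Rmin_r d (exp (ln r1 - 4))).
  set (rho := eucl_dist c (x e)) in *.
  assert (rho0 : 0 < rho).
  { destruct (Hx e He) as [[_ N] _]. unfold closed_disc in N. fold rho in N. lra. }
  assert (lr : ln rho <= ln r1 - 4) by (rewrite <- (ln_exp (ln r1 - 4)); apply ln_le; lra).
  destruct (lambda_max_bounds D u0 (u e) c e eta R0 r1 Dop Db T0 Hm ltac:(lra) e5 r10 Hr1 HR0 R01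
    ltac:(lra) (fun p Hp => Hd p ltac:(lra)) (Hu e He) (x e) (Hx e He)
    (Hd (x e) ltac:(fold rho; lra)) ltac:(fold rho; unfold L in *; lra) lr) as [B1 B2].
  fold rho M in B1. split; auto. apply Rlt_le_trans with (2 := B1).
  assert (Ae : angular_constant M e R0 r1 <= (C1 + 12) * exp (- ln L)).
  { unfold angular_constant. fold L. rewrite exp_ln by lra. rewrite exp_Ropp, exp_ln by lra.
    assert (eL : e <= / L).
    { rewrite <- (exp_ln e), <- (exp_ln (/ L)), ln_Rinv by (try apply Rinv_0_lt_compat; lra).
      left. apply exp_increasing. unfold L in *. lra. }
    replace (6 * (M * (ln R0 - (ln r1 - 5)) / L) / exp (ln r1 - 3)) with (C1 * / L)
      by (unfold C1; field; pose proof (exp_pos (ln r1 - 3)); repeat split; lra).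
    replace (3 * (4 * e ^ 2) / e) with (12 * e) by (field; lra). lra. }
  assert (Rh : / rho <= exp (C2 + 2 / 3 * ln L)).
  { rewrite <- (exp_ln (/ rho)) by now apply Rinv_0_lt_compat. rewrite ln_Rinv by auto.
    destruct HC as [HC|HC]; [left; now apply exp_increasing|right; now rewrite HC]. }
  assert (Fin : angular_constant M e R0 r1 * exp 1 / rho <= eps / 2); [|lra].
  assert (A0 : 0 <= angular_constant M e R0 r1).
  { unfold angular_constant. apply Rplus_le_le_0_compat.
    - apply Rmult_le_pos; [|left; apply Rinv_0_lt_compat, exp_pos]. apply Rmult_le_pos; [lra|].
      apply Rmult_le_pos; [apply Rmult_le_pos; lra|]. left. apply Rinv_0_lt_compat. fold L. lra.
    - apply Rmult_le_pos; [pose proof (pow2_ge_0 e); lra|left; apply Rinv_0_lt_compat, exp_pos]. }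
  apply Rle_trans with ((C1 + 12) * exp (- ln L) * exp 1 * exp (C2 + 2 / 3 * ln L)).
  { unfold Rdiv. apply Rmult_le_compat; auto.
    - apply Rmult_le_pos; auto. left; apply exp_pos.
    - left. now apply Rinv_0_lt_compat.
    - apply Rmult_le_compat_r; auto. left; apply exp_pos. }
  rewrite !Rmult_assoc, <- !exp_plus.
  apply Rle_trans with ((C1 + 12) * exp (ln (eps / (2 * (C1 + 12))))).
  { apply Rmult_le_compat_l; [lra|]. left. apply exp_increasing. unfold K3 in L1. lra. }
  rewrite exp_ln by (apply Rdiv_lt_0_compat; lra). right. field. lra.
Qed.

End Limit.

(** * Diameter and inradius of the perforated domain *)

Lemma real_Lub_ge (P : R -> Prop) (y B : R) :
  P y -> (forall z, P z -> z <= B) -> y <= real (Lub_Rbar P).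
Proof.
  intros Hy HB. destruct (Lub_Rbar_correct P) as [U Lb].
  assert (H1 : Rbar_le y (Lub_Rbar P)) by now apply U.
  assert (H2 : Rbar_le (Lub_Rbar P) B) by (apply Lb; intros z Pz; now apply HB).
  destruct (Lub_Rbar P); simpl in *; tauto.
Qed.

Lemma real_Lub_le (P : R -> Prop) (y B : R) :
  P y -> (forall z, P z -> z <= B) -> real (Lub_Rbar P) <= B.
Proof.
  intros Hy HB. destruct (Lub_Rbar_correct P) as [U Lb].
  assert (H1 : Rbar_le y (Lub_Rbar P)) by now apply U.
  assert (H2 : Rbar_le (Lub_Rbar P) B) by (apply Lb; intros z Pz; now apply HB).
  destruct (Lub_Rbar P); simpl in *; tauto.
Qed.

Lemma eucl_dist_horizontal (p : plane) (h : R) : eucl_dist p (fst p + h, snd p) = Rabs h.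
Proof.
  rewrite eucl_dist_sqrt, <- sqrt_Rsqr_abs. f_equal. unfold dist2, Rsqr; simpl. ring.
Qed.

Lemma diam_le (D : plane -> Prop) (c q : plane) (R0 : R) :
  D q -> (forall p, D p -> eucl_dist c p <= R0) -> diam D <= 4 * R0.
Proof.
  intros Dq H. unfold diam. apply real_Lub_le with (eucl_dist q q); [now exists q, q|].
  intros z [p [p' [Dp [Dp' ->]]]].
  pose proof (H p Dp) as Hp. pose proof (H p' Dp') as Hp'. pose proof (eucl_dist_ge_0 c p).
  assert (A1 : forall a, D a -> Rabs (fst a - fst c) <= R0 /\ Rabs (snd a - snd c) <= R0).
  { intros a Da. pose proof (H a Da). pose proof (Rabs_fst_eucl_dist c a).
    pose proof (Rabs_snd_eucl_dist c a). lra. }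
  destruct (A1 p Dp) as [B1 B2]. destruct (A1 p' Dp') as [B3 B4].
  apply Rabs_le_between in B1. apply Rabs_le_between in B2.
  apply Rabs_le_between in B3. apply Rabs_le_between in B4.
  rewrite eucl_dist_sqrt, <- (sqrt_pow2 (4 * R0)) by lra. apply sqrt_le_1_alt. unfold dist2.
  assert (S1 : (fst p' - fst p) ^ 2 <= (2 * R0) ^ 2).
  { rewrite <- (pow2_abs (fst p' - fst p)). apply pow_incr. split; [apply Rabs_pos|]. apply Rabs_le; lra. }
  assert (S2 : (snd p' - snd p) ^ 2 <= (2 * R0) ^ 2).
  { rewrite <- (pow2_abs (snd p' - snd p)). apply pow_incr. split; [apply Rabs_pos|]. apply Rabs_le; lra. }
  pose proof (pow2_ge_0 R0). lra.
Qed.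

Lemma inrad_ge (D : plane -> Prop) (c z : plane) (R0 r : R) :
  (forall p, D p -> eucl_dist c p <= R0) -> 0 < r ->
  (forall p, eucl_dist z p < r -> D p) -> r <= inrad D.
Proof.
  intros H r0 Hz. unfold inrad. apply real_Lub_ge with (2 * R0); [split; auto; now exists z|].
  intros s [s0 [w Hw]].
  assert (Q1 : D (fst w + s / 2, snd w)).
  { apply Hw. rewrite eucl_dist_horizontal, Rabs_pos_eq; lra. }
  assert (Q2 : D (fst w + - (s / 2), snd w)).
  { apply Hw. rewrite eucl_dist_horizontal, Rabs_Ropp, Rabs_pos_eq; lra. }
  pose proof (H _ Q1). pose proof (H _ Q2).
  pose proof (Rabs_fst_eucl_dist c (fst w + s / 2, snd w)) as B1.
  pose proof (Rabs_fst_eucl_dist c (fst w + - (s / 2), snd w)) as B2. simpl in B1, B2.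
  pose proof (Rle_abs (fst w + s / 2 - fst c)). pose proof (Rcomplements.Rabs_maj2 (fst w + - (s / 2) - fst c)).
  lra.
Qed.

Lemma perforated_diam_inrad (D : plane -> Prop) (c : plane) (R0 r1 e : R) :
  (forall p, D p -> eucl_dist c p <= R0) -> 0 < r1 ->
  (forall p, eucl_dist c p <= r1 -> D p) -> 0 < e < r1 / 4 ->
  diam (perforated D c e) / inrad (perforated D c e) <= 16 * R0 / r1.
Proof.
  intros HR r10 Hr He.
  pose (z := (fst c + r1 / 2, snd c) : plane).
  assert (I : r1 / 4 <= inrad (perforated D c e)).
  { apply inrad_ge with c z R0; [intros p [Dp _]; auto|lra|].
    intros p Hp. pose proof (eucl_dist_pow2 c p) as E1. pose proof (eucl_dist_pow2 z p) as E2.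
    pose proof (eucl_dist_ge_0 c p) as P1. pose proof (eucl_dist_ge_0 z p) as P2.
    pose proof (Rabs_fst_eucl_dist z p) as F1. apply Rabs_le_between in F1.
    unfold dist2 in E1, E2. unfold z in E2, F1. cbn [fst snd] in E2, F1.
    assert (E2' : eucl_dist z p ^ 2 <= (r1 / 4) ^ 2) by (apply pow_incr; lra).
    fold z in F1. set (w1 := fst p - fst c) in *. set (w2 := snd p - snd c) in *.
    replace (fst p - (fst c + r1 / 2)) with (w1 - r1 / 2) in * by (unfold w1; ring).
    fold z in E2. split.
    - apply Hr. apply Rnot_lt_le. intros Hl.
      assert (r1 ^ 2 < eucl_dist c p ^ 2) by nra. nra.
    - unfold closed_disc. intros Hl.
      assert (eucl_dist c p ^ 2 <= e ^ 2) by (apply pow_incr; lra). 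
      pose proof (pow2_ge_0 w2). assert (w1 ^ 2 <= e ^ 2) by lra. nra. }
  assert (Hz : perforated D c e z).
  { unfold z. split.
    - apply Hr. rewrite eucl_dist_horizontal, Rabs_pos_eq; lra.
    - unfold closed_disc. rewrite eucl_dist_horizontal, Rabs_pos_eq; lra. }
  assert (Dm : diam (perforated D c e) <= 4 * R0).
  { apply diam_le with c z; auto. intros p [Dp _]; auto. }
  assert (R00 : 0 <= R0).
  { apply Rle_trans with (2 := HR z (proj1 Hz)). apply eucl_dist_ge_0. }
  set (i := inrad _) in *. set (dd := diam _) in *.
  apply Rle_trans with (4 * R0 / i).
  - apply Rmult_le_compat_r; auto. left. apply Rinv_0_lt_compat. lra.
  - replace (16 * R0 / r1) with (4 * R0 * / (r1 / 4)) by (field; lra).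
    apply Rmult_le_compat_l; [lra|]. apply Rinv_le_contravar; lra.
Qed.

Theorem mainTheorem2
  (Omega : plane -> Prop)
  (Omega_open : open Omega)
  (Omega_bounded : bounded_region Omega)
  (Omega_convex : convex Omega)
  (u0 : plane -> R)
  (u0_torsion : torsion_function Omega u0)
  (y0 : plane)
  (y0_max : max_point Omega u0 y0)
  (lambda1 lambda2 : R)
  (lambda_eigen : eigenvalue_pair (hessian u0 y0) lambda1 lambda2)
  (lambda_eq : lambda1 = lambda2)
  (eps0 : R)
  (eps0_pos : 0 < eps0)
  (eps0_small : forall eps : R, 0 < eps < eps0 ->
     forall p : plane, closed_disc y0 eps p -> Omega p)
  (u : R -> plane -> R)
  (u_torsion : forall eps : R, 0 < eps < eps0 ->
     torsion_function (perforated Omega y0 eps) (u eps))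
  (x : R -> plane)
  (x_max : forall eps : R, 0 < eps < eps0 ->
     max_point (perforated Omega y0 eps) (u eps) (x eps)) :
  filterlim (fun eps => lambda_max (hessian (u eps) (x eps)))
    (at_right 0) (locally 0)
  /\
  ~ (exists c1 c2 : R, 0 < c1 /\ 0 < c2 /\
       at_right 0 (fun eps =>
         lambda_max (hessian (u eps) (x eps)) <=
         - c1 * exp (- c2 * (diam (perforated Omega y0 eps) /
                             inrad (perforated Omega y0 eps))))).
Proof.
  subst lambda2.
  destruct (bounded_eucl_dist Omega y0 Omega_bounded) as [B [B0 HB]].
  pose (r1 := eps0 / 2). assert (r10 : 0 < r1) by (unfold r1; lra).
  pose (R0 := B + r1).
  assert (Hr1 : forall p, eucl_dist y0 p <= r1 -> Omega p).
  { intros p Hp. apply (eps0_small r1); [unfold r1; lra|exact Hp]. }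
  assert (HR0 : forall p, Omega p -> eucl_dist y0 p <= R0).
  { intros p Dp. specialize (HB p Dp). unfold R0. lra. }
  assert (R01 : r1 < R0) by (unfold R0; lra).
  pose proof (lambda_max_limit Omega u0 y0 lambda1 eps0 u x Omega_open Omega_bounded Omega_convex
    u0_torsion y0_max lambda_eigen eps0_pos u_torsion x_max R0 r1 r10 R01 Hr1 HR0) as Lim.
  split.
  - intros P [[d d0] HP]. unfold filtermap.
    generalize (Lim d d0). apply filter_imp. intros e He. apply HP.
    change (Rabs (lambda_max (hessian (u e) (x e)) - 0) < d). apply Rabs_def1; lra.
  - intros [c1 [c2 [c10 [c20 H]]]].
    pose (eps := c1 * exp (- c2 * (16 * R0 / r1))).
    assert (eps_pos : 0 < eps) by (apply Rmult_lt_0_compat; auto; apply exp_pos).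
    destruct (filter_ex (F := at_right 0) _ (filter_and _ _ H (filter_and _ _ (Lim eps eps_pos)
      (at_right_small (r1 / 4) ltac:(lra))))) as [e [H1 [H2 H3]]].
    pose proof (perforated_diam_inrad Omega y0 R0 r1 e HR0 r10 Hr1 H3) as Q.
    set (q := diam _ / inrad _) in *.
    assert (eps <= c1 * exp (- c2 * q)); [|lra].
    unfold eps. apply Rmult_le_compat_l; [lra|].
    assert (Q2 : - c2 * (16 * R0 / r1) <= - c2 * q) by (assert (c2 * q <= c2 * (16 * R0 / r1)) by (apply Rmult_le_compat_l; lra); lra).
    destruct Q2 as [Q2|Q2]; [left; now apply exp_increasing|right; now rewrite Q2].
Qed.
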